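(* Let $f_n\in L^2_+(\mathbb R)$ with $\|f_n\|_{L^2(\mathbb R)}^2=2\pi$, and suppose that $f_n\to f$ strongly in $L^2(\mathbb R)$. Assume that for every $A<\infty$, $$\delta_n(A):=\sup_{0\le a\le A}\left\{\|S_a^*f_n\|_{L^2(\mathbb R)}^2-\frac{|\langle S_a^*f_n,f_n\rangle|^2}{2\pi}\right\}\to0\qquad(n\to\infty).$$ Then there are $\alpha>0$, $\beta\in\mathbb R$ and $\vartheta\in\mathbb R/2\pi\mathbb Z$ such that $f=\mathcal M_{\alpha,\beta,0,\vartheta}R$.
   Context: $\mathcal F_0f(\xi)=(2\pi)^{-1/2}\int_{\mathbb R}e^{-ix\xi}f(x)\,dx$. $L^2_+(\mathbb R)$ is the space of $f\in L^2(\mathbb R)$ with $\mathcal F_0f$ supported in $[0,\infty)$. For $a\ge0$ the backward shift $S_a^*$ on $L^2_+(\mathbb R)$ is defined by $[\mathcal F_0(S_a^*f)](\zeta)=(\mathcal F_0f)(\zeta+a)$ for $\zeta\ge0$ (and $0$ for $\zeta<0$). $R(x)=\frac{\sqrt2}{x+i}$, and $[\mathcal M_{\lambda,y,\xi,\theta}g](x)=\lambda^{-1/2}e^{i\theta}e^{i\xi(x-y)}g\bigl(\frac{x-y}{\lambda}\bigr)$. *)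

(* Defs.v *)
From HB Require Import structures.
From mathcomp Require Import all_boot all_order all_algebra.
From mathcomp Require Import all_classical all_reals all_analysis.
From mathcomp Require Export complex.
Import Order.TTheory GRing.Theory Num.Theory.
Import numFieldNormedType.Exports.

Set Implicit Arguments.
Unset Strict Implicit.
Unset Printing Implicit Defensive.

Local Open Scope classical_set_scope.
Local Open Scope complex_scope.
Local Open Scope ring_scope.

(* Elements of L^2(R) are represented by Borel functions R -> R[i]; equalities
   between them are understood almost everywhere. *)
Section L2.
Context {R : realType}.
Local Notation mu := (@lebesgue_measure R).
Implicit Types f g : R -> R[i].

Definition expi (t : R) : R[i] := cos t +i* sin t.

Definition cmeasurable f : Prop :=
  measurable_fun setT (fun x => complex.Re (f x)) /\
  measurable_fun setT (fun x => complex.Im (f x)).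

Definition cintegral (D : set R) f : R[i] :=
  Rintegral mu D (fun x => complex.Re (f x)) +i* Rintegral mu D (fun x => complex.Im (f x)).

Definition L2norm f : \bar R :=
  Lnorm mu 2%:E (fun x => (Normc.normc (f x))%:E).

Definition L2 : set (R -> R[i]) :=
  [set f | cmeasurable f /\ (L2norm f < +oo)%E].

Definition inner f g : R[i] := cintegral setT (fun x => f x * (g x)^*).

(* Fourier-Plancherel transform: the integral over R is the L^2-limit of the
   integrals over [-k, k]. *)
Definition fourier_trunc (k : nat) f : R -> R[i] := fun xi =>
  ((Num.sqrt (2 * pi))^-1)%:C *
  cintegral `[- k%:R, k%:R] (fun x => expi (- (x * xi)) * f x).

Definition is_fourier f g : Prop :=
  L2 g /\ L2norm (fourier_trunc k f \- g) @[k --> \oo] --> 0%E.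

(* By Plancherel's theorem [is_fourier f] holds for exactly one class modulo
   a.e. equality when [f] is in [L2]; [xget] selects a representative. *)
Definition fourier f : R -> R[i] := xget (cst 0) [set g | is_fourier f g].

Definition hardyL2 : set (R -> R[i]) :=
  [set f | L2 f /\ {ae mu, forall xi, xi < 0 -> fourier f xi = 0}].

Definition is_backshift (a : R) f h : Prop :=
  hardyL2 h /\
  {ae mu, forall zeta,
    fourier h zeta = if 0 <= zeta then fourier f (zeta + a) else 0}.

(* [S_a^* f], determined up to a.e. equality by its Fourier transform. *)
Definition backshift (a : R) f : R -> R[i] :=
  xget (cst 0) [set h | is_backshift a f h].

(* The supremum is taken in [\bar R], so that it is never a default value;
   it is meant for [0 <= A] (for [A < 0] it would be [-oo]). *)
Definition delta (A : R) f : \bar R :=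
  ereal_sup [set (L2norm (backshift a f) ^+ 2 -
    ((Normc.normc (inner (backshift a f) f)) ^+ 2 / (2 * pi))%:E)%E
    | a in `[0, A]].

Definition ratR : R -> R[i] := fun x => (Num.sqrt 2)%:C / (x +i* 1).

Definition Mop (lambda y xi theta : R) g : R -> R[i] := fun x =>
  ((Num.sqrt lambda)^-1)%:C * expi theta * expi (xi * (x - y)) *
  g ((x - y) / lambda).

End L2.

(* Main.v *)
Require Import Defs.
From mathcomp Require Import all_boot all_order all_algebra.
From mathcomp Require Import all_classical all_reals all_analysis.
From mathcomp Require Import measurable_realfun.
From mathcomp Require Import ring lra.
Import Order.TTheory GRing.Theory Num.Theory.
Import numFieldNormedType.Exports.
Import Normc.

(** Write F for the Fourier transform of the limit f. The quantity under the supremum in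
    the hypothesis is the deficit in the Cauchy-Schwarz inequality between the shift of f_n
    by a and f_n itself. Backward shifts are contractions of L^2, so for each a this
    deficit is continuous along f_n -> f; it tends to 0, and equality holds for f. Hence
    F(. + a) = c(a) F on the half line for every a >= 0, that is, f is an eigenvector of all
    the backward shifts ([limit_shift]). The frequencies of f are still nonnegative
    ([limit_hardy]), and its norm is still the one of the f_n ([limit_norm]).

    Formally such an F is an exponential and f a simple fraction. To avoid measurability
    and regularity questions about c, the fraction is found directly. For some A the norm
    of F on [A, oo) is less than its total norm, so |c(A)| < 1 and F is integrable
    ([eigenfunction_L1]); its Laplace transform G(z), the integral of e^(izv) F(v), is
    defined for Im z >= 0. Average the transforms of the shifts of F with weight e^(-a) over
    a >= 0. By the eigenvalue equation the average is rho G(z) with a constant rho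
    ([resolvent_prop]); by exchanging the integrals it is (G(i) - G(z)) / (-1 - iz)
    ([resolvent_eval]). Therefore G(z) (1 - rho - i rho z) = G(i) ([lap_rational]). Since f
    is, up to a constant, G on the real line, and is neither zero nor constant, rho and G(i)
    are not zero, so the pole is not in the closed upper half plane. Thus f is a constant
    over x - beta + i alpha with alpha > 0, and the norm of f fixes the modulus of the
    constant ([rational_Mop]).

    All this rests on the theory of the Fourier transform on L^2. For integrable functions
    the multiplication formula [FT_mul], applied twice with the damping factor
    e^(-e|xi|), expresses a damped inner product of transforms by the Poisson kernel
    ([damped_plancherel]). Schur's test for this kernel and Fatou's lemma show that the
    transform is a contraction in the L^2 norm ([FT_contraction]); with the completeness
    of L^2 ([L2_complete]) it extends to L^2. Letting e tend to 0, with the indicator of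
    an interval as one of the functions, gives the inversion formula
    ([fourier_inversion]). A contraction whose inverse is a contraction is an isometry
    ([plancherel]), and it is onto ([fourier_surj]), so that the backward shift of every
    L^2 function exists and acts on the Fourier side as it should ([backshiftP]). *)

Set Implicit Arguments.
Unset Strict Implicit.
Unset Printing Implicit Defensive.

Local Open Scope classical_set_scope.
Local Open Scope complex_scope.
Local Open Scope ring_scope.

Local Notation Re := complex.Re.
Local Notation Im := complex.Im.

(** * Complex numbers and measurable complex functions *)

Section complex_basics.
Context {R : realType}.
Implicit Types (z w : R[i]) (a b t : R).

Lemma ReD z w : Re (z + w) = Re z + Re w. Proof. by case: z; case: w. Qed.
Lemma ImD z w : Im (z + w) = Im z + Im w. Proof. by case: z; case: w. Qed.
Lemma ReN z : Re (- z) = - Re z. Proof. by case: z. Qed.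
Lemma ImN z : Im (- z) = - Im z. Proof. by case: z. Qed.
Lemma ReM z w : Re (z * w) = Re z * Re w - Im z * Im w.
Proof. by case: z; case: w. Qed.
Lemma ImM z w : Im (z * w) = Re z * Im w + Im z * Re w.
Proof. by case: z; case: w. Qed.
Lemma ReJ z : Re z^* = Re z. Proof. by case: z. Qed.
Lemma ImJ z : Im z^* = - Im z. Proof. by case: z. Qed.

Definition ReImE := (ReD, ImD, ReN, ImN, ReM, ImM, ReJ, ImJ).

Lemma ceqP z w : Re z = Re w -> Im z = Im w -> z = w.
Proof. by case: z; case: w => a b c d /= -> ->. Qed.

Lemma normc_sqr z : normc z ^+ 2 = Re z ^+ 2 + Im z ^+ 2.
Proof. by case: z => a b; rewrite /normc sqr_sqrtr// addr_ge0// sqr_ge0. Qed.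

Lemma normc_ge0 z : 0 <= normc z.
Proof. by case: z => a b; exact: sqrtr_ge0. Qed.

Lemma normcE z : normc z = Num.sqrt (Re z ^+ 2 + Im z ^+ 2).
Proof. by case: z. Qed.

Lemma normc_eq0 z : (normc z == 0) = (z == 0).
Proof. by apply/eqP/eqP => [/eq0_normc|->]//; exact: normc0. Qed.

Lemma normc_gt0 z : (0 < normc z) = (z != 0).
Proof. by rewrite lt_neqAle normc_ge0 andbT eq_sym normc_eq0. Qed.

Lemma normcR a : normc a%:C = `|a|.
Proof. by rewrite normcE /= expr0n addr0 sqrtr_sqr. Qed.

Lemma normcJ z : normc z^* = normc z.
Proof. by rewrite !normcE ReJ ImJ sqrrN. Qed.

Lemma normcB z w : normc (z - w) = normc (w - z).
Proof. by rewrite -normcN opprB. Qed.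

Lemma normc_leD z w : normc (z + w) <= normc z + normc w.
Proof. exact: le_normcD. Qed.

Lemma normc_leB z w : normc (z - w) <= normc z + normc w.
Proof. by rewrite -(normcN w); exact: le_normcD. Qed.

Lemma Re_le_normc z : `|Re z| <= normc z.
Proof.
rewrite -ler_sqr ?nnegrE ?normc_ge0// real_normK ?num_real// normc_sqr.
by rewrite lerDl sqr_ge0.
Qed.

Lemma Im_le_normc z : `|Im z| <= normc z.
Proof.
rewrite -ler_sqr ?nnegrE ?normc_ge0// real_normK ?num_real// normc_sqr.
by rewrite lerDr sqr_ge0.
Qed.

Lemma normc_le_ReIm z : normc z <= `|Re z| + `|Im z|.
Proof.
rewrite -ler_sqr ?nnegrE ?addr_ge0 ?normc_ge0// normc_sqr.
rewrite -[X in X + _ <= _]real_normK ?num_real//.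
rewrite -[X in _ + X <= _]real_normK ?num_real// sqrrD.
by rewrite -addrA lerD2l lerDr mulrn_wge0// mulr_ge0.
Qed.

Lemma conjcM z w : (z * w)^* = z^* * w^*.
Proof. by apply: ceqP; rewrite !ReImE; ring. Qed.

Lemma conjcB z w : (z - w)^* = z^* - w^*.
Proof. by apply: ceqP; rewrite !ReImE; ring. Qed.

Lemma conjcK z : z^*^* = z.
Proof. by apply: ceqP; rewrite !ReImE ?opprK. Qed.

Lemma mulcJ z : z * z^* = (normc z ^+ 2)%:C.
Proof.
by apply: ceqP; rewrite ?ReImE normc_sqr /=; [ring|ring].
Qed.

Lemma normc_expi t : normc (expi t : R[i]) = 1.
Proof. by rewrite normcE /= cos2Dsin2 sqrtr1. Qed.

Lemma expiD s t : expi (s + t) = expi s * expi t :> R[i].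
Proof. by apply: ceqP; rewrite ?ReImE /= ?cosD ?sinD; ring. Qed.

Lemma expiJ t : (expi t)^* = expi (- t) :> R[i].
Proof. by rewrite /expi /= cosN sinN. Qed.

Lemma expi0 : expi 0 = 1 :> R[i].
Proof. by rewrite /expi cos0 sin0. Qed.

(** The phase comes from the arccosine of the real part of z/|z|, its sign from the
    sign of the imaginary part. *)
Lemma polar z : exists t, z = (normc z)%:C * expi t.
Proof.
have [->|z0] := eqVneq z 0; first by exists 0; rewrite normc0 mul0r.
have n0 : 0 < normc z by rewrite normc_gt0.
pose a := Re z / normc z; pose b := Im z / normc z.
have ab : a ^+ 2 + b ^+ 2 = 1.
  rewrite /a /b !expr_div_n -mulrDl -normc_sqr divff//.
  by rewrite expf_eq0/= gt_eqF.
have a1 : -1 <= a <= 1.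
  by rewrite -ler_norml -ler_sqr ?nnegrE// real_normK ?num_real// expr1n -ab lerDl sqr_ge0.
have zE : z = (normc z)%:C * (a +i* b).
  by apply: ceqP; rewrite ?ReImE/= mul0r ?subr0 ?addr0 mulrCA divff ?mulr1// gt_eqF.
have sq : Num.sqrt (1 - a ^+ 2) = `|b| by rewrite -ab addrAC subrr add0r sqrtr_sqr.
have [b0|b0] := leP 0 b.
  exists (acos a); rewrite {1}zE /expi acosK ?sin_acos ?sq ?ger0_norm//.
exists (- acos a); rewrite {1}zE /expi cosN sinN acosK ?sin_acos ?sq ?ltr0_norm ?opprK//.
Qed.

End complex_basics.

Section cmeas.
Context {R : realType} d (T : measurableType d).
Implicit Types (f g : T -> R[i]) (r : T -> R).

(** Stated over an arbitrary measurable space because the integrands of the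
    Fubini arguments live on the plane. *)
Definition cmeas f : Prop :=
  measurable_fun setT (fun x => Re (f x)) /\
  measurable_fun setT (fun x => Im (f x)).

Lemma cmeas_cst c : cmeas (fun=> c). Proof. by split. Qed.

Lemma cmeasD f g : cmeas f -> cmeas g -> cmeas (fun x => f x + g x).
Proof.
move=> [f1 f2] [g1 g2]; split; under eq_fun do rewrite ReImE;
  exact: measurable_funD.
Qed.

Lemma cmeasM f g : cmeas f -> cmeas g -> cmeas (fun x => f x * g x).
Proof.
move=> [f1 f2] [g1 g2]; split; under eq_fun do rewrite ReImE.
  by apply: measurable_funB; exact: measurable_funM.
by apply: measurable_funD; exact: measurable_funM.
Qed.

Lemma cmeasJ f : cmeas f -> cmeas (fun x => (f x)^*).
Proof.
move=> [f1 f2]; split.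
  by rewrite (_ : (fun x => _) = (fun x => Re (f x)))//; apply/funext => x; rewrite ReJ.
rewrite (_ : (fun x => _) = \- (fun x => Im (f x))); first exact: measurable_funN.
by apply/funext => x; rewrite ImJ.
Qed.

Lemma cmeasZ c f : cmeas f -> cmeas (fun x => c * f x).
Proof. by apply: cmeasM; exact: cmeas_cst. Qed.

Lemma cmeasN f : cmeas f -> cmeas (fun x => - f x).
Proof.
move=> mf; rewrite (_ : (fun x => _) = (fun x => (-1) * f x)); first exact: cmeasZ.
by apply/funext => x; rewrite mulN1r.
Qed.

Lemma cmeasB f g : cmeas f -> cmeas g -> cmeas (fun x => f x - g x).
Proof. by move=> mf mg; apply: cmeasD => //; exact: cmeasN. Qed.

Lemma cmeasR r : measurable_fun setT r -> cmeas (fun x => (r x)%:C).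
Proof. by move=> mr; split. Qed.

Lemma cmeas_normc f : cmeas f -> measurable_fun setT (fun x => normc (f x)).
Proof.
move=> [f1 f2].
have -> : (fun x => normc (f x)) =
    Num.sqrt \o (fun x => Re (f x) ^+ 2 + Im (f x) ^+ 2).
  by apply/funext => x; exact: normcE.
apply: measurableT_comp.
  by apply: continuous_measurable_fun; exact: sqrt_continuous.
by apply: measurable_funD; exact: measurable_funX.
Qed.

Lemma cmeas_expi r : measurable_fun setT r -> cmeas (fun x => expi (r x)).
Proof.
move=> mr; split => /=; apply: measurableT_comp mr => //;
  apply: continuous_measurable_fun;
  [exact: continuous_cos|exact: continuous_sin].
Qed.

End cmeas.

Lemma cmeas_comp {R : realType} d d' (T : measurableType d)
    (T' : measurableType d') (f : T -> R[i]) (p : T' -> T) :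
  measurable_fun setT p -> cmeas f -> cmeas (f \o p).
Proof.
by move=> mp [f1 f2]; split; [exact: (measurableT_comp f1)|exact: (measurableT_comp f2)].
Qed.

(** * Integrable complex functions on the line *)

Section almost_everywhere.
Context {R : realType}.
Local Notation mu := (@lebesgue_measure R).
Implicit Types P Q S : R -> Prop.

Lemma ae_imp P Q : (forall x, P x -> Q x) ->
  {ae mu, forall x, P x} -> {ae mu, forall x, Q x}.
Proof. by move=> PQ; apply: filterS; first exact: (ae_filter_ringOfSetsType mu). Qed.

Lemma ae_imp2 P Q S : (forall x, P x -> Q x -> S x) ->
  {ae mu, forall x, P x} -> {ae mu, forall x, Q x} -> {ae mu, forall x, S x}.
Proof. by move=> PQ; apply: filterS2; first exact: (ae_filter_ringOfSetsType mu). Qed.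

Lemma ae_neq (a : R) : {ae mu, forall x : R, x != a}.
Proof.
exists [set a]; split => //; first exact: lebesgue_measure_set1.
by move=> x /= /negP; rewrite negbK => /eqP.
Qed.

End almost_everywhere.

Section L1.
Context {R : realType}.
Local Notation mu := (@lebesgue_measure R).
Implicit Types (f g : R -> R[i]) (c : R[i]) (a : R).

(** As for L^2, elements of L^1 are functions, and [cI] is the integral over the
    whole line. *)
Definition L1 f : Prop :=
  cmeasurable f /\ (\int[mu]_x (normc (f x))%:E < +oo)%E.

Definition cI f : R[i] := cintegral setT f.

Lemma measurable_normcE f : cmeasurable f ->
  measurable_fun [set: R] (fun x => (normc (f x))%:E).
Proof. by move=> mf; apply/measurable_EFinP; exact: cmeas_normc. Qed.

Lemma L1_int f : L1 f -> mu.-integrable setT (fun x => (normc (f x))%:E).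
Proof.
move=> [mf fi]; apply/integrableP; split; first exact: measurable_normcE.
by under eq_integral do rewrite gee0_abs ?lee_fin ?normc_ge0//.
Qed.

Lemma L1_dom f (h : R -> R) : cmeasurable f ->
  (forall x, normc (f x) <= h x) -> mu.-integrable setT (EFin \o h) -> L1 f.
Proof.
move=> mf fh /integrableP[mh hi]; split=> //; apply: le_lt_trans hi.
apply: ge0_le_integral => //=.
- by move=> x _; rewrite lee_fin normc_ge0.
- exact: measurable_normcE.
- by do 2 apply: measurableT_comp => //; exact/measurable_EFinP.
- by move=> x _; rewrite lee_fin (le_trans (fh x))// ler_norm.
Qed.

Lemma L1_le f g : cmeasurable f -> L1 g ->
  (forall x, normc (f x) <= normc (g x)) -> L1 f.
Proof. by move=> mf /L1_int ig fg; exact: (L1_dom mf fg). Qed.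

Lemma L1_Re f : L1 f -> mu.-integrable setT (fun x => (Re (f x))%:E).
Proof.
move=> fi; have := L1_int fi; apply: le_integrable => //.
  by apply/measurable_EFinP; exact: fi.1.1.
by move=> x _ /=; rewrite lee_fin (le_trans (Re_le_normc _))// ler_norm.
Qed.

Lemma L1_Im f : L1 f -> mu.-integrable setT (fun x => (Im (f x))%:E).
Proof.
move=> fi; have := L1_int fi; apply: le_integrable => //.
  by apply/measurable_EFinP; exact: fi.1.2.
by move=> x _ /=; rewrite lee_fin (le_trans (Im_le_normc _))// ler_norm.
Qed.

Lemma L1D f g : L1 f -> L1 g -> L1 (fun x => f x + g x).
Proof.
move=> f1 g1; apply: (L1_dom (h := fun x => normc (f x) + normc (g x))).
- by apply: cmeasD; [exact: f1.1|exact: g1.1].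
- by move=> x; exact: normc_leD.
- exact: (integrableD _ (L1_int f1) (L1_int g1)).
Qed.

Lemma L1_bndM f g a : cmeasurable g -> (forall x, normc (g x) <= a) -> L1 f ->
  L1 (fun x => g x * f x).
Proof.
move=> mg ga f1; apply: (L1_dom (h := fun x => a * normc (f x))).
- by apply: cmeasM => //; exact: f1.1.
- by move=> x; rewrite normcM ler_wpM2r ?normc_ge0.
- exact: (integrableZl _ a (L1_int f1)).
Qed.

Lemma L1Z c f : L1 f -> L1 (fun x => c * f x).
Proof. by apply: (@L1_bndM _ _ (normc c)) => //; exact: cmeas_cst. Qed.

Lemma L1B f g : L1 f -> L1 g -> L1 (fun x => f x - g x).
Proof.
move=> f1 g1; rewrite (_ : (fun x => _) = (fun x => f x + (-1) * g x)).
  by apply: L1D => //; exact: L1Z.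
by apply/funext => x; rewrite mulN1r.
Qed.

Lemma L1J f : L1 f -> L1 (fun x => (f x)^*).
Proof.
move=> f1; apply: (L1_le _ f1); first by apply: cmeasJ; exact: f1.1.
by move=> x; rewrite normcJ.
Qed.

Lemma cID f g : L1 f -> L1 g -> cI (fun x => f x + g x) = cI f + cI g.
Proof.
move=> f1 g1; apply: ceqP; rewrite ReImE /= -RintegralD//;
  by [apply: eq_Rintegral => x _; rewrite ReImE|exact: L1_Re|exact: L1_Im].
Qed.

Lemma cIZ c f : L1 f -> cI (fun x => c * f x) = c * cI f.
Proof.
move=> f1; have [fr fi] := (L1_Re f1, L1_Im f1).
have fZ k : (mu.-integrable setT (EFin \o (fun x => k * Re (f x)))%R)%E.
  exact: (integrableZl _ k fr).
have gZ k : (mu.-integrable setT (EFin \o (fun x => k * Im (f x)))%R)%E.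
  exact: (integrableZl _ k fi).
apply: ceqP; rewrite ReImE /= -!RintegralZl//.
  by rewrite -RintegralB//; apply: eq_Rintegral => x _; rewrite ReImE.
by rewrite -RintegralD//; apply: eq_Rintegral => x _; rewrite ReImE.
Qed.

Lemma cIB f g : L1 f -> L1 g -> cI (fun x => f x - g x) = cI f - cI g.
Proof.
move=> f1 g1; rewrite -mulN1r -cIZ// -cID//; last exact: L1Z.
by congr cI; apply/funext => x; rewrite mulN1r.
Qed.

Lemma cIJ f : L1 f -> cI (fun x => (f x)^*) = (cI f)^*.
Proof.
move=> f1; apply: ceqP; rewrite ReImE /=.
  by apply: eq_Rintegral => x _; rewrite ReJ.
rewrite -[RHS]mulN1r -RintegralZl//; last exact: L1_Im.
by apply: eq_Rintegral => x _; rewrite ImJ mulN1r.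
Qed.

Lemma cI0 : cI (cst 0) = 0.
Proof. by apply: ceqP => /=; rewrite /Rintegral integral0. Qed.

Lemma cI_ae f g : cmeasurable f -> cmeasurable g ->
  {ae mu, forall x, f x = g x} -> cI f = cI g.
Proof.
move=> mf mg fg; apply: ceqP; rewrite /= /Rintegral; congr fine;
  (apply: ae_eq_integral => //; [apply/measurable_EFinP|apply/measurable_EFinP|]);
  rewrite ?(mf.1, mf.2, mg.1, mg.2)//.
- exact: mf.1.
- exact: mg.1.
- by apply: ae_imp fg => x /= -> _.
- exact: mf.2.
- exact: mg.2.
- by apply: ae_imp fg => x /= -> _.
Qed.

(** Multiplying [f] by a constant phase makes its integral a nonnegative real, which is
    the integral of a real part and so at most the integral of the modulus. *)
Lemma normc_cI f : L1 f -> ((normc (cI f))%:E <= \int[mu]_x (normc (f x))%:E)%E.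
Proof.
move=> f1; have [t ft] := polar (cI f).
have f2 : L1 (fun x => expi (- t) * f x) by exact: L1Z.
have e : normc (cI f) = Re (cI (fun x => expi (- t) * f x)).
  rewrite cIZ// [in RHS]ft mulrCA -expiD addNr expi0 mulr1.
  by [].
rewrite e /= /Rintegral fineK; last first.
  by apply: integrable_fin_num => //; exact: L1_Re.
apply: le_integral => //; [exact: L1_Re|exact: L1_int|].
move=> x _; rewrite lee_fin (le_trans (ler_norm _))// (le_trans (Re_le_normc _))//.
by rewrite normcM normc_expi mul1r.
Qed.

End L1.

(** * Translations, reflections and dominated convergence *)

Section invariance.
Context {R : realType}.
Local Notation mu := (@lebesgue_measure R).
Implicit Types (f g : R -> R[i]) (phi : R -> R).

Definition mu_preserving phi :=
  measurable_fun setT phi /\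
  forall A, measurable A -> mu (phi @^-1` A) = mu A.

(** Lebesgue measure is determined by its values on half-open intervals. *)
Lemma mu_preserving_itv phi : measurable_fun setT phi ->
  (forall a b, a < b -> mu (phi @^-1` `]a, b]%classic) = (b - a)%:E) ->
  mu_preserving phi.
Proof.
move=> mphi H; split=> // A mA.
have mphi' : @measurable_fun _ _ (measurableTypeR R) (measurableTypeR R) setT phi by exact: mphi.
pose nu : {measure set (measurableTypeR R) -> \bar R} :=
  pushforward mu (phi : measurableTypeR R -> measurableTypeR R).
suff H2 X : ocitv X -> mu X = nu mphi' X.
  exact/esym/(lebesgue_measure_unique (mu := nu mphi') H2 mA).
case=> -[a b] /= _ <-.
have [ab|ba] := ltP a b.
  by rewrite lebesgue_measure_itv /= lte_fin ab -EFinD /pushforward H.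
by rewrite set_itv_ge ?bnd_simp -?leNgt// measure0 /pushforward preimage_set0 measure0.
Qed.

Lemma mu_preserving_shift (a : R) : mu_preserving (fun x => x + a).
Proof.
apply: mu_preserving_itv; first exact: measurable_funD.
move=> u v uv.
have -> : (fun x => x + a) @^-1` `]u, v]%classic = `]u - a, v - a]%classic.
  by apply/seteqP; split => x /=; rewrite !in_itv /= ltrBlDr lerBrDr.
by rewrite lebesgue_measure_itv /= lte_fin ltrD2r uv -EFinD; congr EFin; ring.
Qed.

Lemma mu_preserving_opp : mu_preserving (fun x => - x).
Proof.
apply: mu_preserving_itv; first exact: oppr_measurable.
move=> u v uv.
have -> : (fun x => - x) @^-1` `]u, v]%classic = `[- v, - u[%classic.
  by apply/seteqP; split => x /=; rewrite !in_itv /= ltrNr lerNl andbC.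
by rewrite lebesgue_measure_itv /= lte_fin ltrN2 uv -EFinD; congr EFin; ring.
Qed.

Section preserving.
Variable phi : R -> R.
Hypothesis hphi : mu_preserving phi.

Lemma ae_preserving (P : R -> Prop) :
  {ae mu, forall x, P x} -> {ae mu, forall x, P (phi x)}.
Proof.
move=> [N [mN N0 PN]]; exists (phi @^-1` N); split.
- by rewrite -[X in measurable X]setTI; exact: hphi.1.
- by rewrite hphi.2.
- by move=> x /= Px; apply: PN.
Qed.

Lemma cmeas_preserving f : cmeasurable f -> cmeasurable (f \o phi).
Proof. by apply: cmeas_comp; exact: hphi.1. Qed.

Lemma ge0_integral_preserving (f : R -> \bar R) : measurable_fun setT f ->
  (forall x, 0 <= f x)%E -> (\int[mu]_x f (phi x) = \int[mu]_x f x)%E.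
Proof.
move=> mf f0; have := @ge0_integral_pushforward _ _ (measurableTypeR R) (measurableTypeR R) R phi hphi.1 mu setT f.
rewrite preimage_setT /= => <- //.
by apply: eq_measure_integral => [|? A mA _]; [exact: hphi.1|exact: (hphi.2 A mA)].
Qed.

Lemma L1_preserving f : L1 f -> L1 (f \o phi).
Proof.
move=> [mf fi]; split; first exact: cmeas_preserving.
rewrite (ge0_integral_preserving (f := fun x => (normc (f x))%:E))//.
- exact: measurable_normcE.
- by move=> x; rewrite lee_fin normc_ge0.
Qed.

Lemma integral_preserving (f : R -> R) : mu.-integrable setT (EFin \o f) ->
  mu.-integrable setT (EFin \o (f \o phi)) ->
  (\int[mu]_x f (phi x) = \int[mu]_x f x)%R.
Proof.
move=> fi fphi; rewrite /Rintegral; congr fine.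
have := @integral_pushforward _ _ (measurableTypeR R) (measurableTypeR R) R phi hphi.1 mu setT (EFin \o f).
rewrite preimage_setT /= => <- //; last exact: (measurable_int mu fi).
by apply: eq_measure_integral => [|? A mA _]; [exact: hphi.1|exact: (hphi.2 A mA)].
Qed.

Lemma cI_preserving f : L1 f -> cI (f \o phi) = cI f.
Proof.
move=> f1; have f2 := L1_preserving f1.
apply: ceqP => /=.
  by rewrite (integral_preserving (f := fun x => Re (f x)))//; exact: L1_Re.
by rewrite (integral_preserving (f := fun x => Im (f x)))//; exact: L1_Im.
Qed.

End preserving.
End invariance.

Section limits.
Context {R : realType}.
Local Notation mu := (@lebesgue_measure R).
Implicit Types (f g : R -> R[i]) (u v : nat -> R[i]) (l : R[i]).

(** Every limit of complex numbers below is the vanishing of a real sequence of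
    errors, so that squeeze arguments take place in the reals. *)
Definition ccvg u l := normc (u n - l) @[n --> \oo] --> (0 : R).

Lemma ccvg_le u l (e : nat -> R) : (forall n, normc (u n - l) <= e n) ->
  e n @[n --> \oo] --> (0 : R) -> ccvg u l.
Proof.
move=> ue e0; apply: (@squeeze_cvgr _ _ _ _ (cst 0) e) => //.
  by near=> n; rewrite normc_ge0 ue.
exact: cvg_cst.
Unshelve. all: by end_near. Qed.

Lemma ccvg_unique u l l' : ccvg u l -> ccvg u l' -> l = l'.
Proof.
move=> ul ul'; apply/eqP; rewrite -subr_eq0 -normc_eq0; apply/eqP.
have : ccvg (fun=> l) l'.
  apply: (@ccvg_le _ _ (fun n => normc (u n - l) + normc (u n - l'))).
    move=> n; rewrite [normc (u n - l)]normcB.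
    by rewrite (le_trans _ (normc_leD _ _))// addrA subrK.
  by rewrite -[X in _ --> X]addr0; exact: cvgD.
move=> h; apply: (cvg_unique (@Rhausdorff R) _ h); exact: cvg_cst.
Qed.

Lemma ccvgZ c u l : ccvg u l -> ccvg (fun n => c * u n) (c * l).
Proof.
move=> ul; apply: (@ccvg_le _ _ (fun n => normc c * normc (u n - l))).
  by move=> n; rewrite -mulrBr normcM.
by rewrite -[X in _ --> X](mulr0 (normc c)); apply: cvgM => //; exact: cvg_cst.
Qed.

Lemma ccvg_ReIm u l : Re (u n) @[n --> \oo] --> Re l ->
  Im (u n) @[n --> \oo] --> Im l -> ccvg u l.
Proof.
move=> ul vl; apply: (@ccvg_le _ _ (fun n => `|Re (u n) - Re l| + `|Im (u n) - Im l|)).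
  by move=> n; rewrite (le_trans (normc_le_ReIm _))// !ReImE.
rewrite -[X in _ --> X]addr0; apply: cvgD.
  rewrite -[X in _ --> X](normr0 R); apply: cvg_norm.
  by rewrite -[X in _ --> X](subrr (Re l)); apply: cvgB => //; exact: cvg_cst.
rewrite -[X in _ --> X](normr0 R); apply: cvg_norm.
by rewrite -[X in _ --> X](subrr (Im l)); apply: cvgB => //; exact: cvg_cst.
Qed.

Lemma ccvg_normc u l : ccvg u l -> normc (u n) @[n --> \oo] --> normc l.
Proof.
move=> ul; apply/cvgrPdist_le => e e0; move/cvgr0_norm_le: ul => /(_ e e0).
apply: filterS => n; rewrite ger0_norm ?normc_ge0// => ule; apply: le_trans ule.
rewrite ler_norml; apply/andP; split.
  by rewrite lerNl opprB lerBlDr (le_trans _ (normc_leD _ _))// subrK.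
by rewrite lerBlDr normcB (le_trans _ (normc_leD _ _))// subrK.
Qed.

Lemma dominated_L1 (u : nat -> R -> R[i]) f (h : R -> R) :
  (forall n, cmeasurable (u n)) -> cmeasurable f ->
  {ae mu, forall x, ccvg (u^~ x) (f x)} ->
  (forall n x, normc (u n x - f x) <= h x) ->
  mu.-integrable setT (EFin \o h) ->
  (\int[mu]_x (normc (u n x - f x))%:E @[n --> \oo] --> 0)%E.
Proof.
move=> mu_ mf uf uh hi.
have mn n : measurable_fun [set: R] (fun x => (normc (u n x - f x))%:E).
  exact: (measurable_normcE (cmeasB (mu_ n) mf)).
have [] := @dominated_convergence _ _ _ mu setT measurableT
  (fun n x => (normc (u n x - f x))%:E) (cst 0)%E (EFin \o h).
- exact: mn.
- exact: measurable_cst.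
- by apply: ae_imp uf => x ux _; apply: cvg_EFin => //; exact: nearW.
- exact: hi.
- apply: aeW => x n _ /=; rewrite lee_fin ger0_norm ?normc_ge0//.
- by move=> _ _; rewrite integral0.
Qed.

Lemma ccvg_cI (u : nat -> R -> R[i]) f : (forall n, L1 (u n)) -> L1 f ->
  (\int[mu]_x (normc (u n x - f x))%:E @[n --> \oo] --> 0)%E ->
  ccvg (fun n => cI (u n)) (cI f).
Proof.
move=> u1 f1 uf; apply: (@ccvg_le _ _ (fun n => fine (\int[mu]_x (normc (u n x - f x))%:E)%E)).
  move=> n; rewrite -cIB//; have h := L1B (u1 n) f1.
  rewrite -lee_fin fineK; first exact: normc_cI.
  rewrite ge0_fin_numE; first exact: h.2.
  by apply: integral_ge0 => x _; rewrite lee_fin normc_ge0.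
exact: (fine_cvg uf).
Qed.

Lemma dominated_cI (u : nat -> R -> R[i]) f (h : R -> R) :
  (forall n, cmeasurable (u n)) -> cmeasurable f ->
  {ae mu, forall x, ccvg (u^~ x) (f x)} ->
  (forall n x, normc (u n x) <= h x) -> (forall x, normc (f x) <= h x) ->
  mu.-integrable setT (EFin \o h) ->
  ccvg (fun n => cI (u n)) (cI f).
Proof.
move=> mu_ mf uf uh fh hi; apply: ccvg_cI.
- by move=> n; exact: (L1_dom (mu_ n) (uh n) hi).
- exact: (L1_dom mf fh hi).
apply: (@dominated_L1 _ _ (fun x => 2 * h x)) => //.
- move=> n x; rewrite (le_trans (normc_leB _ _))// mulr2n mulrDl mul1r.
  by rewrite lerD.
- exact: (integrableZl _ 2 hi).
Qed.

End limits.

(** * Double integrals against bounded kernels *)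

Section fubini.
Context {R : realType}.
Local Notation mu := (@lebesgue_measure R).
Local Notation T := (measurableTypeR R).
Implicit Types (u v : R -> R[i]).

(** Tonelli's theorem gives measurability for the positive and the negative part
    separately. *)
Lemma measurable_Rint (F : T * T -> R) : measurable_fun setT F ->
  measurable_fun (setT : set R) (fun y => Rintegral mu setT (fun x => F (x, y))).
Proof.
move=> mF; have mE : measurable_fun setT (EFin \o F) by exact/measurable_EFinP.
rewrite /Rintegral; apply: measurableT_comp; first exact: fine_measurable.
rewrite (_ : (fun y => _) = (fun y => \int[mu]_x (EFin \o F)^\+ (x, y))%E \-
    (fun y => \int[mu]_x (EFin \o F)^\- (x, y))%E)%E; last first.
  apply/funext => y; rewrite [LHS]integralE; congr (_ - _)%E.
    by apply: eq_integral => x _; rewrite !funeposE.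
  by apply: eq_integral => x _; rewrite !funenegE.
apply: emeasurable_funB.
  apply: (measurable_fun_fubini_tonelli_G (m1 := mu) (EFin \o F)^\+%E) => //.
  exact: measurable_funepos.
apply: (measurable_fun_fubini_tonelli_G (m1 := mu) (EFin \o F)^\-%E) => //.
exact: measurable_funeneg.
Qed.

Lemma cmeas_cI (F : T * T -> R[i]) : cmeas F ->
  cmeasurable (fun y : R => cI (fun x => F (x, y))).
Proof.
by move=> [mr mi]; split => /=; exact: (@measurable_Rint (fun z => _ (F z))).
Qed.

Lemma real_fubini (F : T * T -> R) : measurable_fun setT F ->
  (\int[mu]_x \int[mu]_y `|(F (x, y))%:E| < +oo)%E ->
  (forall x, mu.-integrable setT (fun y => (F (x, y))%:E)) ->
  (forall y, mu.-integrable setT (fun x => (F (x, y))%:E)) ->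
  Rintegral mu setT (fun y => Rintegral mu setT (fun x => F (x, y))) =
  Rintegral mu setT (fun x => Rintegral mu setT (fun y => F (x, y))).
Proof.
move=> mF Foo F1 F2; have mE : measurable_fun setT (EFin \o F) by exact/measurable_EFinP.
have iF : (mu \x mu)%E.-integrable setT (EFin \o F).
  by apply/(integrable12ltyP mu mu mE).
rewrite /Rintegral; congr fine.
under eq_integral do rewrite fineK ?(integrable_fin_num _ (F2 _))//.
under [in RHS]eq_integral do rewrite fineK ?(integrable_fin_num _ (F1 _))//.
by rewrite (Fubini iF).
Qed.

(** Fubini for the real and for the imaginary part; the modulus dominates both, so
    one Tonelli bound serves twice. *)
Lemma complex_fubini (F : T * T -> R[i]) : cmeas F ->
  (\int[mu]_x \int[mu]_y (normc (F (x, y)))%:E < +oo)%E ->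
  (forall x, L1 (fun y => F (x, y))) -> (forall y, L1 (fun x => F (x, y))) ->
  cI (fun y => cI (fun x => F (x, y))) = cI (fun x => cI (fun y => F (x, y))).
Proof.
move=> mF Foo F1 F2.
have mn : measurable_fun setT (fun z => (normc (F z))%:E).
  by apply/measurable_EFinP; exact: cmeas_normc.
have key (r : R[i] -> R) : measurable_fun setT (fun z => r (F z)) ->
    (forall z, `|r z| <= normc z) ->
    (\int[mu]_x \int[mu]_y `|(r (F (x, y)))%:E| < +oo)%E.
  move=> mr rn; apply: le_lt_trans Foo.
  have mrE : measurable_fun setT (abse \o (fun z => (r (F z))%:E)).
    by apply: measurableT_comp => //; exact/measurable_EFinP.
  apply: ge0_le_integral => //.
  - by move=> x _; apply: integral_ge0.
  - apply: (measurable_fun_fubini_tonelli_F (m2 := mu) (abse \o (fun z => (r (F z))%:E))) => //.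
    by move=> z; exact: (abse_ge0 (r (F z))%:E).
  - apply: (measurable_fun_fubini_tonelli_F (m2 := mu) (fun z => (normc (F z))%:E)) => //.
    by move=> z; rewrite lee_fin normc_ge0.
  - move=> x _; apply: ge0_le_integral => //.
    + exact: (measurableT_comp mrE (measurable_pair1 x)).
    + exact: (measurableT_comp mn (measurable_pair1 x)).
    + by move=> y _; rewrite lee_fin.
apply: ceqP.
- apply: (@real_fubini (fun z => Re (F z))).
  + exact: mF.1.
  + by apply: key mF.1 _; exact: Re_le_normc.
  + by move=> x; exact: L1_Re.
  + by move=> y; exact: (L1_Re (F2 y)).
- apply: (@real_fubini (fun z => Im (F z))).
  + exact: mF.2.
  + by apply: key mF.2 _; exact: Im_le_normc.
  + by move=> x; exact: L1_Im.
  + by move=> y; exact: (L1_Im (F2 y)).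
Qed.

Section kernel.
Variable k : R -> R -> R[i].
Hypothesis mk : cmeas (fun z : T * T => k z.1 z.2).
Hypothesis k1 : forall x y, normc (k x y) <= 1.

Lemma kernel_meas1 y : cmeasurable (fun x => k x y).
Proof. exact: (cmeas_comp (measurable_pair2 y) mk). Qed.

Lemma kernel_meas2 x : cmeasurable (fun y => k x y).
Proof. exact: (cmeas_comp (measurable_pair1 x) mk). Qed.

Lemma kernel_L1 u y : L1 u -> L1 (fun x => u x * k x y).
Proof.
move=> u1; under eq_fun do rewrite mulrC.
by apply: (L1_bndM (a := 1)) => //; exact: kernel_meas1.
Qed.

Lemma kernel_L2 v x : L1 v -> L1 (fun y => v y * k x y).
Proof.
move=> u1; under eq_fun do rewrite mulrC.
by apply: (L1_bndM (a := 1)) => //; exact: kernel_meas2.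
Qed.

Lemma kernel_cmeas u : cmeasurable u ->
  cmeasurable (fun y => cI (fun x => u x * k x y)).
Proof.
move=> mu_; apply: (@cmeas_cI (fun z => u z.1 * k z.1 z.2)).
by apply: cmeasM => //; exact: (cmeas_comp (@measurable_fst _ _ T T) mu_).
Qed.

Lemma kernel_bnd u y : L1 u ->
  normc (cI (fun x => u x * k x y)) <= fine (\int[mu]_x (normc (u x))%:E)%E.
Proof.
move=> u1; rewrite -lee_fin fineK; last first.
  by apply: integrable_fin_num => //; exact: L1_int.
apply: (le_trans (normc_cI (kernel_L1 y u1))).
apply: ge0_le_integral => //.
- by move=> x _; rewrite lee_fin normc_ge0.
- by apply: measurable_normcE; exact: (kernel_L1 y u1).1.
- by apply: measurable_normcE; exact: u1.1.
- by move=> x _; rewrite lee_fin normcM ler_piMr ?normc_ge0.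
Qed.

Lemma kernel_intM u v : L1 u -> L1 v ->
  L1 (fun y => v y * cI (fun x => u x * k x y)).
Proof.
move=> u1 v1; under eq_fun do rewrite mulrC.
by apply: (L1_bndM _ (fun y => kernel_bnd y u1) v1); apply: kernel_cmeas; exact: u1.1.
Qed.

(** The double integral converges absolutely because the kernel is bounded by 1
    and [u], [v] are integrable. The Fourier kernel and the truncated exponentials of
    the resolvent below are both of this kind. *)
Lemma kernel_fubini u v : L1 u -> L1 v ->
  cI (fun y => v y * cI (fun x => u x * k x y)) =
  cI (fun x => u x * cI (fun y => v y * k x y)).
Proof.
move=> u1 v1; pose F (z : T * T) := u z.1 * v z.2 * k z.1 z.2.
have mF : cmeas F.
  apply: cmeasM => //; apply: cmeasM.
    exact: (cmeas_comp (@measurable_fst _ _ T T) u1.1).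
  exact: (cmeas_comp (@measurable_snd _ _ T T) v1.1).
have F1 x : L1 (fun y => F (x, y)).
  rewrite (_ : (fun y => _) = (fun y => u x * (v y * k x y))).
    by apply: L1Z; exact: kernel_L2.
  by apply/funext => y; rewrite /F mulrA.
have F2 y : L1 (fun x => F (x, y)).
  rewrite (_ : (fun x => _) = (fun x => v y * (u x * k x y))).
    by apply: L1Z; exact: kernel_L1.
  by apply/funext => x; rewrite /F mulrA [u x * v y]mulrC.
transitivity (cI (fun y => cI (fun x => F (x, y)))).
  congr cI; apply/funext => y; rewrite -cIZ; last exact: kernel_L1.
  by congr cI; apply/funext => x; rewrite /F mulrA [u x * v y]mulrC.
transitivity (cI (fun x => cI (fun y => F (x, y)))); last first.
  congr cI; apply/funext => x; rewrite -cIZ; last exact: kernel_L2.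
  by congr cI; apply/funext => y; rewrite /F mulrA.
apply: complex_fubini => //.
have [c cv] : exists c : R, (\int[mu]_y (normc (v y))%:E = c%:E)%E.
  exists (fine (\int[mu]_y (normc (v y))%:E)%E); rewrite fineK//.
  by apply: integrable_fin_num => //; exact: L1_int.
have c0 : 0 <= c by rewrite -lee_fin -cv integral_ge0// => x _; rewrite lee_fin normc_ge0.
apply: (@le_lt_trans _ _ (\int[mu]_x (c%:E * (normc (u x))%:E))%E); last first.
  rewrite ge0_integralZl//; last 2 first.
  - by apply: measurable_normcE; exact: u1.1.
  - by move=> x _; rewrite lee_fin normc_ge0.
  by rewrite lte_mul_pinfty// u1.2.
have mn : measurable_fun setT (fun z => (normc (F z))%:E).
  by apply/measurable_EFinP; exact: cmeas_normc.
apply: ge0_le_integral => //.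
- by move=> x _; apply: integral_ge0 => y _; rewrite lee_fin normc_ge0.
- apply: (measurable_fun_fubini_tonelli_F (m2 := mu) (fun z => (normc (F z))%:E)) => //.
  by move=> z; rewrite lee_fin normc_ge0.
- by apply: measurable_funeM; apply: measurable_normcE; exact: u1.1.
move=> x _; rewrite -cv muleC -ge0_integralZl//; last 3 first.
- by apply: measurable_normcE; exact: v1.1.
- by move=> y _; rewrite lee_fin normc_ge0.
- by rewrite lee_fin normc_ge0.
apply: ge0_le_integral => //.
- by move=> y _; rewrite lee_fin normc_ge0.
- exact: (measurableT_comp mn (measurable_pair1 x)).
- by apply: measurable_funeM; apply: measurable_normcE; exact: v1.1.
by move=> y _; rewrite lee_fin /F !normcM /= ler_piMr// mulr_ge0// normc_ge0.
Qed.

End kernel.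
End fubini.

(** * Primitives: the Poisson kernel and exponentials *)

Section ftc.
Context {R : realType}.
Local Notation mu := (@lebesgue_measure R).

Lemma is_derive_mul (f g : R -> R) (x df dg : R) :
  is_derive x (1:R) f df -> is_derive x (1:R) g dg ->
  is_derive x (1:R) (fun t => f t * g t) (df * g x + f x * dg).
Proof.
move=> hf hg; have h := is_deriveM hf hg.
by apply: (is_derive_eq h); rewrite /GRing.scale /= addrC [g x * _]mulrC.
Qed.

Lemma is_derive_affine (p a x : R) : is_derive x (1:R) (fun t => p * t + a) p.
Proof.
have h := is_deriveD (is_deriveM (is_derive_cst p x (1:R)) (is_derive_id x (1:R))) (is_derive_cst a x (1:R)).
by apply: (is_derive_eq h); rewrite /GRing.scale /= mulr1 mulr0 !addr0.
Qed.
Lemma derivable_cont (F : R -> R) (f : R -> R) :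
  (forall x : R, is_derive x 1 F (f x)) -> continuous F.
Proof.
move=> dF x; apply: differentiable_continuous; apply/derivable1_diffP.
by have [] := dF x.
Qed.

Lemma FTC_R (F f : R -> R) (a b : R) : a <= b ->
  (forall x : R, is_derive x 1 F (f x)) -> continuous f ->
  Rintegral mu `[a, b] f = F b - F a.
Proof.
rewrite le_eqVlt => /predU1P[<-|ab] dF cf.
  by rewrite set_itv1 Rintegral_set1 subrr.
rewrite /Rintegral (@continuous_FTC2 _ f F) ?fineB//.
- exact: continuous_subspaceT.
- have cF := derivable_cont dF; split.
  + by move=> x _; have [] := dF x.
  + by apply: cvg_at_right_filter; exact: cF.
  + by apply: cvg_at_left_filter; exact: cF.
- by move=> x _; rewrite derive1E; have [] := dF x.
Qed.

Lemma atan_derive (a : R) (e : R) x : 0 < e ->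
  is_derive x (1:R) (fun x => atan ((x + a) / e)) (e / (e ^+ 2 + (x + a) ^+ 2)).
Proof.
move=> e0.
have h : is_derive x (1:R) (fun x => (x + a) / e) e^-1.
  rewrite (_ : (fun x => _) = (fun x => e^-1 * x + a / e)).
    exact: is_derive_affine.
  by apply/funext => y; rewrite mulrDl mulrC.
have h2 := is_derive1_comp (g := fun x => (x + a) / e) (is_derive1_atan _) h.
apply: (is_derive_eq h2).
have n0 : e ^+ 2 + (x + a) ^+ 2 != 0 by rewrite gt_eqF// ltr_pwDl ?sqr_ge0// exprn_gt0.
have en0 : e != 0 by rewrite gt_eqF.
have -> : 1 + ((x + a) / e) ^+ 2 = (e ^+ 2 + (x + a) ^+ 2) / e ^+ 2 by field.
by rewrite invf_div -mulrA mulrCA expr2 -mulrA divff// mulr1 mulrC.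
Qed.

(** [poisson e t / pi] is the Poisson kernel of the upper half plane at height [e];
    its primitive is an arctangent. *)
Definition poisson (e t : R) : R := e / (e ^+ 2 + t ^+ 2).

Lemma poisson_den (e t : R) : 0 < e -> 0 < e ^+ 2 + t ^+ 2.
Proof. by move=> e0; rewrite ltr_pwDl ?sqr_ge0// exprn_gt0. Qed.

Lemma poisson_ge0 (e t : R) : 0 < e -> 0 <= poisson e t.
Proof. by move=> e0; rewrite divr_ge0 ?(ltW (poisson_den _ _))// ltW. Qed.

Lemma poisson_continuous (e a : R) : 0 < e -> continuous (fun x => poisson e (x + a)).
Proof.
move=> e0 x; apply: cvgM; first exact: cvg_cst.
apply: cvgV; first by rewrite gt_eqF// poisson_den.
apply: cvgD; first exact: cvg_cst.
by apply: (cvg_comp (fun x => x + a) (fun x => x ^+ 2)); [apply: cvgD;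
  [exact: cvg_id|exact: cvg_cst]|exact: exprn_continuous].
Qed.

Lemma poisson_shift0 (e : R) : poisson e = fun x : R => poisson e (x + 0).
Proof. by apply/funext => x; rewrite addr0. Qed.

Lemma atan_derive0 (e : R) x : 0 < e ->
  is_derive x (1:R) (fun x => atan (x / e)) (poisson e x).
Proof.
by move=> e0; have := @atan_derive 0 e x e0; rewrite /poisson addr0;
  under [X in is_derive _ _ X _]eq_fun do rewrite addr0.
Qed.

Lemma poisson_itv (e a u v : R) : 0 < e -> u <= v ->
  Rintegral mu `[u, v] (fun x => poisson e (x + a)) =
  atan ((v + a) / e) - atan ((u + a) / e).
Proof.
move=> e0 uv; apply: (@FTC_R (fun x => atan ((x + a) / e))) => //.
  by move=> x; exact: atan_derive.
exact: poisson_continuous.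
Qed.

Lemma measurable_poisson (e a : R) : 0 < e ->
  measurable_fun setT (fun x : R => poisson e (x + a)).
Proof. by move=> e0; apply: continuous_measurable_fun; exact: poisson_continuous. Qed.

Lemma poisson_mass (e a : R) : 0 < e ->
  (\int[mu]_x (poisson e (x + a))%:E = pi%:E)%E.
Proof.
move=> e0.
have cP : continuous (poisson e) by rewrite poisson_shift0; exact: poisson_continuous.
have := ge0_integral_preserving (mu_preserving_shift a) (f := fun x : R => (poisson e x)%:E).
move=> -> //; last 2 first.
- by apply/measurable_EFinP; exact: continuous_measurable_fun.
- by move=> x; rewrite lee_fin poisson_ge0.
(* by symmetry the mass is twice the one of the half line, where arctan ends at pi/2 *)
rewrite ge0_symfun_integralT//; last 2 first.
- by move=> x; exact: poisson_ge0.
- by move=> x; rewrite /poisson /= sqrrN.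
rewrite -set_itvcy (@ge0_continuous_FTC2y _ (poisson e) (fun x => atan (x / e)) 0 (pi / 2)).
- by rewrite mul0r atan0 sube0 -EFinM; congr EFin; field.
- by move=> x _; exact: poisson_ge0.
- exact: continuous_subspaceT.
- apply: cvg_comp (@cvgy_atan R).
  by apply: gt0_cvgMly; [rewrite invr_gt0|exact: cvg_id].
- by move=> x x0; have [] := @atan_derive0 e x e0.
- apply: cvg_at_right_filter.
  exact: (derivable_cont (fun x => @atan_derive0 e x e0)).
- by move=> x _; rewrite derive1E; have [] := @atan_derive0 e x e0.
Qed.

(** The complex exponential e^((p + iq) t) of a real variable. *)
Definition cexp (p q t : R) : R[i] := (expR (p * t))%:C * expi (q * t).

Lemma cexpE p q t : cexp p q t = expR (p * t) * cos (q * t) +i* (expR (p * t) * sin (q * t)).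
Proof. by apply: ceqP; rewrite /cexp !ReImE /=; ring. Qed.

Lemma cexp0 p q : cexp p q 0 = 1.
Proof. by rewrite /cexp !mulr0 expR0 expi0 mulr1. Qed.

Lemma cexpD p q s t : cexp p q (s + t) = cexp p q s * cexp p q t.
Proof.
rewrite /cexp !mulrDr expRD expiD rmorphM /=.
by rewrite mulrACA.
Qed.

Lemma cexpMD p q p' q' t : cexp p q t * cexp p' q' t = cexp (p + p') (q + q') t.
Proof. by rewrite /cexp !mulrDl expRD expiD rmorphM /= mulrACA. Qed.

Lemma normc_cexp p q t : normc (cexp p q t) = expR (p * t).
Proof. by rewrite /cexp normcM normc_expi mulr1 normcR ger0_norm ?expR_ge0. Qed.

Lemma is_derive_cexp p q (t : R) :
  is_derive t (1:R) (fun t => Re (cexp p q t)) (Re ((p +i* q) * cexp p q t)) /\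
  is_derive t (1:R) (fun t => Im (cexp p q t)) (Im ((p +i* q) * cexp p q t)).
Proof.
have lin r : is_derive t (1:R) (fun t => r * t) r.
  by have := is_derive_affine r 0 t; under eq_fun do rewrite addr0.
have dE := is_derive1_comp (g := fun t => p * t) (is_derive_expR (p * t)) (lin p).
have dc := is_derive1_comp (g := fun t => q * t) (is_derive_cos (q * t)) (lin q).
have ds := is_derive1_comp (g := fun t => q * t) (is_derive_sin (q * t)) (lin q).
split.
  have h := is_derive_mul dE dc.
  rewrite (_ : (fun t => _) = (fun t => expR (p * t) * cos (q * t))); last first.
    by apply/funext => s; rewrite cexpE.
  by apply: (is_derive_eq h); rewrite ReImE cexpE /=; ring.
have h := is_derive_mul dE ds.
rewrite (_ : (fun t => _) = (fun t => expR (p * t) * sin (q * t))); last first.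
  by apply/funext => s; rewrite cexpE.
by apply: (is_derive_eq h); rewrite ReImE cexpE /=; ring.
Qed.

Lemma continuous_cexp p q :
  continuous (fun t => Re (cexp p q t)) /\ continuous (fun t => Im (cexp p q t)).
Proof.
split; first exact: (derivable_cont (fun t => (is_derive_cexp p q t).1)).
exact: (derivable_cont (fun t => (is_derive_cexp p q t).2)).
Qed.

Lemma cmeas_cexp p q : cmeasurable (cexp p q).
Proof. by split; apply: continuous_measurable_fun; have [] := continuous_cexp p q. Qed.

(** The exponential is its own primitive up to the factor p + iq; keeping this factor
    inside the integral avoids a case distinction when it vanishes. *)
Lemma cintegral_cexp p q (a b : R) : a <= b ->
  cintegral `[a, b] (fun t => (p +i* q) * cexp p q t) = cexp p q b - cexp p q a.
Proof.
move=> ab; have [cr ci] := continuous_cexp p q.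
have cM (u v : R) : continuous (fun t : R => u * Re (cexp p q t) + v * Im (cexp p q t)).
  by move=> t; apply: cvgD; apply: cvgM; [exact: cvg_cst|exact: cr|exact: cvg_cst|exact: ci].
apply: ceqP; rewrite ReImE.
  apply: (FTC_R (F := fun t => Re (cexp p q t))) => //.
    by move=> t; exact: (is_derive_cexp p q t).1.
  rewrite (_ : (fun t => _) = (fun t => p * Re (cexp p q t) + (- q) * Im (cexp p q t)))//.
  by apply/funext => t; rewrite ReImE mulNr.
apply: (FTC_R (F := fun t => Im (cexp p q t))) => //.
  by move=> t; exact: (is_derive_cexp p q t).2.
rewrite (_ : (fun t => _) = (fun t => q * Re (cexp p q t) + p * Im (cexp p q t)))//.
by apply/funext => t; rewrite ReImE /= addrC.
Qed.

End ftc.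

(** * Transforms of damped exponentials *)

Section transforms.
Context {R : realType}.
Local Notation mu := (@lebesgue_measure R).
Implicit Types (D : set R) (f g u : R -> R[i]).

(** The indicator function is complex valued, so that restricting a function to a
    set is a multiplication and integrals over subsets become integrals over the line. *)
Definition ind D (x : R) : R[i] := (\1_D x)%:C.

Lemma indE D x : ind D x = if x \in D then 1 else 0.
Proof. by rewrite /ind indicE; case: (x \in D). Qed.

Lemma ind_in D x : D x -> ind D x = 1.
Proof. by move=> Dx; rewrite indE mem_set. Qed.

Lemma ind_out D x : ~ D x -> ind D x = 0.
Proof. by move=> Dx; rewrite indE memNset. Qed.

Lemma cmeas_ind D : measurable D -> cmeasurable (ind D).
Proof. by move=> mD; apply: cmeasR; exact: measurable_indic. Qed.

Lemma normc_ind D x : normc (ind D x) = \1_D x.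
Proof. by rewrite normcR ger0_norm// indicE. Qed.

Lemma normc_ind1 D x : normc (ind D x) <= 1.
Proof. by rewrite normc_ind indicE; case: (x \in D). Qed.

Lemma normc_indM D f x : normc (ind D x * f x) <= normc (f x).
Proof. by rewrite normcM ler_piMl ?normc_ge0// normc_ind1. Qed.

Lemma normc_ind_sub D E x (z : R[i]) : D `<=` E ->
  normc (ind D x * z) <= normc (ind E x * z).
Proof.
move=> DE; rewrite [leLHS]normcM [leRHS]normcM ler_wpM2r ?normc_ge0//.
rewrite !normc_ind !indicE ler_nat.
by case/boolP: (x \in D) => //; rewrite inE => /DE Ex; rewrite mem_set.
Qed.

Lemma itv0_half (a : R) : `[0, a]%classic `<=` `[0, +oo[%classic.
Proof. by move=> x /=; rewrite !in_itv/= => /andP[->]. Qed.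

Lemma L1_itv (a b : R) : L1 (ind `[a, b]).
Proof.
apply: (L1_dom (h := \1_`[a, b])).
- by apply: cmeas_ind; exact: measurable_itv.
- by move=> x; rewrite normc_ind.
- exact: integrable_indic_itv.
Qed.

Lemma cintegral_ind D f : measurable D ->
  cintegral D f = cI (fun x => ind D x * f x).
Proof.
move=> mD; apply: ceqP; rewrite /= [LHS]Rintegral_mkcond;
  apply: eq_Rintegral => x _; rewrite patchE indE ?ReImE;
  by case: (x \in D); rewrite /= ?mul1r ?mul0r ?subr0 ?addr0.
Qed.

Lemma L1_half_exp (p q : R) : p < 0 ->
  L1 (fun t => ind `[0, +oo[ t * cexp p q t).
Proof.
move=> p0; have r0 : 0 < - p by rewrite oppr_gt0.
apply: (L1_dom (h := fun t => (- p)^-1 * exponential_pdf (- p) t)).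
- by apply: cmeasM; [exact: cmeas_ind|exact: cmeas_cexp].
- move=> t; rewrite normcM normc_ind normc_cexp indicE /exponential_pdf patchE.
  case: (t \in `[0, +oo[%classic); rewrite ?mul1r ?mul0r ?mulr0//.
  by rewrite opprK mulrA mulVf ?mul1r// gt_eqF.
- exact: (integrableZl _ _ (integrable_exponential_pdf r0)).
Qed.

Lemma expR_cvg0 (p : R) : p < 0 -> expR (p * n%:R) @[n --> \oo] --> (0 : R).
Proof.
move=> p0; rewrite (_ : (fun n : nat => _) = (fun n : nat => expR p ^+ n)).
  by apply: cvg_expr; rewrite ger0_norm ?expR_ge0// expR_lt1.
by apply/funext => n; rewrite -expRM_natl mulrC.
Qed.

(** The integral of e^((p + iq) t) over [0, n] is explicit, and the boundary term at n
    tends to 0 when [p < 0]. *)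
Lemma half_exp_transform (p q : R) : p < 0 ->
  (p +i* q) * cI (fun t => ind `[0, +oo[ t * cexp p q t) = -1.
Proof.
move=> p0; set c := cI _.
pose u (n : nat) t := ind `[0, n%:R] t * cexp p q t.
have uc : ccvg (fun n => cI (u n)) c.
  apply: (@dominated_cI _ _ _ (fun t => normc (ind `[0, +oo[ t * cexp p q t))).
  - move=> n; apply: cmeasM; last exact: cmeas_cexp.
    by apply: cmeas_ind; exact: measurable_itv.
  - by apply: cmeasM; [exact: cmeas_ind|exact: cmeas_cexp].
  - apply: aeW => t; rewrite /ccvg; apply/cvg_ballP => e e0.
    near=> n; rewrite /u (_ : ind `[0, n%:R] t = ind `[0, +oo[ t).
      by rewrite subrr normc0; exact: ballxx.
    rewrite !indE; congr (if _ then _ else _).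
    apply/idP/idP; rewrite !inE /= !in_itv/= ?andbT; first by case/andP.
    by move=> ->/=; near: n; exact: nbhs_infty_ger.
  - by move=> n t; apply: normc_ind_sub; exact: itv0_half.
  - by [].
  - exact: (L1_int (L1_half_exp q p0)).
have e1 n : (p +i* q) * cI (u n) = cexp p q n%:R - 1.
  rewrite -(cexp0 p q) -cintegral_cexp// cintegral_ind//.
  rewrite -cIZ; last first.
    apply: (L1_le _ (L1_half_exp q p0)).
      by apply: cmeasM; [apply: cmeas_ind; exact: measurable_itv|exact: cmeas_cexp].
    by move=> t; apply: normc_ind_sub; exact: itv0_half.
  by congr cI; apply/funext => t; rewrite /u mulrCA.
apply: (ccvg_unique (ccvgZ (p +i* q) uc)).
apply: (@ccvg_le _ _ _ (fun n => expR (p * n%:R))); last exact: expR_cvg0.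
by move=> n; rewrite e1 opprK subrK normc_cexp.
Unshelve. all: by end_near. Qed.

(** The damping factor e^(-e|x|), whose Fourier transform is, up to a constant,
    the Poisson kernel. *)
Definition damp (e x : R) : R[i] := (expR (- (e * `|x|)))%:C.

Let h (p q : R) t := ind `[0, +oo[ t * cexp p q t.

(** At the origin the two half lines overlap, hence the almost everywhere
    statement. *)
Lemma damp_split (e t : R) : {ae mu, forall x : R,
  damp e x * expi (- (t * x)) = h (- e) (- t) x + h (- e) t (- x)}.
Proof.
apply: ae_imp (ae_neq 0) => x x0; rewrite /h /damp /cexp.
have [x1|x1] := ltP 0 x.
  rewrite ind_in/=; last by rewrite in_itv/= andbT ltW.
  rewrite ind_out/=; last by rewrite in_itv/= andbT oppr_ge0 leNgt x1.
  by rewrite mul0r addr0 mul1r ger0_norm ?(ltW x1)// !mulNr.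
have {}x1 : x < 0 by rewrite lt_neqAle x0.
rewrite ind_out/=; last by rewrite in_itv/= andbT leNgt x1.
rewrite ind_in/=; last by rewrite in_itv/= andbT oppr_ge0 ltW.
by rewrite mul0r add0r mul1r ltr0_norm// mulNr !mulrN.
Qed.

Lemma cmeas_damp e : cmeasurable (damp e).
Proof.
apply: cmeasR; apply: (measurableT_comp (@measurable_expR R)).
apply: (measurableT_comp (@oppr_measurable R setT)).
by apply: measurable_funM; [exact: measurable_cst|exact: normr_measurable].
Qed.

Lemma normc_damp e x : 0 < e -> normc (damp e x) <= 1.
Proof.
by move=> e0; rewrite normcR ger0_norm ?expR_ge0// expR_le1 oppr_le0 mulr_ge0// ltW.
Qed.

Lemma cmeas_expilin (t : R) : cmeasurable (fun x => expi (- (t * x))).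
Proof.
apply: cmeas_expi; apply: (measurableT_comp (@oppr_measurable R setT)).
exact: mulrl_measurable.
Qed.

Lemma damp_transform (e t : R) : 0 < e ->
  cI (fun x => damp e x * expi (- (t * x))) = (2 * poisson e t)%:C.
Proof.
move=> e0; have ne : - e < 0 by rewrite oppr_lt0.
have h1 q : L1 (h (- e) q) by exact: L1_half_exp.
have h2 q : L1 (fun x => h (- e) q (- x)).
  exact: (L1_preserving mu_preserving_opp (h1 q)).
have hE q : cI (h (- e) q) = - (- e +i* q)^-1.
  have := half_exp_transform q ne; rewrite -/(h (- e) q) => eq1.
  have n0 : - e +i* q != 0 :> R[i] by rewrite eq_complex /= oppr_eq0 gt_eqF.
  by rewrite -[LHS](mulKf n0) eq1 mulrN1.
rewrite (@cI_ae _ _ (fun x => h (- e) (- t) x + h (- e) t (- x))).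
- rewrite cID// (cI_preserving mu_preserving_opp (h1 t)) !hE.
  apply: ceqP; rewrite !ReImE /= /poisson !sqrrN; [|by ring].
  by have := gt_eqF (poisson_den t e0) => /negbT dn; field.
- by apply: cmeasM; [exact: cmeas_damp|exact: cmeas_expilin].
- exact: (L1D (h1 _) (h2 _)).1.
- exact: damp_split.
Qed.

Lemma L1_damp e : 0 < e -> L1 (damp e).
Proof.
move=> e0; have ne : - e < 0 by rewrite oppr_lt0.
have h1 q : L1 (h (- e) q) by exact: L1_half_exp.
have h2 q : L1 (fun x => h (- e) q (- x)).
  exact: (L1_preserving mu_preserving_opp (h1 q)).
apply: (L1_dom (h := fun x => normc (h (- e) 0 x) + normc (h (- e) 0 (- x)))).
- exact: cmeas_damp.
- move=> x; rewrite /h /damp /cexp !normcM !normcR !normc_expi !mulr1 !mulNr mulrN.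
  have [x1|x1] := leP 0 x.
    by rewrite (@indicE _ _ _ x) mem_set/= ?in_itv/= ?x1// normr1 mul1r !ger0_norm ?expR_ge0// lerDl mulr_ge0// expR_ge0.
  rewrite (@indicE _ _ _ (- x)) mem_set/=; last by rewrite in_itv/= oppr_ge0 andbT ltW.
  rewrite normr1 mul1r (ltr0_norm x1) mulrN !(ger0_norm (expR_ge0 _)) lerDr.
  by rewrite mulr_ge0 ?expR_ge0.
- exact: (integrableD _ (L1_int (h1 0)) (L1_int (h2 0))).
Qed.

End transforms.

(** * The space of square integrable functions *)

Section L2theory.
Context {R : realType}.
Local Notation mu := (@lebesgue_measure R).
Implicit Types (f g h : R -> R[i]) (c : R[i]).

Lemma limn_einf_le (u : (\bar R)^nat) (C : \bar R) :
  (forall n, u n <= C)%E -> (limn_einf u <= C)%E.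
Proof.
move=> uC; rewrite limn_einf_lim; apply: lime_le; first exact: is_cvg_einfs.
apply: nearW => n; apply: le_trans (uC n).
by apply: ereal_inf_lbound; exists n => /=.
Qed.

(** Fatou's lemma for an almost everywhere limit: almost everywhere the limit is
    the lower limit. *)
Lemma fatou_le (g_ : nat -> R -> R) (g : R -> R) (C : \bar R) :
  (forall n, measurable_fun setT (g_ n)) -> (forall n x, 0 <= g_ n x) ->
  measurable_fun setT g -> (forall x, 0 <= g x) ->
  {ae mu, forall x, g_ n x @[n --> \oo] --> g x} ->
  (forall n, \int[mu]_x (g_ n x)%:E <= C)%E -> (\int[mu]_x (g x)%:E <= C)%E.
Proof.
move=> mg_ g_0 mg g0 gg gC.
have mE n : measurable_fun (setT : set (measurableTypeR R)) (EFin \o g_ n).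
  by apply/measurable_EFinP; exact: mg_.
have -> : (\int[mu]_x (g x)%:E = \int[mu]_x limn_einf (fun n => (EFin \o g_ n) x))%E.
  apply: ge0_ae_eq_integral => //.
  - by apply/measurable_EFinP; exact: mg.
  - have := @measurable_fun_limn_esup _ _ R setT (fun n x => - (EFin \o g_ n) x)%E.
    move=> /(_ (fun n => measurableT_comp (@oppe_measurable R setT) (mE n))) m.
    have -> : (fun x => limn_einf (fun n => (EFin \o g_ n) x)) =
        (fun x => - limn_esup (fun n => - (EFin \o g_ n) x))%E.
      by apply/funext => x; rewrite -limn_einfN; congr limn_einf; apply/funext => n; exact/esym/oppeK.
    exact: (measurableT_comp (@oppe_measurable R setT) m).
  - by move=> x _; rewrite lee_fin g0.
  - move=> x _; rewrite limn_einf_lim; apply: lime_ge; first exact: is_cvg_einfs.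
    apply: nearW => n; apply: le_ereal_inf_tmp => _ [m _ <-] /=; rewrite lee_fin; exact: g_0.
  - apply: ae_imp gg => x gx _.
    have cx : (EFin \o g_ n) x @[n --> \oo] --> (g x)%:E by apply: cvg_EFin => //; exact: nearW.
    by rewrite is_cvg_limn_einfE; [rewrite (cvg_lim _ cx)|apply/cvg_ex; eexists; exact: cx].
apply: (le_trans (fatou _ measurableT mE _)).
  by move=> n x _; rewrite lee_fin g_0.
exact: limn_einf_le.
Qed.

(** The square of the L^2 norm as an integral, free of the roots in [L2norm]. *)
Definition sqI f : \bar R := (\int[mu]_x (normc (f x) ^+ 2)%:E)%E.

Lemma sqI_ge0 f : (0 <= sqI f)%E.
Proof. by apply: integral_ge0 => x _; rewrite lee_fin sqr_ge0. Qed.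

Lemma L2norm_sqrte f : L2norm f = sqrte (sqI f).
Proof.
rewrite /L2norm unlock -poweR12_sqrt ?sqI_ge0//; congr (_ `^ _)%E.
apply: eq_integral => x _; rewrite /= ger0_norm ?normc_ge0//.
by rewrite powR_mulrn ?normc_ge0.
Qed.

Lemma L2norm_sqr f : (L2norm f ^+ 2 = sqI f)%E.
Proof. by rewrite L2norm_sqrte sqr_sqrte// sqI_ge0. Qed.

Lemma measurable_sq f : cmeasurable f ->
  measurable_fun setT (fun x => normc (f x) ^+ 2).
Proof. by move=> mf; apply: measurable_funX; exact: cmeas_normc. Qed.

Lemma L2P f : L2 f <-> cmeasurable f /\ (sqI f < +oo)%E.
Proof.
split=> -[mf fi]; split => //; rewrite ?L2norm_sqrte; last first.
  by move: fi; case: (sqI f) (sqI_ge0 f) => [r| |]//= _ _; rewrite ltry.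
move: fi; rewrite L2norm_sqrte.
by move: (sqI_ge0 f); case: (sqI f) => [r| |]//= _ _; rewrite ltry.
Qed.

(** The L^2 norm as a real number; it is the norm only on [L2], since [fine] sends an
    infinite value to 0. *)
Definition nrm f : R := fine (L2norm f).

Lemma nrm_ge0 f : 0 <= nrm f.
Proof. by rewrite fine_ge0// Lnorm_ge0. Qed.

Lemma L2normE f : L2 f -> L2norm f = (nrm f)%:E.
Proof. by move=> [_ fi]; rewrite fineK// ge0_fin_numE// Lnorm_ge0. Qed.

Lemma sqIE f : L2 f -> sqI f = (nrm f ^+ 2)%:E.
Proof. by move=> f2; rewrite -L2norm_sqr L2normE// -EFin_expe. Qed.

(** Membership in L^2 and the bound on the norm come together: every L^2 function
    built below is obtained from an estimate. *)
Lemma nrm_le f (C : R) : 0 <= C -> cmeasurable f -> (sqI f <= (C ^+ 2)%:E)%E ->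
  L2 f /\ nrm f <= C.
Proof.
move=> C0 mf fC; have f2 : L2 f by apply/L2P; split=> //; rewrite (le_lt_trans fC)// ltry.
split=> //; rewrite -(@ler_pXn2r _ 2)// ?nnegrE ?nrm_ge0//.
by rewrite -lee_fin -sqIE.
Qed.

Lemma sqI_ae f g : cmeasurable f -> cmeasurable g ->
  {ae mu, forall x, f x = g x} -> sqI f = sqI g.
Proof.
move=> mf mg fg; apply: ge0_ae_eq_integral => //.
- by apply/measurable_EFinP; exact: measurable_sq.
- by apply/measurable_EFinP; exact: measurable_sq.
- by move=> x _; rewrite lee_fin sqr_ge0.
- by move=> x _; rewrite lee_fin sqr_ge0.
- by apply: ae_imp fg => x /= -> _.
Qed.

Lemma nrm_ae f g : cmeasurable f -> cmeasurable g ->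
  {ae mu, forall x, f x = g x} -> nrm f = nrm g.
Proof. by move=> mf mg fg; rewrite /nrm !L2norm_sqrte (sqI_ae mf mg fg). Qed.

Lemma sqI_mono f g : cmeasurable f -> cmeasurable g ->
  (forall x, normc (f x) <= normc (g x)) -> (sqI f <= sqI g)%E.
Proof.
move=> mf mg fg; apply: ge0_le_integral => //.
- by move=> x _; rewrite lee_fin sqr_ge0.
- by apply/measurable_EFinP; exact: measurable_sq.
- by apply/measurable_EFinP; exact: measurable_sq.
- by move=> x _; rewrite lee_fin lerXn2r ?nnegrE ?normc_ge0.
Qed.

Lemma L2_le f g : cmeasurable f -> L2 g ->
  (forall x, normc (f x) <= normc (g x)) -> L2 f.
Proof.
move=> mf /L2P[mg gi] fg; apply/L2P; split => //.
exact: le_lt_trans (sqI_mono mf mg fg) gi.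
Qed.

Lemma sqI0_ae f : cmeasurable f -> sqI f = 0%E -> {ae mu, forall x, f x = 0}.
Proof.
move=> mf f0; have : ae_eq mu setT (fun x => (normc (f x) ^+ 2)%:E) (cst 0%E).
  apply/ae_eq_integral_abs => //; first by apply/measurable_EFinP; exact: measurable_sq.
  rewrite -[RHS]f0; apply: eq_integral => x _.
  by rewrite gee0_abs// lee_fin sqr_ge0.
apply: ae_imp => x /(_ I)/= /eqP; rewrite eqe sqrf_eq0 normc_eq0.
by move=> /eqP.
Qed.

Lemma nrm0_ae f : L2 f -> nrm f = 0 -> {ae mu, forall x, f x = 0}.
Proof.
by move=> f2 f0; apply: sqI0_ae; [exact: f2.1|rewrite sqIE// f0 expr0n].
Qed.

Lemma LnormE f : L2norm f = Lnorm mu 2%:E (EFin \o (fun x => normc (f x))).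
Proof. by []. Qed.

(** Minkowski's inequality applies to the moduli; the modulus of the sum is at most
    the sum of the moduli. *)
Lemma L2norm_triangle f g : cmeasurable f -> cmeasurable g ->
  (L2norm (f \+ g)%R <= L2norm f + L2norm g)%E.
Proof.
move=> mf mg.
apply: (@le_trans _ _ (Lnorm mu 2%:E (EFin \o ((fun x => normc (f x)) \+ (fun x => normc (g x))))%R)); last first.
  apply: minkowski_EFin; first exact: cmeas_normc.
    exact: cmeas_normc.
  by rewrite ler1n.
pose G x : R[i] := (normc (f x) + normc (g x))%:C.
have GE x : normc (G x) = normc (f x) + normc (g x).
  by rewrite normcR ger0_norm// addr_ge0 ?normc_ge0.
have -> : (fun x => normc (f x)) \+ (fun x => normc (g x)) = (fun x => normc (G x)).
  by apply/funext => x; rewrite GE.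
rewrite -LnormE !L2norm_sqrte.
have : (sqI (f \+ g)%R <= sqI G)%E.
  apply: sqI_mono; first exact: cmeasD.
    by apply: cmeasR; apply: measurable_funD; exact: cmeas_normc.
  by move=> x; rewrite GE normc_leD.
move: (sqI_ge0 (f \+ g)) (sqI_ge0 G).
case: (sqI (f \+ g)) => [a| |]; case: (sqI G) => [b| |]//=; rewrite ?leey//.
by move=> a0 b0; rewrite !lee_fin => ab; rewrite ler_wsqrtr.
Qed.

Lemma L2D f g : L2 f -> L2 g -> L2 (f \+ g).
Proof.
move=> f2 g2; split; first by apply: cmeasD; [exact: f2.1|exact: g2.1].
apply: (le_lt_trans (L2norm_triangle f2.1 g2.1)).
by rewrite !L2normE// -EFinD ltry.
Qed.

Lemma nrmD f g : L2 f -> L2 g -> nrm (f \+ g) <= nrm f + nrm g.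
Proof.
move=> f2 g2; have := L2norm_triangle f2.1 g2.1.
by rewrite !L2normE//; exact: L2D.
Qed.

Lemma sqI_Z c f : cmeasurable f ->
  sqI (fun x => c * f x) = ((normc c ^+ 2)%:E * sqI f)%E.
Proof.
move=> mf; rewrite /sqI -ge0_integralZl//.
- by apply: eq_integral => x _; rewrite normcM exprMn EFinM.
- by apply/measurable_EFinP; exact: measurable_sq.
- by move=> x _; rewrite lee_fin sqr_ge0.
- by rewrite lee_fin sqr_ge0.
Qed.

Lemma L2Z c f : L2 f -> L2 (fun x => c * f x).
Proof.
move=> f2; apply/L2P; split; first by apply: cmeasZ; exact: f2.1.
by rewrite sqI_Z ?sqIE// -?EFinM ?ltry//; exact: f2.1.
Qed.

Lemma nrmZ c f : L2 f -> nrm (fun x => c * f x) = normc c * nrm f.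
Proof.
move=> f2; apply/eqP; rewrite -(@eqrXn2 _ 2)// ?nrm_ge0// ?mulr_ge0 ?normc_ge0 ?nrm_ge0//.
rewrite -eqe -sqIE; last exact: L2Z.
by rewrite sqI_Z ?sqIE// -?EFinM ?exprMn//; exact: f2.1.
Qed.

Lemma L2B f g : L2 f -> L2 g -> L2 (f \- g).
Proof.
move=> f2 g2; rewrite (_ : f \- g = f \+ (fun x => (-1) * g x)).
  by apply: L2D => //; exact: L2Z.
by apply/funext => x /=; rewrite mulN1r.
Qed.

Lemma nrmB f g : L2 f -> L2 g -> nrm (f \- g) <= nrm f + nrm g.
Proof.
move=> f2 g2; rewrite (_ : f \- g = f \+ (fun x => (-1) * g x)).
  apply: (le_trans (nrmD f2 (L2Z _ g2))).
  by rewrite nrmZ// normcN normc1 mul1r.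
by apply/funext => x /=; rewrite mulN1r.
Qed.

Lemma nrm_sub f g : L2 f -> L2 g -> nrm (f \- g) = nrm (g \- f).
Proof.
move=> f2 g2; rewrite (_ : f \- g = fun x => (-1) * (g \- f) x).
  by rewrite nrmZ ?normcN ?normc1 ?mul1r//; exact: L2B.
by apply/funext => x /=; rewrite mulN1r opprB.
Qed.

Lemma nrm_lip f g : L2 f -> L2 g -> `|nrm f - nrm g| <= nrm (f \- g).
Proof.
move=> f2 g2; rewrite ler_norml; apply/andP; split.
  rewrite lerNl opprB lerBlDr nrm_sub//.
  have := nrmD (L2B g2 f2) f2.
  by rewrite (_ : (g \- f) \+ f = g)//; apply/funext => x /=; rewrite subrK.
rewrite lerBlDr; have := nrmD (L2B f2 g2) g2.
by rewrite (_ : (f \- g) \+ g = f)//; apply/funext => x /=; rewrite subrK.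
Qed.

Lemma hoelder22 f g : L2 f -> L2 g ->
  (\int[mu]_x (normc (f x * g x))%:E <= (nrm f * nrm g)%:E)%E.
Proof.
move=> f2 g2; rewrite EFinM -!L2normE// !LnormE.
have := @hoelder _ _ _ mu (fun x => normc (f x)) (fun x => normc (g x)) 2 2.
move=> /(_ (cmeas_normc f2.1) (cmeas_normc g2.1)).
move=> /(_ ltac:(lra) ltac:(lra) ltac:(lra)); apply: le_trans.
rewrite Lnorm1 le_eqVlt; apply/orP; left; apply/eqP.
apply: eq_integral => x _ /=; rewrite normcM ger0_norm// mulr_ge0 ?normc_ge0//.
Qed.

Lemma L1M f g : L2 f -> L2 g -> L1 (fun x => f x * g x).
Proof.
move=> f2 g2; split; first by apply: cmeasM; [exact: f2.1|exact: g2.1].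
by apply: (le_lt_trans (hoelder22 f2 g2)); rewrite ltry.
Qed.

Lemma normc_cIM f g : L2 f -> L2 g -> normc (cI (fun x => f x * g x)) <= nrm f * nrm g.
Proof.
move=> f2 g2; rewrite -lee_fin; apply: (le_trans (normc_cI (L1M f2 g2))).
exact: hoelder22.
Qed.

Lemma L2J f : L2 f -> L2 (fun x => (f x)^*).
Proof.
move=> f2; apply: (L2_le _ f2); first by apply: cmeasJ; exact: f2.1.
by move=> x; rewrite normcJ.
Qed.

Lemma nrm_eq f g : (forall x, normc (f x) = normc (g x)) -> nrm f = nrm g.
Proof.
move=> fg; rewrite /nrm !L2norm_sqrte; congr (fine (sqrte _)).
by apply: eq_integral => x _; rewrite fg.
Qed.

Lemma L2_preserving (phi : R -> R) f : mu_preserving phi -> L2 f ->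
  L2 (f \o phi) /\ nrm (f \o phi) = nrm f.
Proof.
move=> hphi f2; have e : sqI (f \o phi) = sqI f.
  apply: (ge0_integral_preserving hphi (f := fun x => (normc (f x) ^+ 2)%:E)).
    by apply/measurable_EFinP; apply: measurable_sq; exact: f2.1.
  by move=> x; rewrite lee_fin sqr_ge0.
split; last by rewrite /nrm !L2norm_sqrte e.
apply/L2P; split; first by apply: cmeas_preserving => //; exact: f2.1.
by rewrite e sqIE// ltry.
Qed.

Definition L2cvg (u : nat -> R -> R[i]) f := nrm (u n \- f) @[n --> \oo] --> (0 : R).

Lemma L2cvgP (u : nat -> R -> R[i]) f : (forall n, L2 (u n)) -> L2 f ->
  L2cvg u f <-> (L2norm (u n \- f)%R @[n --> \oo] --> 0)%E.
Proof.
move=> u2 f2; have e : (fun n => L2norm (u n \- f)) = (fun n => (nrm (u n \- f))%:E).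
  by apply/funext => n; rewrite L2normE//; exact: L2B.
rewrite e; split => [uf|]; first by apply: cvg_EFin => //; exact: nearW.
by move=> /fine_cvg.
Qed.

Lemma L2cvg_le (u : nat -> R -> R[i]) f (e : nat -> R) :
  (forall n, nrm (u n \- f) <= e n) -> e n @[n --> \oo] --> (0 : R) -> L2cvg u f.
Proof.
move=> ue e0; apply: (@squeeze_cvgr _ _ _ _ (cst 0) e) => //.
  by near=> n; rewrite nrm_ge0 ue.
exact: cvg_cst.
Unshelve. all: by end_near. Qed.

Lemma cvg_nrm (u : nat -> R -> R[i]) f : (forall n, L2 (u n)) -> L2 f ->
  L2cvg u f -> nrm (u n) @[n --> \oo] --> nrm f.
Proof.
move=> u2 f2 uf; apply/cvgrPdist_le => e e0.
move/cvgr0_norm_le: uf => /(_ e e0); apply: filterS => n.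
rewrite distrC ger0_norm ?nrm_ge0// => h; exact: le_trans (nrm_lip (u2 n) f2) h.
Qed.

Lemma L2cvg_unique (u : nat -> R -> R[i]) f g : (forall n, L2 (u n)) -> L2 f -> L2 g ->
  L2cvg u f -> L2cvg u g -> {ae mu, forall x, f x = g x}.
Proof.
move=> u2 f2 g2 uf ug.
have : L2cvg (fun=> f) g.
  apply: (@L2cvg_le _ _ (fun n => nrm (u n \- f) + nrm (u n \- g))).
    move=> n; rewrite [nrm (u n \- f)]nrm_sub//.
    have := nrmD (L2B f2 (u2 n)) (L2B (u2 n) g2).
    rewrite (_ : (f \- u n) \+ (u n \- g) = f \- g)//.
    by apply/funext => x /=; rewrite addrA subrK.
  by rewrite -[X in _ --> X]addr0; exact: cvgD.
rewrite /L2cvg => h; have n0 : nrm (f \- g) = 0.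
  by apply: (cvg_unique (@Rhausdorff R) _ h); exact: cvg_cst.
by apply: ae_imp (nrm0_ae (L2B f2 g2) n0) => x /= /eqP; rewrite subr_eq0 => /eqP.
Qed.

Lemma L2cvgD (u v : nat -> R -> R[i]) f g :
  (forall n, L2 (u n)) -> (forall n, L2 (v n)) -> L2 f -> L2 g ->
  L2cvg u f -> L2cvg v g -> L2cvg (fun n => u n \+ v n) (f \+ g).
Proof.
move=> u2 v2 f2 g2 uf vg.
apply: (@L2cvg_le _ _ (fun n => nrm (u n \- f) + nrm (v n \- g))).
  move=> n; have := nrmD (L2B (u2 n) f2) (L2B (v2 n) g2).
  rewrite (_ : (u n \- f) \+ (v n \- g) = (u n \+ v n) \- (f \+ g))//.
  by apply/funext => x /=; rewrite opprD addrACA.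
by rewrite -[X in _ --> X]addr0; exact: cvgD.
Qed.

Lemma L2cvgZ c (u : nat -> R -> R[i]) f : (forall n, L2 (u n)) -> L2 f ->
  L2cvg u f -> L2cvg (fun n x => c * u n x) (fun x => c * f x).
Proof.
move=> u2 f2 uf; apply: (@L2cvg_le _ _ (fun n => normc c * nrm (u n \- f))).
  move=> n; rewrite -nrmZ; last exact: L2B.
  by rewrite le_eqVlt; apply/orP; left; apply/eqP; congr nrm; apply/funext => x /=; rewrite mulrBr.
by rewrite -[X in _ --> X](mulr0 (normc c)); apply: cvgM => //; exact: cvg_cst.
Qed.

Lemma ccvg_cIM (u v : nat -> R -> R[i]) f g :
  (forall n, L2 (u n)) -> (forall n, L2 (v n)) -> L2 f -> L2 g ->
  L2cvg u f -> L2cvg v g ->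
  ccvg (fun n => cI (fun x => u n x * v n x)) (cI (fun x => f x * g x)).
Proof.
move=> u2 v2 f2 g2 uf vg.
apply: (@ccvg_le _ _ _ (fun n => nrm (u n \- f) * nrm (v n) + nrm f * nrm (v n \- g))).
  move=> n; have d1 := L2B (u2 n) f2; have d2 := L2B (v2 n) g2.
  have -> : cI (fun x => u n x * v n x) - cI (fun x => f x * g x) =
      cI (fun x => (u n \- f) x * v n x) + cI (fun x => f x * (v n \- g) x).
    rewrite -cIB; [|exact: L1M|exact: L1M].
    rewrite -cID; [|exact: L1M|exact: L1M].
    by congr cI; apply/funext => x /=; ring.
  by rewrite (le_trans (normc_leD _ _))// lerD// normc_cIM.
have -> : (0 : R) = 0 * nrm g + nrm f * 0 by rewrite mul0r mulr0 addr0.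
apply: cvgD; first by apply: cvgM => //; exact: cvg_nrm.
by apply: cvgM => //; exact: cvg_cst.
Qed.

(** Balls of L^2 are closed under almost everywhere convergence. *)
Lemma fatou_L2 (w : nat -> R -> R[i]) f (C : \bar R) :
  (forall n, cmeasurable (w n)) -> cmeasurable f ->
  {ae mu, forall x, ccvg (w^~ x) (f x)} ->
  (forall n, sqI (w n) <= C)%E -> (sqI f <= C)%E.
Proof.
move=> mw mf wf wC.
apply: (@fatou_le (fun n x => normc (w n x) ^+ 2)) wC.
- by move=> n; exact: measurable_sq.
- by move=> n x; exact: sqr_ge0.
- exact: measurable_sq.
- by move=> x; exact: sqr_ge0.
apply: ae_imp wf => x wx.
have nc := ccvg_normc wx.
by under eq_fun do rewrite expr2; rewrite expr2; exact: cvgM.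
Qed.

End L2theory.

(** * Completeness *)

Section riesz_fischer.
Context {R : realType}.
Local Notation mu := (@lebesgue_measure R).
Variable u : nat -> R -> R[i].
Hypothesis u2 : forall n, L2 (u n).

Lemma cvg_geometric_diff (a : nat -> R) (S : R) :
  (forall j, `|a j.+1 - a j| <= S * (2^-1) ^+ j) -> cvgn a.
Proof.
move=> aS; have S0 : 0 <= S.
  by have := aS 0%N; rewrite expr0 mulr1; exact: le_trans.
have e n : series (fun j => a j.+1 - a j) n = a n - a 0%N.
  by rewrite /series /= telescope_sumr.
have cs : cvgn (series (fun j => a j.+1 - a j)).
  apply: (@normed_cvg _ R); apply: (@series_le_cvg _ _ (geometric S 2^-1)).
  - by move=> n; exact: normr_ge0.
  - by move=> n; rewrite /geometric /= mulr_ge0// exprn_ge0.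
  - by move=> n; exact: aS.
  - apply: is_cvg_geometric_series; rewrite ger0_norm//; lra.
have -> : a = (fun n => series (fun j => a j.+1 - a j) n + a 0%N).
  by apply/funext => n; rewrite e subrK.
by apply: is_cvgD => //; exact: is_cvg_cst.
Qed.

(** A limit superior is measurable without any convergence assumption, so it is a
    measurable version of a limit that exists only almost everywhere. *)
Lemma measurable_limsup (a : nat -> R -> R) : (forall n, measurable_fun setT (a n)) ->
  measurable_fun setT (fun x => fine (limn_esup (fun n => (a n x)%:E))).
Proof.
move=> ma; apply: measurableT_comp; first exact: fine_measurable.
apply: (@measurable_fun_limn_esup _ _ R setT (fun n x => (a n x)%:E)) => n.
by apply/measurable_EFinP; exact: ma.
Qed.

Lemma limsup_lim (a : nat -> R) (l : R) : a n @[n --> \oo] --> l ->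
  fine (limn_esup (EFin \o a)) = l.
Proof.
move=> al; have al' : (EFin \o a) n @[n --> \oo] --> l%:E by apply: cvg_EFin => //; exact: nearW.
by rewrite is_cvg_limn_esupE; [rewrite (cvg_lim _ al')|apply/cvg_ex; eexists; exact: al'].
Qed.

(** A sequence with small increments converges almost everywhere: the sum over j of
    4^j |u_(j+1) - u_j|^2 has a finite integral, so it is finite at almost every point,
    and there the increments are O(2^-j). *)
Lemma fast_cauchy_cvg :
  (forall j, nrm (u j.+1 \- u j) <= (4^-1) ^+ j / 2) ->
  exists2 f, cmeasurable f & {ae mu, forall x, ccvg (u^~ x) (f x)}.
Proof.
move=> ud; pose d j := u j.+1 \- u j.
have d2 j : L2 (d j) by exact: L2B.
(* the weight 4^j turns a bound on the sum into increments O(2^-j); the integral of the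
   j-th term is at most 4^j (4^-j / 2)^2, hence summable *)
pose g j (x : measurableTypeR R) : \bar R := (4 ^+ j * normc (d j x) ^+ 2)%:E.
have mg j : measurable_fun setT (g j).
  apply/measurable_EFinP; apply: measurable_funM; first exact: measurable_cst.
  by apply: measurable_sq; exact: (d2 j).1.
have g0 j x : (0 <= g j x)%E by rewrite lee_fin mulr_ge0// ?sqr_ge0// exprn_ge0.
have ig j : (\int[mu]_x g j x <= (1 / (2 ^ (j + 1))%:R)%:E)%E.
  have -> : (\int[mu]_x g j x = (4 ^+ j)%:E * sqI (d j))%E.
    rewrite /sqI -ge0_integralZl//.
    - by apply/measurable_EFinP; apply: measurable_sq; exact: (d2 j).1.
    - by move=> x _; rewrite lee_fin sqr_ge0.
  rewrite sqIE// -EFinM lee_fin.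
  have : nrm (d j) ^+ 2 <= ((4^-1) ^+ j / 2) ^+ 2.
    by rewrite lerXn2r ?nnegrE ?nrm_ge0 ?divr_ge0 ?exprn_ge0 ?invr_ge0//; exact: ud.
  move=> /(ler_wpM2l (exprn_ge0 j (ler0n R 4))) /le_trans; apply.
  have -> : 4 ^+ j * ((4^-1) ^+ j / 2) ^+ 2 = (4^-1) ^+ j / 4 :> R.
    have e : 4 ^+ j * (4^-1) ^+ j = 1 :> R by rewrite -exprMn mulfV// expr1n.
    rewrite expr_div_n expr2 !mulrA e mul1r; congr (_ * _^-1).
    by rewrite -natrX.
  have -> : 1 / (2 ^ (j + 1))%:R = (2^-1) ^+ j / 2 :> R.
    by rewrite addn1 expnSr natrM natrX invfM exprVn mul1r.
  have : (4^-1) ^+ j <= (2^-1) ^+ j :> R by rewrite lerXn2r ?nnegrE//; lra.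
  have : 0 <= (4^-1) ^+ j :> R by rewrite exprn_ge0.
  lra.
have isum : (\int[mu]_x \sum_(j <oo) g j x < +oo)%E.
  rewrite integral_nneseries//.
  apply: (@le_lt_trans _ _ (\sum_(j <oo) (1 / (2 ^ (j + 1))%:R)%:E)%E).
    by apply: lee_nneseries => // j _ _; exact: integral_ge0.
  by rewrite (cvg_lim _ (@cvg_geometric_eseries_half R 1 0))// ltry.
have msum : measurable_fun setT (fun x => \sum_(j <oo) g j x)%E.
  have := @ge0_emeasurable_sum _ _ R setT g xpredT (fun k x _ _ => g0 k x) (fun k _ => mg k).
  by [].
have fsum : {ae mu, forall x, (\sum_(j <oo) g j x)%E \is a fin_num}.
  have : mu.-integrable setT (fun x => \sum_(j <oo) g j x)%E.
    apply/integrableP; split=> //; apply: le_lt_trans isum.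
    apply: ge0_le_integral => //.
    - exact: measurableT_comp.
    - by move=> x _; rewrite gee0_abs// nneseries_ge0.
  by move/(integrable_ae measurableT); apply: ae_imp => x; exact.
have key x : (\sum_(j <oo) g j x)%E \is a fin_num ->
    exists2 S : R, 0 <= S & forall j, normc (d j x) <= S * (2^-1) ^+ j.
  move=> fx; pose S2 := fine (\sum_(j <oo) g j x)%E.
  exists (Num.sqrt S2); first exact: sqrtr_ge0.
  move=> j; have gS : 4 ^+ j * normc (d j x) ^+ 2 <= S2.
    rewrite -lee_fin fineK//.
    apply: (@le_trans _ _ (\sum_(0 <= i < j.+1) g i x)%E); last first.
      by apply: nneseries_lim_ge => i _ _; exact: g0.
    rewrite big_nat_recr//=; apply: (@le_trans _ _ (0 + g j x)%E); first by rewrite add0e.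
    by apply: leeD => //; apply: sume_ge0 => i _; exact: g0.
  have S20 : 0 <= S2 by apply: le_trans gS; rewrite mulr_ge0 ?exprn_ge0 ?normc_ge0.
  rewrite -(@ler_pXn2r _ 2)// ?nnegrE ?normc_ge0 ?mulr_ge0 ?sqrtr_ge0 ?exprn_ge0//.
  rewrite exprMn sqr_sqrtr// -exprM mulnC exprM.
  rewrite -(@ler_pM2l _ (4 ^+ j)) ?exprn_gt0// (le_trans gS)//.
  rewrite mulrCA -exprMn (_ : 4 * 2^-1 ^+ 2 = 1) ?expr1n ?mulr1//; lra.
(* a measurable function defined everywhere, equal to the limit where it exists *)
pose f x := fine (limn_esup (fun n => (Re (u n x))%:E)) +i*
            fine (limn_esup (fun n => (Im (u n x))%:E)).
exists f.
  by split => /=; apply: (@measurable_limsup (fun n x => _ (u n x))) => n;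
    [exact: (u2 n).1.1|exact: (u2 n).1.2].
apply: ae_imp fsum => x /key[S S0 dS].
have cr : cvgn (fun n => Re (u n x)).
  apply: (@cvg_geometric_diff _ S) => j; apply: le_trans (dS j).
  by rewrite -ReN -ReD; exact: Re_le_normc.
have ci : cvgn (fun n => Im (u n x)).
  apply: (@cvg_geometric_diff _ S) => j; apply: le_trans (dS j).
  by rewrite -ImN -ImD; exact: Im_le_normc.
apply: ccvg_ReIm.
  rewrite [X in _ --> X](_ : _ = limn (fun n => Re (u n x)))//.
  exact: (@limsup_lim (fun n => Re (u n x))).
rewrite [X in _ --> X](_ : _ = limn (fun n => Im (u n x)))//.
exact: (@limsup_lim (fun n => Im (u n x))).
Qed.

End riesz_fischer.

Section completeness.
Context {R : realType}.
Local Notation mu := (@lebesgue_measure R).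

(** The Riesz-Fischer theorem: a fast subsequence converges almost everywhere, and
    by Fatou's lemma its pointwise limit is the L^2 limit of the whole sequence. *)
Theorem L2_complete (u : nat -> R -> R[i]) : (forall n, L2 (u n)) ->
  (forall e : R, 0 < e -> exists N, forall m n, (N <= m)%N -> (N <= n)%N ->
     nrm (u m \- u n) <= e) ->
  exists2 f, L2 f & L2cvg u f.
Proof.
move=> u2 cu.
have /choice[N hN] : forall j : nat, exists N, forall m n, (N <= m)%N -> (N <= n)%N ->
     nrm (u m \- u n) <= (4^-1) ^+ j / 2.
  by move=> j; apply: cu; rewrite divr_gt0 ?exprn_gt0.
(* a nondecreasing choice of ranks with [psi j >= N j], tending to infinity *)
pose psi j := (\sum_(i < j.+1) N i + j)%N.
have Npsi j : (N j <= psi j)%N.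
  by rewrite /psi big_ord_recr /= -addnA addnCA leq_addr.
have psiS j : (psi j <= psi j.+1)%N.
  by rewrite /psi [in leqRHS]big_ord_recr /= leq_add// leq_addr.
have [||f mf uf] := @fast_cauchy_cvg _ (fun j => u (psi j)).
- by move=> j; exact: u2.
- by move=> j; apply: hN; [exact: leq_trans (Npsi j) (psiS j)|exact: Npsi].
(* for [n >= M] the distances from u_n to the subsequence are at most e, and Fatou's
   lemma passes this bound to the limit *)
have tail (e : R) : 0 < e -> exists M, forall n, (M <= n)%N -> (sqI (u n \- f)%R <= (e ^+ 2)%:E)%E.
  move=> e0; have [M hM] := cu _ e0; exists M => n Mn.
  apply: (@fatou_L2 _ (fun j => u n \- u (psi (j + M)%N))).
  - by move=> j; exact: (L2B (u2 _) (u2 _)).1.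
  - by apply: cmeasB => //; exact: (u2 n).1.
  - apply: ae_imp uf => x; rewrite /ccvg -(cvg_shiftn M).
    apply: cvg_trans; apply: near_eq_cvg; near=> j.
    have -> : (u n \- u (psi (j + M)%N)) x - (u n \- f) x = f x - u (psi (j + M)%N) x.
      by rewrite /=; ring.
    exact: normcB.
  - move=> j; rewrite sqIE; last exact: L2B.
    rewrite lee_fin lerXn2r ?nnegrE ?nrm_ge0 ?(ltW e0)//; apply: hM => //.
    by rewrite (leq_trans _ (leq_addl _ _))// leq_addl.
have mB n : cmeasurable (u n \- f) by apply: cmeasB => //; exact: (u2 n).1.
have f2 : L2 f.
  have [M hM] := tail 1 ltr01.
  have [h2 _] := nrm_le ler01 (mB M) (hM M (leqnn M)).
  rewrite (_ : f = u M \- (u M \- f)); first exact: L2B.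
  by apply/funext => x /=; ring.
exists f => //; apply/cvgr0Pnorm_le => e e0.
have [M hM] := tail _ e0; exists M => // n /= Mn.
rewrite ger0_norm ?nrm_ge0//.
by have [] := nrm_le (ltW e0) (mB n) (hM n Mn).
Unshelve. all: by end_near. Qed.

End completeness.

(** * The Fourier transform of integrable functions *)

Section FT.
Context {R : realType}.
Local Notation mu := (@lebesgue_measure R).
Local Notation T := (measurableTypeR R).
Implicit Types (u v f g : R -> R[i]).

(** The unitary normalization of the Fourier transform. *)
Definition kap : R[i] := ((Num.sqrt (2 * pi))^-1)%:C.

Lemma pi2_gt0 : 0 < 2 * pi :> R. Proof. by rewrite mulr_gt0// pi_gt0. Qed.

Lemma kap_sqr : kap * kap = ((2 * pi)^-1)%:C.
Proof. by rewrite /kap -rmorphM /= -invfM -expr2 sqr_sqrtr// ltW// pi2_gt0. Qed.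

Definition fker (x xi : R) : R[i] := expi (- (x * xi)).

Lemma fkerC x xi : fker x xi = fker xi x.
Proof. by rewrite /fker mulrC. Qed.

Lemma cmeas_fker : cmeas (fun z : T * T => fker z.1 z.2).
Proof.
apply: cmeas_expi; apply: (measurableT_comp (@oppr_measurable R setT)).
by apply: measurable_funM; [exact: measurable_fst|exact: measurable_snd].
Qed.

Lemma fker1 x xi : normc (fker x xi) <= 1.
Proof. by rewrite normc_expi. Qed.

(** On integrable functions the Fourier transform is a convergent integral, and all
    identities are proved there first. *)
Definition FT u (xi : R) : R[i] := kap * cI (fun x => u x * fker x xi).

Lemma FT_L1 u xi : L1 u -> L1 (fun x => u x * fker x xi).
Proof. exact: (kernel_L1 cmeas_fker fker1). Qed.

Lemma FT_cmeas u : cmeasurable u -> cmeasurable (FT u).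
Proof. by move=> mu_; apply: cmeasZ; exact: (kernel_cmeas cmeas_fker). Qed.

Lemma FT_bnd u : L1 u -> exists M, forall xi, normc (FT u xi) <= M.
Proof.
move=> u1; exists (normc (kap : R[i]) * fine (\int[mu]_x (normc (u x))%:E)%E) => xi.
by rewrite normcM ler_wpM2l ?normc_ge0//; exact: (kernel_bnd cmeas_fker fker1).
Qed.

Lemma FTM_L1 u v : L1 u -> L1 v -> L1 (fun x => FT u x * v x).
Proof.
move=> u1 v1; have [M uM] := FT_bnd u1.
by apply: (L1_bndM _ uM v1); apply: FT_cmeas; exact: u1.1.
Qed.

Lemma FTD u v xi : L1 u -> L1 v -> FT (fun x => u x + v x) xi = FT u xi + FT v xi.
Proof.
move=> u1 v1; rewrite /FT -mulrDr -cID; [|exact: FT_L1|exact: FT_L1].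
by congr (_ * cI _); apply/funext => x; rewrite mulrDl.
Qed.

Lemma FTZ c u xi : L1 u -> FT (fun x => c * u x) xi = c * FT u xi.
Proof.
move=> u1; rewrite /FT mulrCA -(cIZ c); last exact: FT_L1.
by congr (_ * cI _); apply/funext => x; rewrite mulrA.
Qed.

(** The multiplication formula: both sides are the same double integral, because the
    Fourier kernel is symmetric. *)
Lemma FT_mul u v : L1 u -> L1 v ->
  cI (fun x => FT u x * v x) = cI (fun x => u x * FT v x).
Proof.
move=> u1 v1.
transitivity (cI (fun y => kap * (v y * cI (fun x => u x * fker x y)))).
  by congr cI; apply/funext => y; rewrite /FT; ring.
rewrite cIZ; last exact: (kernel_intM cmeas_fker fker1).
rewrite (kernel_fubini cmeas_fker fker1 u1 v1).
have e : (fun x => u x * cI (fun y => v y * fker x y)) =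
    (fun x => u x * cI (fun y => v y * fker y x)).
  by apply/funext => x; congr (_ * cI _); apply/funext => y; rewrite fkerC.
rewrite e -cIZ; last exact: (kernel_intM cmeas_fker fker1).
by congr cI; apply/funext => x; rewrite /FT; ring.
Qed.

Lemma kapJ : kap^* = kap.
Proof. by apply: ceqP; rewrite ?ReImE /= ?oppr0. Qed.

Lemma FT_conj u xi : L1 u -> FT (fun x => (u (- x))^*) xi = (FT u xi)^*.
Proof.
move=> u1; rewrite /FT conjcM kapJ; congr (_ * _).
have u2 := FT_L1 xi u1.
rewrite -cIJ// -(cI_preserving mu_preserving_opp (L1J u2)).
congr cI; apply/funext => x; rewrite /comp conjcM; congr (_ * _).
by rewrite /fker expiJ mulNr opprK.
Qed.

Lemma FT_mod u y xi : FT (fun x => u x * fker x y) xi = FT u (xi + y).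
Proof.
rewrite /FT; congr (_ * cI _); apply/funext => x.
by rewrite -mulrA /fker -expiD; congr (_ * expi _); ring.
Qed.

(** Plancherel's formula with a damping factor e^(-e|xi|), needed because the undamped
    product of the transforms need not be integrable. Two applications of the
    multiplication formula move both transforms onto the damping factor, where they
    become a Poisson kernel. The formula is bilinear, hence the reflected variable
    y + x where a convolution has y - x. *)
Lemma damped_plancherel (e : R) u v : 0 < e -> L1 u -> L1 v ->
  cI (fun xi => damp e xi * (FT u xi * FT v xi)) =
  cI (fun x => u x * cI (fun y => v y * (pi^-1 * poisson e (y + x))%:C)).
Proof.
move=> e0 u1 v1; have d1 := L1_damp e0.
(* first application: the factor [FT v * damp] is regarded as one integrable function *)
pose phi xi := FT v xi * damp e xi.
have phi1 : L1 phi by exact: FTM_L1.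
transitivity (cI (fun xi => FT u xi * phi xi)).
  by congr cI; apply/funext => xi; rewrite /phi; ring.
rewrite FT_mul//; congr cI; apply/funext => x; congr (_ * _).
(* second application: the remaining Fourier kernel is absorbed in the damping factor *)
pose psi xi := damp e xi * fker xi x.
have psi1 : L1 psi by exact: FT_L1.
transitivity (kap * cI (fun xi => FT v xi * psi xi)).
  by congr (_ * cI _); apply/funext => xi; rewrite /phi /psi mulrA.
rewrite FT_mul// -cIZ; last first.
  by under eq_fun do rewrite mulrC; exact: FTM_L1.
congr cI; apply/funext => y; rewrite mulrCA; congr (_ * _).
rewrite FT_mod /FT mulrA kap_sqr.
have -> : (fun xi => damp e xi * fker xi (y + x)) =
    (fun xi => damp e xi * expi (- ((y + x) * xi))).
  by apply/funext => xi; rewrite /fker mulrC [_ * (y + x)]mulrC mulrC.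
rewrite damp_transform// -rmorphM /=; congr (_%:C).
by rewrite invfM mulrACA mulVf// mul1r.
Qed.

End FT.

(** * The Fourier transform is a contraction *)

Section contraction.
Context {R : realType}.
Local Notation mu := (@lebesgue_measure R).
Local Notation T := (measurableTypeR R).
Implicit Types (u v f g : R -> R[i]).

(** The normalized Poisson kernel in the reflected variable x + y, as it comes out of
    the damped Plancherel formula. *)
Definition pker (e x y : R) : R := pi^-1 * poisson e (x + y).

Lemma pker_ge0 e x y : 0 < e -> 0 <= pker e x y.
Proof. by move=> e0; rewrite mulr_ge0 ?poisson_ge0// invr_ge0 pi_ge0. Qed.

Lemma pkerC e x y : pker e x y = pker e y x.
Proof. by rewrite /pker addrC. Qed.

Lemma measurable_pker e : 0 < e -> measurable_fun setT (fun z : T * T => pker e z.1 z.2).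
Proof.
move=> e0; apply: measurable_funM; first exact: measurable_cst.
have mp : measurable_fun setT (poisson e).
  by rewrite poisson_shift0; exact: measurable_poisson.
apply: (measurableT_comp mp).
by apply: measurable_funD; [exact: measurable_fst|exact: measurable_snd].
Qed.

Lemma pker_mass e y : 0 < e -> (\int[mu]_x (pker e x y)%:E = 1)%E.
Proof.
move=> e0; under eq_integral do rewrite EFinM.
rewrite ge0_integralZl//.
- by rewrite poisson_mass// -EFinM mulVf// gt_eqF// pi_gt0.
- by apply/measurable_EFinP; exact: measurable_poisson.
- by move=> x _; rewrite lee_fin poisson_ge0.
- by rewrite lee_fin invr_ge0 pi_ge0.
Qed.

Lemma pker_bnd e x y : 0 < e -> pker e x y <= pi^-1 / e.
Proof.
move=> e0; rewrite ler_wpM2l ?invr_ge0 ?pi_ge0// /poisson.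
rewrite ler_pdivrMr ?poisson_den// expr2 mulrDr mulKf ?gt_eqF// lerDl.
by rewrite mulr_ge0 ?invr_ge0 ?sqr_ge0// ltW.
Qed.

Lemma cmeas_pker e y : 0 < e -> cmeasurable (fun x => (pker e x y)%:C).
Proof.
move=> e0; apply: cmeasR; apply: measurable_funM; first exact: measurable_cst.
exact: measurable_poisson.
Qed.

Lemma pker_L1 e u y : 0 < e -> L1 u -> L1 (fun x => u x * (pker e x y)%:C).
Proof.
move=> e0 u1; under eq_fun do rewrite mulrC.
apply: (L1_bndM (a := pi^-1 / e)) => //; first exact: cmeas_pker.
by move=> x; rewrite normcR ger0_norm ?pker_ge0// pker_bnd.
Qed.

Lemma pker_schur_meas e u v : 0 < e -> cmeasurable u -> cmeasurable v ->
  measurable_fun (setT : set T)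
    (fun x => \int[mu]_y (normc (u x) * (normc (v y) * pker e y x))%:E)%E.
Proof.
move=> e0 mu_ mv.
pose F (z : T * T) := (normc (u z.1) * (normc (v z.2) * pker e z.2 z.1))%:E.
apply: (measurable_fun_fubini_tonelli_F (m2 := mu) F); last first.
  by move=> z; rewrite lee_fin mulr_ge0 ?normc_ge0// mulr_ge0 ?normc_ge0 ?pker_ge0.
apply/measurable_EFinP; apply: measurable_funM.
  exact: (measurableT_comp (cmeas_normc mu_) (@measurable_fst _ _ T T)).
apply: measurable_funM.
  exact: (measurableT_comp (cmeas_normc mv) (@measurable_snd _ _ T T)).
by under eq_fun do rewrite pkerC; exact: measurable_pker.
Qed.

(** Schur's test: |u v| is at most |u|^2/2 + |v|^2/2, and the kernel has mass 1 in each
    variable. *)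
Lemma pker_schur e u v : 0 < e -> cmeasurable u -> cmeasurable v ->
  (\int[mu]_x \int[mu]_y (normc (u x) * (normc (v y) * pker e y x))%:E <=
   2^-1%:E * sqI u + 2^-1%:E * sqI v)%E.
Proof.
move=> e0 mu_ mv.
have mp := measurable_pker e0.
pose A (z : T * T) := (2^-1 * normc (u z.1) ^+ 2 * pker e z.1 z.2)%:E.
pose B (z : T * T) := (2^-1 * normc (v z.2) ^+ 2 * pker e z.1 z.2)%:E.
have mA : measurable_fun setT A.
  apply/measurable_EFinP; apply: measurable_funM => //.
  apply: measurable_funM; first exact: measurable_cst.
  exact: (measurableT_comp (measurable_sq mu_) (@measurable_fst _ _ T T)).
have mB : measurable_fun setT B.
  apply/measurable_EFinP; apply: measurable_funM => //.
  apply: measurable_funM; first exact: measurable_cst.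
  exact: (measurableT_comp (measurable_sq mv) (@measurable_snd _ _ T T)).
have A0 z : (0 <= A z)%E by rewrite lee_fin mulr_ge0 ?pker_ge0// mulr_ge0// sqr_ge0.
have B0 z : (0 <= B z)%E by rewrite lee_fin mulr_ge0 ?pker_ge0// mulr_ge0// sqr_ge0.
have half w : cmeasurable w -> (\int[mu]_x (2^-1 * normc (w x) ^+ 2)%:E = 2^-1%:E * sqI w)%E.
  move=> mw; rewrite /sqI -ge0_integralZl//.
  - by apply/measurable_EFinP; exact: measurable_sq.
  - by move=> x _; rewrite lee_fin sqr_ge0.
have mpx x : measurable_fun (setT : set T) (fun y => (pker e y x)%:E).
  apply/measurable_EFinP; apply: measurable_funM; first exact: measurable_cst.
  exact: measurable_poisson.
have iA : (\int[mu]_x \int[mu]_y A (x, y) = 2^-1%:E * sqI u)%E.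
  rewrite -half//; apply: eq_integral => x _.
  transitivity (\int[mu]_y ((2^-1 * normc (u x) ^+ 2)%:E * (pker e y x)%:E))%E.
    by apply: eq_integral => y _; rewrite /A /= pkerC EFinM.
  rewrite ge0_integralZl//.
  - by rewrite pker_mass// mule1.
  - by move=> y _; rewrite lee_fin pker_ge0.
  - by rewrite lee_fin mulr_ge0// sqr_ge0.
have iB : (\int[mu]_x \int[mu]_y B (x, y) = 2^-1%:E * sqI v)%E.
  rewrite (fubini_tonelli B)// -half//; apply: eq_integral => y _.
  transitivity (\int[mu]_x ((2^-1 * normc (v y) ^+ 2)%:E * (pker e x y)%:E))%E.
    by apply: eq_integral => x _; rewrite /B /= EFinM.
  rewrite ge0_integralZl//.
  - by rewrite pker_mass// mule1.
  - by move=> x _; rewrite lee_fin pker_ge0.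
  - by rewrite lee_fin mulr_ge0// sqr_ge0.
rewrite -iA -iB -ge0_integralD//.
- apply: ge0_le_integral => //.
  + move=> x _; apply: integral_ge0 => y _.
    by rewrite lee_fin mulr_ge0 ?normc_ge0// mulr_ge0 ?normc_ge0 ?pker_ge0.
  + exact: pker_schur_meas.
  + by apply: emeasurable_funD;
      [exact: (measurable_fun_fubini_tonelli_F (m2 := mu) A)|
       exact: (measurable_fun_fubini_tonelli_F (m2 := mu) B)].
  + move=> x _; rewrite -ge0_integralD//; last 2 first.
    * exact: (measurableT_comp mA (measurable_pair1 x)).
    * exact: (measurableT_comp mB (measurable_pair1 x)).
    apply: ge0_le_integral => //.
    * by move=> y _; rewrite lee_fin mulr_ge0 ?normc_ge0// mulr_ge0 ?normc_ge0 ?pker_ge0.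
    * apply/measurable_EFinP; apply: measurable_funM; first exact: measurable_cst.
      apply: measurable_funM; first exact: cmeas_normc.
      by apply/measurable_EFinP; exact: mpx.
    * apply: emeasurable_funD; first exact: (measurableT_comp mA (measurable_pair1 x)).
      exact: (measurableT_comp mB (measurable_pair1 x)).
    * move=> y _; rewrite /A /B /= -EFinD lee_fin pkerC -mulrDl mulrA.
      rewrite ler_wpM2r ?pker_ge0//.
      have := sqr_ge0 (normc (u x) - normc (v y)); rewrite sqrrB; lra.
- by move=> x _; exact: integral_ge0.
- exact: (measurable_fun_fubini_tonelli_F (m2 := mu) A).
- by move=> x _; exact: integral_ge0.
- exact: (measurable_fun_fubini_tonelli_F (m2 := mu) B).
Qed.

Lemma pker_pair_L1 e u v : 0 < e -> L1 u -> L1 v -> L2 u -> L2 v ->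
  let W x := u x * cI (fun y => v y * (pker e y x)%:C) in
  L1 W /\ (\int[mu]_x (normc (W x))%:E <= (2^-1 * nrm u ^+ 2 + 2^-1 * nrm v ^+ 2)%:E)%E.
Proof.
move=> e0 u1 v1 u2 v2 W.
have mW : cmeasurable W.
  apply: cmeasM; first exact: u1.1.
  apply: (@kernel_cmeas _ (fun y x => (pker e y x)%:C)); last exact: v1.1.
  by apply: cmeasR; exact: measurable_pker.
have bW : (\int[mu]_x (normc (W x))%:E <= (2^-1 * nrm u ^+ 2 + 2^-1 * nrm v ^+ 2)%:E)%E.
  rewrite EFinD (EFinM _ (nrm u ^+ 2)) (EFinM _ (nrm v ^+ 2)) -!sqIE//; apply: le_trans (pker_schur e0 u1.1 v1.1).
  apply: ge0_le_integral => //.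
  - by move=> x _; rewrite lee_fin normc_ge0.
  - exact: measurable_normcE.
  - exact: (pker_schur_meas e0 u1.1 v1.1).
  - move=> x _; have h := pker_L1 x e0 v1.
    have m : measurable_fun (setT : set T) (fun y => (normc (v y * (pker e y x)%:C))%:E).
      by apply: measurable_normcE; exact: h.1.
    apply: (@le_trans _ _ ((normc (u x))%:E * \int[mu]_y (normc (v y * (pker e y x)%:C))%:E)%E).
      by rewrite normcM EFinM lee_wpmul2l ?lee_fin ?normc_ge0//; exact: normc_cI.
    rewrite -ge0_integralZl//; last 2 first.
    + by move=> y _; rewrite lee_fin normc_ge0.
    + by rewrite lee_fin normc_ge0.
    rewrite le_eqVlt; apply/orP; left; apply/eqP; apply: eq_integral => y _.
    by rewrite -EFinM normcM normcR ger0_norm ?pker_ge0.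
by split=> //; split=> //; apply: le_lt_trans bW _; rewrite ltry.
Qed.

(** The damped Plancherel formula and Schur's test bound the damped L^2 norm of the
    transform by the L^2 norm of the function, uniformly in the damping; Fatou's lemma
    removes the damping. *)
Lemma FT_contraction u : L1 u -> L2 u -> L2 (FT u) /\ nrm (FT u) <= nrm u.
Proof.
(* the transform of [v] is the conjugate of that of [u], so the bilinear formula yields
   the square of a modulus *)
move=> u1 u2; pose v x := (u (- x))^*.
have v1 : L1 v by exact: (L1J (L1_preserving mu_preserving_opp u1)).
have [un2 unE] := L2_preserving mu_preserving_opp u2.
have v2 : L2 v by exact: (L2J un2).
have vE : nrm v = nrm u by rewrite -unE; apply: nrm_eq => x; rewrite normcJ.
have mF := FT_cmeas u1.1.
apply: nrm_le => //; first exact: nrm_ge0.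
have damped (e : R) : 0 < e ->
    (\int[mu]_x (expR (- (e * `|x : R|)) * normc (FT u x) ^+ 2)%:E <= (nrm u ^+ 2)%:E)%E.
  move=> e0; pose W x := damp e x * (FT u x * FT v x).
  have WE x : W x = (expR (- (e * `|x|)) * normc (FT u x) ^+ 2)%:C.
    by rewrite /W (FT_conj _ u1) mulcJ /damp -rmorphM.
  have W1 : L1 W.
    have [M uM] := FT_bnd u1; have [N vN] := FT_bnd v1.
    rewrite (_ : W = fun x => FT u x * (FT v x * damp e x)); last first.
      by apply/funext => x; rewrite /W; ring.
    apply: (L1_bndM mF uM); apply: (L1_bndM _ vN); last exact: L1_damp.
    by apply: FT_cmeas; exact: v1.1.
  have e1 : (\int[mu]_x (expR (- (e * `|x : R|)) * normc (FT u x) ^+ 2)%:E = (Re (cI W))%:E)%E.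
    have -> : Re (cI W) = Rintegral mu setT (fun x => Re (W x)) by [].
    rewrite /Rintegral fineK; last by apply: integrable_fin_num => //; exact: (L1_Re W1).
    by apply: eq_integral => x _; rewrite WE.
  rewrite e1; have [V1 Vb] := pker_pair_L1 e0 u1 v1 u2 v2.
  apply: (@le_trans _ _ (normc (cI W))%:E).
    by rewrite lee_fin (le_trans (ler_norm _))// Re_le_normc.
  rewrite /W damped_plancherel//; apply: (le_trans (normc_cI V1)).
  by apply: (le_trans Vb); rewrite lee_fin vE; lra.
apply: (@fatou_le _ (fun n x => expR (- (n.+1%:R^-1 * `|x|)) * normc (FT u x) ^+ 2)).
- move=> n; apply: measurable_funM; last exact: measurable_sq.
  exact: (cmeas_damp n.+1%:R^-1).1.
- by move=> n x; rewrite mulr_ge0 ?expR_ge0 ?sqr_ge0.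
- exact: measurable_sq.
- by move=> x; exact: sqr_ge0.
- apply: aeW => x; rewrite -[X in _ --> X]mul1r; apply: cvgM; last exact: cvg_cst.
  rewrite [X in _ --> X](_ : _ = expR (- (0 * `|x|))); last by rewrite mul0r oppr0 expR0.
  apply: continuous_cvg; first exact: continuous_expR.
  apply: cvgN; apply: cvgM; last exact: cvg_cst.
  exact: cvg_harmonic.
- by move=> n; apply: damped; rewrite invr_gt0.
Qed.

End contraction.

(** * The Fourier transform of square integrable functions *)

Section fourier_L2.
Context {R : realType}.
Local Notation mu := (@lebesgue_measure R).
Implicit Types (u v f g : R -> R[i]).

(** The truncations that define [fourier]; they are integrable. *)
Definition cut (k : nat) f (x : R) : R[i] := ind `[- k%:R, k%:R] x * f x.

Lemma cmeas_itv (a b : R) : cmeasurable (ind `[a, b]).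
Proof. by apply: cmeas_ind; exact: measurable_itv. Qed.

Lemma L2_ind (D : set R) : measurable D -> (mu D < +oo)%E -> L2 (ind D).
Proof.
move=> mD Doo; apply/L2P; split; first exact: cmeas_ind.
have -> : sqI (ind D) = (\int[mu]_x (\1_D x)%:E)%E.
  apply: eq_integral => x _; rewrite normc_ind indicE; congr EFin.
  by case: (x \in D); rewrite ?expr1n ?expr0n.
by rewrite integral_indic// setIT.
Qed.

Lemma L2_itv (a b : R) : L2 (ind `[a, b]).
Proof.
apply: L2_ind; first exact: measurable_itv.
by rewrite lebesgue_measure_itv; case: ifPn => _; rewrite ?ltry// -EFinD ltry.
Qed.

Lemma L2_indM (D : set R) f : measurable D -> L2 f -> L2 (fun x => ind D x * f x).
Proof.
move=> mD f2; apply: (L2_le _ f2); last by move=> x; exact: normc_indM.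
by apply: cmeasM; [exact: cmeas_ind|exact: f2.1].
Qed.

Lemma cut_L1 k f : L2 f -> L1 (cut k f).
Proof. by apply: L1M; exact: L2_itv. Qed.

Lemma cut_L2 k f : L2 f -> L2 (cut k f).
Proof. by apply: L2_indM; exact: measurable_itv. Qed.

Lemma nrm_cvg0 (u : nat -> R -> R[i]) : (forall n, L2 (u n)) ->
  (sqI (u n) @[n --> \oo] --> 0)%E -> nrm (u n) @[n --> \oo] --> (0 : R).
Proof.
move=> u2 /fine_cvg/= u0; apply/cvgr0Pnorm_le => e e0.
have e20 : 0 < e ^+ 2 by rewrite exprn_gt0.
move/cvgr0_norm_le: u0 => /(_ _ e20); apply: filterS => n /=.
rewrite sqIE//= ger0_norm ?sqr_ge0// ger0_norm ?nrm_ge0//.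
by rewrite ler_pXn2r ?nnegrE ?nrm_ge0// ltW.
Qed.

(** Dominated convergence for the squares of the moduli. *)
Lemma L2_dominated (u : nat -> R -> R[i]) f :
  (forall n, cmeasurable (u n)) -> L2 f ->
  {ae mu, forall x, ccvg (u^~ x) 0} ->
  (forall n x, normc (u n x) <= normc (f x)) ->
  nrm (u n) @[n --> \oo] --> (0 : R).
Proof.
move=> mu_ f2 u0 uf; apply: nrm_cvg0.
  by move=> n; exact: (L2_le (mu_ n) f2).
have /L2P[mf fi] := f2.
pose U n x : R[i] := (normc (u n x) ^+ 2)%:C.
have h := @dominated_L1 _ U (cst 0) (fun x => normc (f x) ^+ 2).
have -> : (fun n => sqI (u n)) = (fun n => \int[mu]_x (normc (U n x - cst 0 x))%:E)%E.
  apply/funext => n; apply: eq_integral => x _.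
  by rewrite subr0 normcR ger0_norm// sqr_ge0.
apply: h.
- by move=> n; apply: cmeasR; exact: measurable_sq.
- exact: cmeas_cst.
- apply: ae_imp u0 => x; rewrite /ccvg => ux.
  have -> : (0 : R) = 0 * 0 by rewrite mul0r.
  have ux' : normc (u n x) @[n --> \oo] --> (0 : R).
    by under eq_fun do rewrite -[u _ x]subr0.
  have -> : (fun n => normc (U n x - cst 0 x)) = (fun n => normc (u n x) * normc (u n x)).
    by apply/funext => n; rewrite subr0 normcR ger0_norm ?sqr_ge0.
  exact: cvgM.
- move=> n x; rewrite subr0 normcR ger0_norm ?sqr_ge0//.
  by rewrite lerXn2r ?nnegrE ?normc_ge0.
- apply/integrableP; split.
    by apply/measurable_EFinP; exact: measurable_sq.
  apply: le_lt_trans fi; rewrite le_eqVlt; apply/orP; left; apply/eqP.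
  by apply: eq_integral => x _; rewrite gee0_abs// lee_fin sqr_ge0.
Qed.

Lemma cut_cvg f : L2 f -> L2cvg (cut^~ f) f.
Proof.
move=> f2; apply: (@L2_dominated _ f) => //.
- by move=> n; exact: (L2B (cut_L2 n f2) f2).1.
- apply: aeW => x; rewrite /ccvg; apply/cvg_ballP => e e0.
  near=> n; rewrite /cut /= (_ : ind _ x = 1).
    by rewrite mul1r !subrr normc0; exact: ballxx.
  apply: ind_in => /=; rewrite in_itv/= -ler_norml.
  by near: n; exact: nbhs_infty_ger.
- move=> n x; rewrite /cut /= indE; case: (x \in _).
    by rewrite mul1r subrr normc0 normc_ge0.
  by rewrite mul0r sub0r normcN.
Unshelve. all: by end_near. Qed.

Lemma fourier_truncE k f : fourier_trunc k f = FT (cut k f).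
Proof.
apply/funext => xi; rewrite /fourier_trunc /FT cintegral_ind; last exact: measurable_itv.
congr (_ * cI _); apply/funext => x.
by rewrite /cut /fker mulrA mulrAC.
Qed.

Lemma FTB u v : L1 u -> L1 v -> FT u \- FT v = FT (u \- v).
Proof.
move=> u1 v1; apply/funext => xi.
have -> : u \- v = (fun x => u x + (-1) * v x).
  by apply/funext => x; rewrite mulN1r.
rewrite (FTD xi u1 (L1Z (-1) v1)) (FTZ (-1) xi v1).
by rewrite [in RHS]mulN1r.
Qed.

Lemma FT_dist u v : L1 u -> L1 v -> L2 u -> L2 v ->
  nrm (FT u \- FT v) <= nrm (u \- v).
Proof.
move=> u1 v1 u2 v2; rewrite FTB//.
by have [] := FT_contraction (L1B u1 v1) (L2B u2 v2).
Qed.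

(** The transforms of the truncations form a Cauchy sequence because the Fourier
    transform is a contraction on integrable functions in L^2. *)
Lemma fourier_ex f : L2 f -> exists g, is_fourier f g.
Proof.
move=> f2; pose u n := FT (cut n f).
have u2 n : L2 (u n) by have [] := FT_contraction (cut_L1 n f2) (cut_L2 n f2).
have [|g g2 ug] := L2_complete u2; last first.
  exists g; split=> //; under eq_fun do rewrite fourier_truncE.
  exact/(L2cvgP u2 g2).
move=> e e0; have e20 : 0 < e / 2 by rewrite divr_gt0.
move/cvgr0_norm_le: (cut_cvg f2) => /(_ _ e20)[N _ hN].
(* both truncations are within e/2 of [f] *)
exists N => m n Nm Nn.
rewrite (le_trans (FT_dist (cut_L1 _ f2) (cut_L1 _ f2) (cut_L2 _ f2) (cut_L2 _ f2)))//.
have := hN m Nm; have := hN n Nn; rewrite /= !ger0_norm ?nrm_ge0// => h1 h2.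
have := nrmB (L2B (cut_L2 m f2) f2) (L2B (cut_L2 n f2) f2).
rewrite (_ : (cut m f \- f) \- (cut n f \- f) = cut m f \- cut n f).
  by move=> /le_trans; apply; lra.
by apply/funext => x /=; ring.
Qed.

(** [fourier f] is a chosen element of the set of possible transforms; as this set is
    not empty, the choice lies in it. *)
Lemma fourierP f : L2 f -> L2 (fourier f) /\ L2cvg (fun k => FT (cut k f)) (fourier f).
Proof.
move=> f2; have [g fg] := fourier_ex f2.
have [F2 FF] : is_fourier f (fourier f) by exact: (xgetI (cst 0) fg).
split; first exact: F2.
apply: (L2cvgP _ F2).2.
  by move=> n; have [] := FT_contraction (cut_L1 n f2) (cut_L2 n f2).
by move: FF; under eq_fun do rewrite fourier_truncE.
Qed.

Lemma fourier_L2 f : L2 f -> L2 (fourier f).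
Proof. by move=> /fourierP[]. Qed.

(** Any integrable approximation may replace the truncations, again because the
    transform is a contraction; so identities for integrable functions extend to L^2. *)
Lemma fourier_lim (u : nat -> R -> R[i]) f :
  (forall n, L1 (u n)) -> (forall n, L2 (u n)) -> L2 f -> L2cvg u f ->
  L2cvg (fun n => FT (u n)) (fourier f).
Proof.
move=> u1 u2 f2 uf; have [F2 FF] := fourierP f2.
have c1 n := cut_L1 n f2; have c2 n := cut_L2 n f2.
have Fu2 n : L2 (FT (u n)) by have [] := FT_contraction (u1 n) (u2 n).
have Fc2 n : L2 (FT (cut n f)) by have [] := FT_contraction (c1 n) (c2 n).
apply: (@L2cvg_le _ _ _ (fun n => (nrm (u n \- f) + nrm (cut n f \- f)) +
    nrm (FT (cut n f) \- fourier f))).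
  move=> n; have -> : FT (u n) \- fourier f =
      (FT (u n) \- FT (cut n f)) \+ (FT (cut n f) \- fourier f).
    by apply/funext => x /=; rewrite addrA subrK.
  apply: (le_trans (nrmD (L2B (Fu2 n) (Fc2 n)) (L2B (Fc2 n) F2))).
  rewrite lerD2r (le_trans (FT_dist (u1 n) (c1 n) (u2 n) (c2 n)))//.
  have -> : u n \- cut n f = (u n \- f) \- (cut n f \- f).
    by apply/funext => x /=; ring.
  exact: (nrmB (L2B (u2 n) f2) (L2B (c2 n) f2)).
have -> : (0 : R) = (0 + 0) + 0 by rewrite !addr0.
by apply: cvgD => //; apply: cvgD => //; exact: cut_cvg.
Qed.

Lemma L2cvg_cst f : L2cvg (fun=> f) f.
Proof.
rewrite /L2cvg (_ : f \- f = fun x => 0 * (f \- f) x); last first.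
  by apply/funext => x /=; rewrite subrr mulr0.
have -> : nrm (fun x => 0 * (f \- f) x) = 0.
  rewrite /nrm L2norm_sqrte /sqI (_ : (\int[mu]_x _ = 0)%E) /= ?sqrtr0//.
  by rewrite -[RHS](integral0 mu setT); apply: eq_integral => x _; rewrite mul0r normc0 expr0n.
exact: cvg_cst.
Qed.

Lemma fourier_L1 f : L1 f -> L2 f -> {ae mu, forall x, fourier f x = FT f x}.
Proof.
move=> f1 f2; have [F2 FF] := FT_contraction f1 f2.
apply: (@L2cvg_unique _ (fun=> FT f)) => //; first exact: fourier_L2.
  by apply: fourier_lim => //; exact: L2cvg_cst.
exact: L2cvg_cst.
Qed.

Lemma fourier_contraction f : L2 f -> nrm (fourier f) <= nrm f.
Proof.
move=> f2; have [F2 FF] := fourierP f2.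
have Fc n := FT_contraction (cut_L1 n f2) (cut_L2 n f2).
have h1 := cvg_nrm (fun n => (Fc n).1) F2 FF.
have h2 := cvg_nrm (fun n => cut_L2 n f2) f2 (cut_cvg f2).
rewrite -(cvg_lim (@Rhausdorff R) h1) -(cvg_lim (@Rhausdorff R) h2).
apply: ler_lim; [by apply/cvg_ex; eexists; exact: h1|by apply/cvg_ex; eexists; exact: h2|].
by apply: nearW => n; exact: (Fc n).2.
Qed.

Lemma fourierD f g : L2 f -> L2 g ->
  {ae mu, forall x, fourier (f \+ g) x = fourier f x + fourier g x}.
Proof.
move=> f2 g2; have [F2 FF] := fourierP f2; have [G2 GG] := fourierP g2.
have Fc n := FT_contraction (cut_L1 n f2) (cut_L2 n f2).
have Gc n := FT_contraction (cut_L1 n g2) (cut_L2 n g2).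
have fg2 := L2D f2 g2.
apply: (@L2cvg_unique _ (fun n => FT (cut n f) \+ FT (cut n g))).
- by move=> n; exact: (L2D (Fc n).1 (Gc n).1).
- exact: fourier_L2.
- exact: L2D.
- have -> : (fun n => FT (cut n f) \+ FT (cut n g)) = (fun n => FT (cut n f \+ cut n g)).
    apply/funext => n; apply/funext => x.
    exact: (esym (FTD x (cut_L1 n f2) (cut_L1 n g2))).
  apply: fourier_lim => //.
  + by move=> n; apply: L1D; exact: cut_L1.
  + by move=> n; apply: L2D; exact: cut_L2.
  + apply: L2cvgD => //; try exact: cut_cvg; by move=> n; exact: cut_L2.
- by apply: L2cvgD => // n; [exact: (Fc n).1|exact: (Gc n).1].
Qed.

Lemma fourierZ c f : L2 f ->
  {ae mu, forall x, fourier (fun x => c * f x) x = c * fourier f x}.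
Proof.
move=> f2; have [F2 FF] := fourierP f2.
have Fc n := FT_contraction (cut_L1 n f2) (cut_L2 n f2).
apply: (@L2cvg_unique _ (fun n x => c * FT (cut n f) x)).
- by move=> n; exact: (L2Z c (Fc n).1).
- by apply: fourier_L2; exact: L2Z.
- exact: L2Z.
- have -> : (fun n x => c * FT (cut n f) x) = (fun n => FT (fun x => c * cut n f x)).
    apply/funext => n; apply/funext => x.
    exact: (esym (FTZ c x (cut_L1 n f2))).
  apply: fourier_lim => //.
  + by move=> n; apply: L1Z; exact: cut_L1.
  + by move=> n; apply: L2Z; exact: cut_L2.
  + exact: L2Z.
  + apply: L2cvgZ => //; last exact: cut_cvg.
    by move=> n; exact: cut_L2.
- by apply: L2cvgZ => // n; exact: (Fc n).1.
Qed.

Lemma fourierB f g : L2 f -> L2 g ->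
  {ae mu, forall x, fourier (f \- g) x = fourier f x - fourier g x}.
Proof.
move=> f2 g2; have gN := L2Z (-1) g2.
have -> : f \- g = f \+ (fun x => (-1) * g x).
  by apply/funext => x /=; rewrite mulN1r.
apply: ae_imp2 (fourierD f2 gN) (fourierZ (-1) g2) => x /= -> ->.
by rewrite mulN1r.
Qed.

Lemma fourier_ae f g : L2 f -> L2 g -> {ae mu, forall x, f x = g x} ->
  {ae mu, forall x, fourier f x = fourier g x}.
Proof.
move=> f2 g2 fg; have d2 := L2B f2 g2.
have n0 : nrm (f \- g) = 0.
  rewrite -[RHS](_ : nrm (fun x => 0 * f x) = 0); last by rewrite nrmZ// normc0 mul0r.
  apply: nrm_ae; [exact: d2.1|by apply: cmeasZ; exact: f2.1|].
  by apply: ae_imp fg => x /= ->; rewrite subrr mul0r.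
have F0 : nrm (fourier (f \- g)) = 0.
  by apply/eqP; rewrite eq_le nrm_ge0 andbT -[leRHS]n0 fourier_contraction.
apply: ae_imp2 (nrm0_ae (fourier_L2 d2) F0) (fourierB f2 g2) => x -> /esym/eqP.
by rewrite subr_eq0 => /eqP.
Qed.

(** Both sides are continuous bilinear forms on L^2 that agree on truncations. *)
Lemma fourier_mul f g : L2 f -> L2 g ->
  cI (fun x => fourier f x * g x) = cI (fun x => f x * fourier g x).
Proof.
move=> f2 g2; have [F2 FF] := fourierP f2; have [G2 GG] := fourierP g2.
have Fc n := FT_contraction (cut_L1 n f2) (cut_L2 n f2).
have Gc n := FT_contraction (cut_L1 n g2) (cut_L2 n g2).
have cf := cut_cvg f2; have cg := cut_cvg g2.
have h1 := ccvg_cIM (fun n => (Fc n).1) (fun n => cut_L2 n g2) F2 g2 FF cg.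
have h2 := ccvg_cIM (fun n => cut_L2 n f2) (fun n => (Gc n).1) f2 G2 cf GG.
apply: (ccvg_unique h1); move: h2; congr ccvg; apply/funext => n.
by rewrite FT_mul//; exact: cut_L1.
Qed.

Lemma fourier_cvg (u : nat -> R -> R[i]) f : (forall n, L2 (u n)) -> L2 f ->
  L2cvg u f -> L2cvg (fun n => fourier (u n)) (fourier f).
Proof.
move=> u2 f2 uf; apply: (@L2cvg_le _ _ _ (fun n => nrm (u n \- f))) => // n.
rewrite -(@nrm_ae _ (fourier (u n \- f))).
- by apply: fourier_contraction; exact: L2B.
- by apply: (fourier_L2 _).1; exact: L2B.
- by apply: (L2B _ _).1; exact: fourier_L2.
- exact: fourierB.
Qed.

End fourier_L2.

(** * Inversion and the theorems of Plancherel *)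

Section inversion.
Context {R : realType}.
Local Notation mu := (@lebesgue_measure R).
Implicit Types (u v f g : R -> R[i]).

Lemma locally_integrable_L2 (w : R -> R) :
  measurable_fun setT w -> L2 (fun x => (w x)%:C) -> locally_integrable setT w.
Proof.
move=> mw w2; split => //; first exact: openT.
move=> K _ cK; have mK := compact_measurable cK.
have K2 : L2 (ind K) by apply: L2_ind => //; exact: compact_finite_measure.
have [_ h] := L1M K2 w2; apply: le_lt_trans h.
rewrite integral_mkcond le_eqVlt; apply/orP; left; apply/eqP.
apply: eq_integral => x _; rewrite patchE indE; case: (x \in K).
  by rewrite mul1r normcR.
by rewrite mul0r normc0.
Qed.

(** The primitive of [w] vanishes identically, and by Lebesgue's differentiation
    theorem its derivative is [w] almost everywhere. *)
Lemma itv_zero_right (w : R -> R) (a : R) : locally_integrable setT w ->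
  (forall b, Rintegral mu `[a, b] w = 0) ->
  {ae mu, forall x, a < x -> w x = 0}.
Proof.
move=> lw w0.
have iw y : mu.-integrable `[a, y] (EFin \o w).
  have [mw _ h] := lw; apply/integrableP; split.
    by apply/measurable_EFinP; exact: measurable_funTS.
  by have := h _ (subsetT _) (@segment_compact R a y).
have := FTC1 iw lw; apply: ae_imp => x h ax.
have [_ <-] := h ax.
rewrite (_ : (fun x => _) = cst 0); last by apply/funext => y; exact: w0.
exact: derive1_cst.
Qed.

Lemma itv_zero (w : R -> R) : locally_integrable setT w ->
  (forall a b, Rintegral mu `[a, b] w = 0) -> {ae mu, forall x, w x = 0}.
Proof.
move=> lw w0.
have h : {ae mu, forall x, forall n : nat, - n%:R < x -> w x = 0}.
  by apply/ae_foralln => n; exact: (itv_zero_right lw (w0 (- n%:R))).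
apply: ae_imp h => x; apply; rewrite ltrNl; apply: le_lt_trans (truncnS_gt `|x|).
by rewrite -normrN ler_norm.
Qed.

Lemma itv_zero_L2 (w : R -> R[i]) : L2 w ->
  (forall a b, cI (fun x => w x * ind `[a, b] x) = 0) -> {ae mu, forall x, w x = 0}.
Proof.
move=> w2 w0.
have cw a b : cintegral `[a, b] w = 0.
  by rewrite cintegral_ind// -[RHS](w0 a b); congr cI; apply/funext => x; rewrite mulrC.
have hr : {ae mu, forall x, Re (w x) = 0}.
  apply: itv_zero => [|a b]; last by have := congr1 (@complex.Re R) (cw a b).
  apply: locally_integrable_L2; first exact: w2.1.1.
  apply: (L2_le _ w2); first by apply: cmeasR; exact: w2.1.1.
  by move=> x; rewrite normcR Re_le_normc.
have hi : {ae mu, forall x, Im (w x) = 0}.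
  apply: itv_zero => [|a b]; last by have := congr1 (@complex.Im R) (cw a b).
  apply: locally_integrable_L2; first exact: w2.1.2.
  apply: (L2_le _ w2); first by apply: cmeasR; exact: w2.1.2.
  by move=> x; rewrite normcR Im_le_normc.
by apply: ae_imp2 hr hi => x rx ix; apply: ceqP; rewrite ?rx ?ix.
Qed.

Lemma atan_cvg_pos (c : R) : 0 < c -> atan (c / n.+1%:R^-1) @[n --> \oo] --> (pi / 2 : R).
Proof.
move=> c0; apply: (cvg_comp _ _ _ (@cvgy_atan R)).
apply/cvgryPge => A; near=> n; rewrite invrK.
rewrite -ler_pdivrMl// (le_trans (ler_norm _))//.
have : (Num.truncn `|c^-1 * A|).+1%:R <= n.+1%:R :> R.
  by rewrite ler_nat ltnS; near: n; exact: nbhs_infty_ge.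
by apply: le_trans; exact/ltW/truncnS_gt.
Unshelve. all: by end_near. Qed.

Lemma atan_cvg_neg (c : R) : c < 0 -> atan (c / n.+1%:R^-1) @[n --> \oo] --> (- (pi / 2) : R).
Proof.
move=> c0; have := @atan_cvg_pos (- c); rewrite oppr_gt0 => /(_ c0) h.
have -> : (fun n => atan (c / n.+1%:R^-1)) = (fun n => - atan (- c / n.+1%:R^-1)).
  by apply/funext => n; rewrite mulNr atanN opprK.
exact: cvgN.
Qed.

(** The primitive of the Poisson kernel is an arctangent. *)
Lemma pker_itv (e a b x : R) : 0 < e -> a <= b ->
  cI (fun y => ind `[a, b] y * (pker e y x)%:C) =
  (pi^-1 * (atan ((b + x) / e) - atan ((a + x) / e)))%:C.
Proof.
move=> e0 ab; rewrite -cintegral_ind//; apply: ceqP => /=; last first.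
  by rewrite /Rintegral integral0.
rewrite -(poisson_itv x e0 ab) -RintegralZl//.
have := L1_Re (pker_L1 x e0 (L1_itv a b)).
rewrite (_ : (fun y => _) = (fun y => (pker e y x)%:E) \_ `[a, b]); last first.
  apply/funext => y; rewrite patchE indE ReM /=.
  by case: (y \in _); rewrite /= ?mul1r ?mul0r subr0.
move=> h; have {}h : mu.-integrable `[a, b] (fun y => (pker e y x)%:E).
  apply/integrable_mkcond; [exact: measurable_itv|exact: h].
have mI : measurable (`[a, b]%classic : set (measurableTypeR R)) by exact: measurable_itv.
have := integrableZl mI pi h; apply: eq_integrable => // y _ /=.
by rewrite -EFinM /pker mulrA divff ?mul1r// gt_eqF// pi_gt0.
Qed.

(** The arctangents tend to pi/2 or -pi/2 according to the side of the endpoint, so the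
    Poisson integrals of the indicator recover it away from the endpoints. *)
Lemma pker_itv_lim (a b x : R) : a <= b -> - x != a -> - x != b ->
  ccvg (fun n => cI (fun y => ind `[a, b] y * (pker n.+1%:R^-1 y x)%:C)) (ind `[a, b] (- x)).
Proof.
move=> ab xa xb.
have n0 n : 0 < n.+1%:R^-1 :> R by rewrite invr_gt0.
have pi0 : pi != 0 :> R by rewrite gt_eqF// pi_gt0.
(* the limit of arctan(c n) for [c] nonzero *)
pose s (c : R) : R := if 0 < c then pi / 2 else - (pi / 2).
have sc (c : R) : c != 0 -> atan (c / n.+1%:R^-1) @[n --> \oo] --> s c.
  rewrite /s neq_lt => /orP[c0|c0]; last by rewrite c0; exact: atan_cvg_pos.
  by rewrite ltNge (ltW c0); exact: atan_cvg_neg.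
have hb : b + x != 0 by apply: contra xb => /eqP h; apply/eqP; lra.
have ha : a + x != 0 by apply: contra xa => /eqP h; apply/eqP; lra.
have lim : pi^-1 * (atan ((b + x) / n.+1%:R^-1) - atan ((a + x) / n.+1%:R^-1))
    @[n --> \oo] --> pi^-1 * (s (b + x) - s (a + x)).
  by apply: cvgM; [exact: cvg_cst|apply: cvgB; apply: sc].
have -> : ind `[a, b] (- x) = (pi^-1 * (s (b + x) - s (a + x)))%:C.
  rewrite /ind indicE mem_setE in_itv/= /s.
  have -> : (a <= - x) = (a + x <= 0) by rewrite -lerBrDr sub0r.
  have -> : (- x <= b) = (0 <= b + x) by rewrite -lerBlDr sub0r.
  have [a0|a0] := leP (a + x) 0; have [b0|b0] := leP 0 (b + x); congr (_%:C) => /=.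
  - by rewrite lt_neqAle eq_sym hb b0 /= opprK -splitr mulVf.
  - by rewrite ltNge (ltW b0) /= subrr mulr0.
  - by rewrite lt_neqAle eq_sym hb b0 /= subrr mulr0.
  - by exfalso; lra.
have e n : cI (fun y => ind `[a, b] y * (pker n.+1%:R^-1 y x)%:C) =
    (pi^-1 * (atan ((b + x) / n.+1%:R^-1) - atan ((a + x) / n.+1%:R^-1)))%:C.
  exact: pker_itv.
under eq_fun do rewrite e.
by apply: ccvg_ReIm => /=; [exact: lim|exact: cvg_cst].
Qed.

(** Let the damping tend to 0 in the damped Plancherel formula: the left side converges
    because the product of two L^2 functions is integrable, the right side because the
    Poisson integrals of an indicator converge boundedly. *)
Lemma inversion_itv_L1 f (a b : R) : a <= b -> L1 f -> L2 f ->
  cI (fun x => FT f x * FT (ind `[a, b]) x) = cI (fun x => f x * ind `[a, b] (- x)).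
Proof.
move=> ab f1 f2; have i1 := L1_itv a b; have i2 := L2_itv a b.
have [F2 _] := FT_contraction f1 f2; have [I2 _] := FT_contraction i1 i2.
have FI1 := L1M F2 I2.
have n0 n : 0 < n.+1%:R^-1 :> R by rewrite invr_gt0.
pose D n x := damp n.+1%:R^-1 x * (FT f x * FT (ind `[a, b]) x).
have lim1 : ccvg (fun n => cI (D n)) (cI (fun x => FT f x * FT (ind `[a, b]) x)).
  apply: (@dominated_cI _ D _ (fun x => normc (FT f x * FT (ind `[a, b]) x))).
  - by move=> n; apply: cmeasM; [exact: cmeas_damp|exact: FI1.1].
  - exact: FI1.1.
  - apply: aeW => x; have h : ccvg (fun n => damp n.+1%:R^-1 x) 1.
      apply: ccvg_ReIm => /=; last exact: cvg_cst.
      rewrite [X in _ --> X](_ : _ = expR (- (0 * `|x|))); last by rewrite mul0r oppr0 expR0.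
      apply: continuous_cvg; first exact: continuous_expR.
      apply: cvgN; apply: cvgM; last exact: cvg_cst.
      exact: cvg_harmonic.
    have := ccvgZ (FT f x * FT (ind `[a, b]) x) h; rewrite mulr1; congr ccvg.
    by apply/funext => n; rewrite mulrC.
  - by move=> n x; rewrite /D normcM ler_piMl ?normc_ge0// normc_damp.
  - by move=> x.
  - exact: (L1_int FI1).
pose E n x := f x * cI (fun y => ind `[a, b] y * (pker n.+1%:R^-1 y x)%:C).
have lim2 : ccvg (fun n => cI (E n)) (cI (fun x => f x * ind `[a, b] (- x))).
  have q1 n x : normc (cI (fun y => ind `[a, b] y * (pker n.+1%:R^-1 y x)%:C)) <= 1.
    rewrite pker_itv// normcR ger0_norm; last first.
      rewrite mulr_ge0 ?invr_ge0 ?pi_ge0// subr_ge0 le_atan//.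
      by rewrite ler_wpM2r ?invr_ge0// lerD2r.
    rewrite mulrC ler_pdivrMr ?pi_gt0// mul1r.
    have := atan_ltpi2 ((b + x) / n.+1%:R^-1); have := atan_gtNpi2 ((a + x) / n.+1%:R^-1).
    lra.
  apply: (@dominated_cI _ E _ (fun x => normc (f x))).
  - move=> n; apply: cmeasM; first exact: f1.1.
    apply: (@kernel_cmeas _ (fun y x => (pker n.+1%:R^-1 y x)%:C)); last exact: i1.1.
    by apply: cmeasR; exact: measurable_pker.
  - apply: cmeasM; first exact: f1.1.
    exact: (cmeas_preserving mu_preserving_opp i1.1).
  - apply: ae_imp2 (ae_neq (- a)) (ae_neq (- b)) => x xa xb.
    by apply: ccvgZ; apply: pker_itv_lim; rewrite // eqr_oppLR.
  - by move=> n x; rewrite normcM ler_piMr ?normc_ge0.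
  - by move=> x; rewrite normcM ler_piMr ?normc_ge0// normc_ind1.
  - exact: (L1_int f1).
apply: (ccvg_unique lim1); move: lim2; congr ccvg; apply/funext => n.
by rewrite /D damped_plancherel.
Qed.

Lemma inversion_itv f (a b : R) : a <= b -> L2 f ->
  cI (fun x => fourier f x * FT (ind `[a, b]) x) = cI (fun x => f x * ind `[a, b] (- x)).
Proof.
move=> ab f2; have [F2 FF] := fourierP f2.
have Fc n := FT_contraction (cut_L1 n f2) (cut_L2 n f2).
have [I2 _] := FT_contraction (L1_itv a b) (L2_itv a b).
have [J2 _] := L2_preserving mu_preserving_opp (L2_itv a b).
have lim1 := ccvg_cIM (fun n => (Fc n).1) (fun=> I2) F2 I2 FF (L2cvg_cst _).
have lim2 := ccvg_cIM (fun n => cut_L2 n f2) (fun=> J2) f2 J2 (cut_cvg f2) (L2cvg_cst _).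
apply: (ccvg_unique lim1); move: lim2; congr ccvg; apply/funext => n.
by rewrite inversion_itv_L1//; [exact: cut_L1|exact: cut_L2].
Qed.

(** It suffices to test against indicators of intervals; there the multiplication
    formula moves one of the two transforms to the indicator, and the previous lemma
    removes them both. *)
Theorem fourier_inversion f : L2 f ->
  {ae mu, forall x, fourier (fourier f) x = f (- x)}.
Proof.
move=> f2; have F2 := fourier_L2 f2; have FF2 := fourier_L2 F2.
have [J2 _] := L2_preserving mu_preserving_opp f2.
suff : {ae mu, forall x, (fourier (fourier f) \- (f \o -%R)) x = 0}.
  by apply: ae_imp => x /= /eqP; rewrite subr_eq0 => /eqP.
apply: itv_zero_L2; first exact: L2B.
move=> a b; have i2 := L2_itv a b.
have [ab|ba] := leP a b; last first.
  rewrite (_ : (fun x => _) = cst 0) ?cI0//; apply/funext => x.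
  by rewrite set_itv_ge ?bnd_simp -?ltNge// ind_out ?mulr0//.
have -> : cI (fun x => (fourier (fourier f) \- (f \o -%R)) x * ind `[a, b] x) =
    cI (fun x => fourier (fourier f) x * ind `[a, b] x) - cI (fun x => f (- x) * ind `[a, b] x).
  rewrite -cIB; [|exact: L1M|exact: (L1M J2)].
  by congr cI; apply/funext => x /=; rewrite mulrBl.
rewrite (fourier_mul F2 i2); apply/eqP; rewrite subr_eq0; apply/eqP.
have [I2 _] := FT_contraction (L1_itv a b) i2.
transitivity (cI (fun x => fourier f x * FT (ind `[a, b]) x)).
  apply: cI_ae; [exact: (L1M F2 (fourier_L2 i2)).1|exact: (L1M F2 I2).1|].
  by apply: ae_imp (fourier_L1 (L1_itv a b) i2) => x ->.
rewrite inversion_itv//.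
have [K2 _] := L2_preserving mu_preserving_opp i2.
rewrite -(cI_preserving mu_preserving_opp (L1M f2 K2)).
by congr cI; apply/funext => x /=; rewrite opprK.
Qed.

(** The Fourier transform and, by the inversion formula, its inverse are both
    contractions, so the norm is preserved. *)
Theorem plancherel f : L2 f -> nrm (fourier f) = nrm f.
Proof.
move=> f2; have F2 := fourier_L2 f2.
have [J2 JE] := L2_preserving mu_preserving_opp f2.
apply/eqP; rewrite eq_le fourier_contraction//= -JE.
rewrite -(nrm_ae (fourier_L2 F2).1 J2.1 (fourier_inversion f2)).
exact: fourier_contraction.
Qed.

(** By the inversion formula, transforming the reflection of [g] yields a
    preimage. *)
Lemma fourier_surj g : L2 g ->
  exists2 f, L2 f & {ae mu, forall x, fourier f x = g x}.
Proof.
move=> g2; have [J2 _] := L2_preserving mu_preserving_opp g2.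
exists (fourier (g \o -%R)); first exact: fourier_L2.
by apply: ae_imp (fourier_inversion J2) => x ->; rewrite /= opprK.
Qed.

End inversion.

(** * The equality case: the limit is an eigenvector of the shifts *)

Section equality_case.
Context {R : realType}.
Local Notation mu := (@lebesgue_measure R).
Implicit Types (f g h : R -> R[i]).

Lemma innerE f g : inner f g = cI (fun x => f x * (g x)^*).
Proof. by []. Qed.

Lemma inner_self f : L2 f -> inner f f = (nrm f ^+ 2)%:C.
Proof.
move=> f2; have e x : f x * (f x)^* = (normc (f x) ^+ 2)%:C by exact: mulcJ.
have er : Rintegral mu setT (fun x => Re (f x * (f x)^*)) = nrm f ^+ 2.
  transitivity (fine (sqI f)); last by rewrite sqIE.
  by congr fine; apply: eq_integral => x _; rewrite e.
have ei : Rintegral mu setT (fun x => Im (f x * (f x)^*)) = 0.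
  pose z (x : R) : R := 0.
  transitivity (Rintegral mu setT z); first by apply: eq_Rintegral => x _; rewrite e.
  by rewrite /Rintegral integral0.
by apply: ceqP; [exact: er|exact: ei].
Qed.

Lemma inner_conj f g : L2 f -> L2 g -> inner g f = (inner f g)^*.
Proof.
move=> f2 g2; rewrite !innerE -cIJ; last by apply: L1M => //; exact: L2J.
by congr cI; apply/funext => x; rewrite conjcM conjcK mulrC.
Qed.

(** The left side of the last hypothesis is the squared distance from [h] to its
    orthogonal projection on the line through [f]. *)
Lemma cauchy_schwarz_eq f h (N : R) : 0 < N -> L2 f -> L2 h -> nrm f ^+ 2 = N ->
  nrm h ^+ 2 - normc (inner h f) ^+ 2 / N <= 0 ->
  exists c, {ae mu, forall x, h x = c * f x}.
Proof.
move=> N0 f2 h2 fN hle; pose s := inner h f; pose c := s * (N^-1)%:C.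
exists c; have cf2 := L2Z c f2; have d2 := L2B h2 cf2.
have fJ := L2J f2; have hJ := L2J h2.
have N0' : N%:C != 0 :> R[i] by rewrite -normc_eq0 normcR normr_eq0 gt_eqF.
have NV : N%:C * (N^-1)%:C = 1 :> R[i].
  by rewrite -rmorphM /= mulfV// gt_eqF.
have sJ : inner f h = s^* by exact: inner_conj.
have e : inner (h \- (fun x => c * f x)) (h \- (fun x => c * f x)) =
    (nrm h ^+ 2 - normc s ^+ 2 / N)%:C.
  transitivity (inner h h - c^* * s - c * s^* + c * c^* * inner f f).
    rewrite /s -inner_conj// !innerE.
    have p1 := L1M h2 hJ; have p2 := L1M h2 fJ; have p3 := L1M f2 hJ; have p4 := L1M f2 fJ.
    rewrite -(cIZ (c^*) p2) -(cIZ c p3) -(cIZ (c * c^*) p4).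
    have q2 := L1Z (c^*) p2; have q3 := L1Z c p3; have q4 := L1Z (c * c^*) p4.
    rewrite -(cIB p1 q2) -(cIB (L1B p1 q2) q3) -(cID (L1B (L1B p1 q2) q3) q4).
    by congr cI; apply/funext => x; rewrite conjcB conjcM /=; ring.
  rewrite !inner_self// fN /c.
  have -> : (s * (N^-1)%:C)^* = s^* * (N^-1)%:C.
    by apply: ceqP; rewrite !ReImE /=; ring.
  have sq : s * s^* = (normc s ^+ 2)%:C by exact: mulcJ.
  have -> : (nrm h ^+ 2 - normc s ^+ 2 / N)%:C = (nrm h ^+ 2)%:C - (s * s^*) * (N^-1)%:C :> R[i].
    by rewrite sq -rmorphM -rmorphB.
  transitivity ((nrm h ^+ 2)%:C - 2 * (s * s^* * (N^-1)%:C) +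
      (s * s^* * (N^-1)%:C) * (N%:C * (N^-1)%:C)); first by ring.
  by rewrite NV; ring.
rewrite inner_self// in e; have {}e := congr1 (@complex.Re R) e; rewrite /= in e.
have n0 : nrm (h \- (fun x => c * f x)) = 0.
  apply/eqP; rewrite -sqrf_eq0 eq_le sqr_ge0 andbT e; exact: hle.
by apply: ae_imp (nrm0_ae d2 n0) => x /= /eqP; rewrite subr_eq0 => /eqP.
Qed.

(** What the backward shift does on the Fourier side: translate, then cut off the
    negative frequencies. *)
Definition tshift (a : R) g (z : R) : R[i] := ind `[0, +oo[ z * g (z + a).

Lemma tshift_L2 a g : L2 g -> L2 (tshift a g) /\ nrm (tshift a g) <= nrm g.
Proof.
move=> g2; have [s2 sE] := L2_preserving (mu_preserving_shift a) g2.
have mt : cmeasurable (tshift a g) by apply: cmeasM; [exact: cmeas_ind|exact: s2.1].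
rewrite -sE; apply: nrm_le => //; first exact: nrm_ge0.
rewrite -sqIE//; apply: sqI_mono => //; first exact: s2.1.
by move=> x; exact: normc_indM.
Qed.

(** Surjectivity of the Fourier transform provides a function that satisfies the
    definition, so the chosen [backshift a f] satisfies it too. *)
Lemma backshiftP a f : L2 f -> L2 (backshift a f) /\
  {ae mu, forall z, fourier (backshift a f) z = tshift a (fourier f) z}.
Proof.
move=> f2; have [t2 _] := tshift_L2 a (fourier_L2 f2).
have [h h2 hE] := fourier_surj t2.
(* the cutoff in [tshift] also gives the Hardy condition on [h] *)
have bh : is_backshift a f h.
  split; [split; first exact: h2|].
    apply: ae_imp hE => z -> z0; rewrite /tshift ind_out ?mul0r//=.
    by rewrite in_itv/= andbT leNgt z0.
  apply: ae_imp hE => z ->; rewrite /tshift indE; case: ifPn.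
    by rewrite inE /= in_itv/= andbT => ->; rewrite mul1r.
  move=> zn; rewrite mul0r ifF//; apply/negbTE; apply: contra zn => z0.
  by rewrite inE /= in_itv/= z0.
have [[b2 _] bE] : is_backshift a f (backshift a f) by exact: (xgetI (cst 0) bh).
split; first exact: b2.
 apply: ae_imp bE => z ->; rewrite /tshift indE.
case: ifPn => z0.
  by rewrite mem_set ?mul1r//= in_itv/= z0.
by rewrite memNset ?mul0r//= in_itv/= andbT; exact/negP.
Qed.

(** On the Fourier side the shift followed by the cutoff does not increase norms, and
    Plancherel's theorem transports this to the functions. *)
Lemma backshift_dist a f g : L2 f -> L2 g ->
  nrm (backshift a f \- backshift a g) <= nrm (f \- g).
Proof.
move=> f2 g2; have [bf2 bfE] := backshiftP a f2; have [bg2 bgE] := backshiftP a g2.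
have d2 := L2B f2 g2; have F2 := fourier_L2 d2; have [t2 tE] := tshift_L2 a F2.
rewrite -(plancherel (L2B bf2 bg2)) -(plancherel d2); apply: le_trans tE.
rewrite le_eqVlt; apply/orP; left; apply/eqP; apply: nrm_ae.
- by apply: (fourier_L2 _).1; exact: L2B.
- exact: t2.1.
have hs : {ae mu, forall z, fourier (f \- g) (z + a) = fourier f (z + a) - fourier g (z + a)}.
  exact: (ae_preserving (mu_preserving_shift a) (fourierB f2 g2)).
have hb : {ae mu, forall z, fourier (backshift a f) z - fourier (backshift a g) z =
    tshift a (fourier f) z - tshift a (fourier g) z}.
  by apply: ae_imp2 bfE bgE => z e1 e2; exact: (f_equal2 (fun u v => u - v) e1 e2).
have hd := ae_imp2 (fun z e1 e2 => etrans e1 e2) (fourierB bf2 bg2) hb.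
apply: ae_imp2 hd hs => z e1 e2.
by apply: (etrans e1); rewrite /tshift -mulrBr; congr (_ * _); exact: (esym e2).
Qed.

(** If [g] vanishes on [D], then on [D] the function [h] is the error [h - g]. *)
Lemma nrm_ind_le (D : set R) g h : measurable D -> L2 g -> L2 h ->
  {ae mu, forall x, D x -> g x = 0} ->
  nrm (fun x => ind D x * h x) <= nrm (g \- h).
Proof.
move=> mD g2 h2 g0; pose P (k : R -> R[i]) x := ind D x * k x.
have d2 := L2B h2 g2; have P2 := L2_indM mD d2; have Ph2 := L2_indM mD h2.
rewrite (nrm_sub g2 h2) (@nrm_ae _ _ (P (h \- g))).
- apply: (nrm_le (nrm_ge0 _) P2.1 _).2; rewrite -(sqIE d2).
  by apply: sqI_mono; [exact: P2.1|exact: d2.1|move=> x; exact: normc_indM].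
- exact: Ph2.1.
- exact: P2.1.
- apply: ae_imp g0 => x gx; rewrite /P indE; case: ifPn; rewrite ?mul0r//.
  by rewrite inE => /gx; rewrite /= => ->; rewrite subr0.
Qed.

Section limit.
Variables (f_ : nat -> R -> R[i]) (f : R -> R[i]).
Hypothesis hf_ : forall n, hardyL2 (f_ n).
Hypothesis hnorm : forall n, (L2norm (f_ n) ^+ 2 = (2 * pi)%:E)%E.
Hypothesis hf : L2 f.
Hypothesis hcvg : (L2norm (f_ n \- f)%R @[n --> \oo] --> 0)%E.
Hypothesis hdelta : forall A : R, 0 <= A -> (delta A (f_ n) @[n --> \oo] --> 0)%E.

Let f2_ n : L2 (f_ n). Proof. exact: (hf_ n).1. Qed.
Let cf : L2cvg f_ f. Proof. exact/(L2cvgP f2_ hf). Qed.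

Lemma limit_norm : nrm f ^+ 2 = 2 * pi.
Proof.
have n_ n : nrm (f_ n) ^+ 2 = 2 * pi.
  by apply/eqP; rewrite -eqe -sqIE// -L2norm_sqr hnorm.
have h : nrm (f_ n) ^+ 2 @[n --> \oo] --> nrm f ^+ 2.
  by under eq_fun do rewrite expr2; rewrite expr2; apply: cvgM; exact: cvg_nrm.
have e : (fun n => nrm (f_ n) ^+ 2) = (fun=> 2 * pi) by apply/funext => n; exact: n_.
by rewrite e in h; apply/esym; apply: (cvg_unique (@Rhausdorff R) _ h); exact: cvg_cst.
Qed.

(** The negative frequencies of [f] are at most the distance between the transforms
    of [f] and [f_ n], which tends to 0. *)
Lemma limit_hardy : {ae mu, forall z, z < 0 -> fourier f z = 0}.
Proof.
have F2 := fourier_L2 hf; have Fn2 n := fourier_L2 (f2_ n).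
have cF := fourier_cvg f2_ hf cf.
have mD : measurable (`]-oo, 0[%classic : set R) by exact: measurable_itv.
have le n : nrm (fun x => ind `]-oo, 0[ x * fourier f x) <= nrm (fourier (f_ n) \- fourier f).
  apply: (nrm_ind_le mD (Fn2 n) F2); apply: ae_imp (hf_ n).2 => x h /=.
  by rewrite in_itv/=; exact: h.
have P2 : L2 (fun x => ind `]-oo, 0[ x * fourier f x) by exact: L2_indM.
have P0 : nrm (fun x => ind `]-oo, 0[ x * fourier f x) = 0.
  apply/eqP; rewrite eq_le nrm_ge0 andbT -[leRHS](cvg_lim (@Rhausdorff R) cF).
  by apply: limr_ge; [apply/cvg_ex; eexists; exact: cF|by apply: nearW => n; exact: le].
apply: ae_imp (nrm0_ae P2 P0) => x h x0.
have e : ind (`]-oo, 0[%classic : set R) x = 1 by apply: ind_in => /=; rewrite in_itv.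
by rewrite e in h; rewrite -h mul1r.
Qed.

(** The deficit in the Cauchy-Schwarz inequality between the shifted function and the
    function itself is continuous in L^2, and along [f_ n] it is at most [delta], which
    tends to 0. So equality holds in the limit, and the shift of [f] is a multiple of
    [f]. *)
Lemma limit_shift (a : R) : 0 <= a ->
  exists c, {ae mu, forall z, tshift a (fourier f) z = c * fourier f z}.
Proof.
move=> a0; have [b2 bE] := backshiftP a hf.
have b2_ n : L2 (backshift a (f_ n)) by have [] := backshiftP a (f2_ n).
have cb : L2cvg (fun n => backshift a (f_ n)) (backshift a f).
  by apply: (L2cvg_le _ cf) => n; exact: (backshift_dist a (f2_ n) hf).
suff [c hc] : exists c, {ae mu, forall x, backshift a f x = c * f x}.
  exists c; have h1 := fourier_ae b2 (L2Z c hf) hc.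
  have h2 := ae_imp2 (fun z e1 e2 => etrans (esym e1) e2) bE h1.
  by apply: ae_imp2 h2 (fourierZ c hf) => z; exact: etrans.
apply: (@cauchy_schwarz_eq _ _ (2 * pi)) => //; [exact: pi2_gt0|exact: limit_norm|].
pose D n := nrm (backshift a (f_ n)) ^+ 2 - normc (inner (backshift a (f_ n)) (f_ n)) ^+ 2 / (2 * pi).
have cin : ccvg (fun n => inner (backshift a (f_ n)) (f_ n)) (inner (backshift a f) f).
  apply: ccvg_cIM => //; [by move=> n; exact: L2J|exact: L2J|].
  apply: (L2cvg_le _ cf) => n; rewrite le_eqVlt; apply/orP; left; apply/eqP.
  by apply: nrm_eq => x; rewrite -[RHS]normcJ conjcB.
have cD : D n @[n --> \oo] -->
    nrm (backshift a f) ^+ 2 - normc (inner (backshift a f) f) ^+ 2 / (2 * pi).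
  apply: cvgB.
    by under eq_fun do rewrite expr2; rewrite expr2; apply: cvgM; exact: cvg_nrm.
  apply: cvgM; last exact: cvg_cst.
  by under eq_fun do rewrite expr2; rewrite expr2; apply: cvgM; exact: ccvg_normc.
have Dle n : ((D n)%:E <= delta a (f_ n))%E.
  apply: ereal_sup_ubound; exists a; first by rewrite /= in_itv/= a0 lexx.
  rewrite L2norm_sqr (sqIE (b2_ n)) -EFinD; exact: erefl.
have cDE : (EFin \o D) n @[n --> \oo] -->
    (nrm (backshift a f) ^+ 2 - normc (inner (backshift a f) f) ^+ 2 / (2 * pi))%:E.
  by apply: cvg_EFin; [apply: nearW => n|exact: cD].
rewrite -lee_fin; apply: (lee_cvg_to cDE (hdelta a0)).
by apply: nearW => n; exact: Dle.
Qed.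

End limit.
End equality_case.

(** * Eigenvectors of the shifts are integrable *)

Section eigenfunction.
Context {R : realType}.
Local Notation mu := (@lebesgue_measure R).
Variables (g : R -> R[i]) (c : R -> R[i]).
Hypothesis g2 : L2 g.
Hypothesis gn0 : 0 < nrm g.
Hypothesis g0 : forall z : R, z < 0 -> g z = 0.
Hypothesis hc : forall a : R, 0 <= a -> {ae mu, forall z, tshift a g z = c a * g z}.

Local Notation H := (`[0, +oo[%classic : set R).

Lemma tshift_nrm (a : R) : 0 <= a -> nrm (tshift a g) = normc (c a) * nrm g.
Proof.
move=> a0; rewrite -nrmZ//; apply: nrm_ae; [exact: (tshift_L2 a g2).1.1|exact: (L2Z (c a) g2).1|].
exact: hc.
Qed.

(** The modulus of [c a] is the ratio of the norm of [g] on [a, oo) to its total norm,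
    and the tail of an L^2 function is small. *)
Lemma eigenvalue_lt1 : exists2 A : R, 0 < A & normc (c A) < 1.
Proof.
pose D (n : nat) : set R := `[n%:R, +oo[%classic.
have mD n : measurable (D n) by exact: measurable_itv.
pose u n x := ind (D n) x * g x.
have u0 : nrm (u n) @[n --> \oo] --> (0 : R).
  apply: (L2_dominated _ g2).
  - by move=> n; exact: (L2_indM (mD n) g2).1.
  - apply: aeW => x; rewrite /ccvg; apply/cvg_ballP => e e0.
    near=> n; rewrite /u ind_out ?mul0r ?subr0 ?normc0; first exact: ballxx.
    rewrite /D /= in_itv/= andbT; apply/negP; rewrite -ltNge.
    apply: le_lt_trans (ler_norm x) _; apply: lt_le_trans (truncnS_gt _) _.
    by rewrite ler_nat; near: n; exact: nbhs_infty_ge.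
  - by move=> n x; exact: normc_indM.
move/cvgr0_norm_lt: u0 => /(_ _ gn0)[N _ hN].
have n0 : 0 <= N.+1%:R :> R by [].
exists N.+1%:R => //; rewrite -(ltr_pM2r gn0) mul1r -tshift_nrm//.
have := hN N.+1 (leqnSn N); rewrite ger0_norm ?nrm_ge0//; apply: le_lt_trans.
have [_ <-] := L2_preserving (mu_preserving_shift N.+1%:R) (L2_indM (mD N.+1) g2).
rewrite le_eqVlt; apply/orP; left; apply/eqP; congr nrm; apply/funext => z.
rewrite /tshift /comp; congr (_ * _); rewrite !indE; congr (if _ then _ else _).
by apply/idP/idP; rewrite !inE /D /= !in_itv/= !andbT lerDr.
Unshelve. all: by end_near. Qed.

(** With [A] as in the previous lemma and q = |c A|, the mass of [g] on [0, (n+1) A] is at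
    most its mass on [0, A] plus q times its mass on [0, n A]. Since q < 1, these masses
    stay bounded. *)
Lemma eigenfunction_L1 : L1 g.
Proof.
have [A A0 q1] := eigenvalue_lt1; set q := normc (c A) in q1.
have q0 : 0 <= q by exact: normc_ge0.
have Lind (a b : R) : L1 (fun x => ind `[a, b] x * g x) by exact: L1M (L2_itv a b) g2.
pose X (n : nat) := (\int[mu]_x (normc (ind `[0, n%:R * A] x * g x))%:E)%E.
pose M := fine (\int[mu]_x (normc (ind `[0, A] x * g x))%:E)%E.
have ME : (\int[mu]_x (normc (ind `[0, A] x * g x))%:E = M%:E)%E.
  by rewrite /M fineK//; apply: integrable_fin_num => //; exact: (L1_int (Lind 0 A)).
have M0 : 0 <= M by rewrite -lee_fin -ME; apply: integral_ge0 => x _; rewrite lee_fin normc_ge0.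
(* the fixed point of the recursion X -> M + q X *)
pose K := M / (1 - q).
have K0 : 0 <= K by rewrite divr_ge0// subr_ge0 ltW.
have KE : M + q * K = K.
  have d : 1 - q != 0 by rewrite subr_eq0 eq_sym lt_eqF.
  by rewrite /K; field.
have XK n : (X n <= K%:E)%E.
  elim: n => [|n IH].
    rewrite /X mul0r; apply: (@le_trans _ _ M%:E); last by rewrite lee_fin -[leRHS]KE lerDl mulr_ge0.
    rewrite -ME; apply: ge0_le_integral => //.
    - by move=> x _; rewrite lee_fin normc_ge0.
    - exact: (measurable_normcE (Lind _ _).1).
    - exact: (measurable_normcE (Lind _ _).1).
    - move=> x _; rewrite lee_fin; apply: normc_ind_sub => y /=; rewrite !in_itv/=.
      by move=> /andP[-> y0]; exact: le_trans y0 (ltW A0).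
  (* [v] is the part of [g] on [A, (n+1) A] moved back by [A]; there the shift of [g] by
     [A] is [c A * g] *)
  pose v x := ind `[0, n%:R * A] x * g (x + A).
  pose w x := ind `[0, n%:R * A] (x - A) * g x.
  have [s2 _] := L2_preserving (mu_preserving_shift A) g2.
  have v1 : L1 v by exact: L1M (L2_itv _ _) s2.
  have [i2 _] := L2_preserving (mu_preserving_shift (- A)) (L2_itv 0 (n%:R * A)).
  have w1 : L1 w by exact: L1M i2 g2.
  have wv : (\int[mu]_x (normc (w x))%:E = \int[mu]_x (normc (v x))%:E)%E.
    rewrite -(ge0_integral_preserving (mu_preserving_shift A) (f := fun x => (normc (w x))%:E)).
    - by apply: eq_integral => x _; rewrite /w /v addrK.
    - exact: (measurable_normcE w1.1).
    - by move=> x; rewrite lee_fin normc_ge0.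
  have vX : (\int[mu]_x (normc (v x))%:E = q%:E * X n)%E.
    rewrite /X -ge0_integralZl//; last 2 first.
    - exact: (measurable_normcE (Lind _ _).1).
    - by move=> x _; rewrite lee_fin normc_ge0.
    apply: ge0_ae_eq_integral => //.
    - exact: (measurable_normcE v1.1).
    - by apply: measurable_funeM; exact: (measurable_normcE (Lind _ _).1).
    - by move=> x _; rewrite lee_fin normc_ge0.
    - by move=> x _; rewrite -EFinM lee_fin mulr_ge0 ?normc_ge0.
    - apply: ae_imp (hc (ltW A0)) => x; rewrite /tshift => hx _; rewrite -EFinM; congr EFin.
      have e : normc (ind `[0, n%:R * A] x * (c A * g x)) = q * normc (ind `[0, n%:R * A] x * g x).
        by rewrite normcM (normcM (c A)) mulrCA normcM.
      rewrite -e -hx /v; have [xi|xi] := pselect (`[0, n%:R * A]%classic x); last first.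
        by rewrite (ind_out xi) !mul0r.
      have xH : H x by move: xi; rewrite /= !in_itv/= => /andP[->].
      by rewrite (ind_in xH) mul1r.
  rewrite -KE EFinD EFinM; apply: (@le_trans _ _ (M%:E + q%:E * X n)%E); last first.
    by rewrite leeD2l// lee_wpmul2l.
  rewrite -vX -wv -ME -ge0_integralD//; last 4 first.
  - by move=> x _; rewrite lee_fin normc_ge0.
  - exact: (measurable_normcE (Lind _ _).1).
  - by move=> x _; rewrite lee_fin normc_ge0.
  - exact: (measurable_normcE w1.1).
  apply: ge0_le_integral => //.
  - by move=> x _; rewrite lee_fin normc_ge0.
  - exact: (measurable_normcE (Lind _ _).1).
  - by apply: emeasurable_funD; [exact: (measurable_normcE (Lind _ _).1)|exact: (measurable_normcE w1.1)].
  move=> x _; rewrite -EFinD lee_fin /w !normcM -mulrDl ler_wpM2r ?normc_ge0//.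
  rewrite !normc_ind !indicE -natrD ler_nat.
  case/boolP: (x \in `[0, n.+1%:R * A]%classic) => //; rewrite inE /= in_itv/= => /andP[x0 xn].
  have [xA|xA] := leP x A; first by rewrite [x \in _]mem_set//= in_itv/= x0 xA.
  rewrite [(x - A) \in _]mem_set ?addn1//= in_itv/= subr_ge0 (ltW xA) lerBlDr.
  by rewrite -[X in _ + X]mul1r -mulrDl -natr1 in xn *.
split; first exact: g2.1.
apply: (@le_lt_trans _ _ K%:E); last by rewrite ltry.
apply: (@fatou_le _ (fun n x => normc (ind `[0, n%:R * A] x * g x))) XK.
- by move=> n; apply: cmeas_normc; exact: (Lind _ _).1.
- by move=> n x; exact: normc_ge0.
- by apply: cmeas_normc; exact: g2.1.
- by move=> x; exact: normc_ge0.
apply: aeW => x; apply: cvg_near_cst; near=> n.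
have [x0|x0] := ltP x 0; first by rewrite g0// mulr0.
rewrite ind_in ?mul1r//= in_itv/= x0 -ler_pdivrMr// (le_trans (ler_norm _))//.
apply: le_trans (ltW (truncnS_gt _)) _.
by rewrite ler_nat; near: n; exact: nbhs_infty_ge.
Unshelve. all: by end_near. Qed.

End eigenfunction.

(** * The Laplace transform of an eigenvector *)

Section laplace.
Context {R : realType}.
Local Notation mu := (@lebesgue_measure R).
Local Notation T := (measurableTypeR R).
Variables (g : R -> R[i]) (c : R -> R[i]).
Hypothesis g1 : L1 g.
Hypothesis g0 : forall z : R, z < 0 -> g z = 0.
Hypothesis hc : forall a : R, 0 <= a -> {ae mu, forall z, tshift a g z = c a * g z}.

Local Notation H := (`[0, +oo[%classic : set R).

(** The Laplace transform of [g] at the point x + iy of the closed upper half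
    plane. *)
Definition lap (x y : R) : R[i] := cI (fun z => cexp (- y) x z * g z).

(** The factor on the half line makes the exponential bounded by 1 on all of R. *)
Definition hker (x y t : R) : R[i] := ind H t * cexp (- y) x t.

Lemma hker_cmeas x y : cmeasurable (hker x y).
Proof. by apply: cmeasM; [exact: cmeas_ind|exact: cmeas_cexp]. Qed.

Lemma hker1 x y t : 0 <= y -> normc (hker x y t) <= 1.
Proof.
move=> y0; rewrite normcM normc_ind normc_cexp indicE.
have [t0|t0] := boolP (t \in H); last by rewrite mul0r.
rewrite mul1r expR_le1 mulNr oppr_le0 mulr_ge0//.
by move: t0; rewrite inE /= in_itv/= andbT.
Qed.

Lemma hker_g x y z : hker x y z * g z = cexp (- y) x z * g z.
Proof.
rewrite /hker; have [z0|z0] := ltP z 0; first by rewrite (g0 z0) !mulr0.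
by rewrite ind_in ?mul1r//= in_itv/= z0.
Qed.

Lemma lap_L1 x y : 0 <= y -> L1 (fun z => cexp (- y) x z * g z).
Proof.
move=> y0; under eq_fun do rewrite -hker_g.
by apply: (L1_bndM (hker_cmeas x y) (fun t => hker1 x t y0) g1).
Qed.

(** Integrating [g] against it gives the transform of the shift of [g] by [a]. *)
Definition resker (x y v a : R) : R[i] := hker x y (v - a).

Lemma resker_cmeas x y : cmeas (fun z : T * T => resker x y z.1 z.2).
Proof.
have m : measurable_fun setT (fun z : T * T => z.1 - z.2 : R).
  by apply: measurable_funB; [exact: measurable_fst|exact: measurable_snd].
exact: (cmeas_comp m (hker_cmeas x y)).
Qed.

Lemma resker_cmeasC x y : cmeas (fun z : T * T => resker x y z.2 z.1).
Proof.
have m : measurable_fun setT (fun z : T * T => z.2 - z.1 : R).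
  by apply: measurable_funB; [exact: measurable_snd|exact: measurable_fst].
exact: (cmeas_comp m (hker_cmeas x y)).
Qed.

(** The transform of the shift of [g] by [a], and this shift is [c a] times [g]. *)
Lemma shifted_lap x y a : 0 <= y -> 0 <= a ->
  cI (fun v => g v * resker x y v a) = c a * lap x y.
Proof.
move=> y0 a0; have k1 u v : normc (resker x y u v) <= 1 by exact: hker1.
have h1 := kernel_L1 (resker_cmeas x y) k1 a g1.
rewrite -(cI_preserving (mu_preserving_shift a) h1) -cIZ; last exact: lap_L1.
apply: cI_ae.
- exact: (cmeas_preserving (mu_preserving_shift a) h1.1).
- by apply: (L1Z _ _).1; exact: lap_L1.
apply: ae_imp (hc a0) => z; rewrite /tshift /= => e.
by rewrite [RHS]mulrCA -e /resker addrK /hker; ring.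
Qed.

Let W (a : R) : R[i] := ind H a * cexp (-1) 0 a.

Lemma weight_L1 : L1 W.
Proof. by apply: L1_half_exp; rewrite oppr_lt0. Qed.

(** The Laplace average over the shift parameter [a], with weight e^(-a), of the
    transforms of the shifted functions: the resolvent of the shift semigroup at 1, seen
    on the transform side. *)
Definition resolvent x y := cI (fun a => W a * cI (fun v => g v * resker x y v a)).

(** Formally [resolvent x y] is the integral of e^(-a) c(a) times [lap x y]. Comparing two
    points with the integrals not evaluated avoids any question about the measurability
    of [c]. *)
Lemma resolvent_prop x y x0 y0 : 0 <= y -> 0 <= y0 ->
  lap x0 y0 * resolvent x y = lap x y * resolvent x0 y0.
Proof.
move=> yp y0p.
have k1 u v : normc (resker x y u v) <= 1 by exact: hker1.
have k01 u v : normc (resker x0 y0 u v) <= 1 by exact: hker1.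
rewrite /resolvent -cIZ; last exact: (kernel_intM (resker_cmeas x y) k1 g1 weight_L1).
rewrite -cIZ; last exact: (kernel_intM (resker_cmeas x0 y0) k01 g1 weight_L1).
congr cI; apply/funext => a; have [a0|a0] := leP 0 a.
  by rewrite !shifted_lap//; ring.
by rewrite /W ind_out ?mul0r ?mulr0//= in_itv/= andbT leNgt a0.
Qed.

Lemma cexpN p q (t : R) : cexp p q (- t) = cexp (- p) (- q) t.
Proof. by rewrite /cexp !mulrN !mulNr. Qed.

(** The integrand lives on [0, v], where it is the exponential of an affine
    function of [a]. *)
Lemma resolvent_kernel x y v : 0 <= v ->
  ((y - 1) +i* (- x)) * cI (fun a => W a * resker x y v a) =
  cexp (-1) 0 v - cexp (- y) x v.
Proof.
move=> v0; set s := _ +i* _.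
(* the supports [a >= 0] and [a <= v] of the two factors cut out [0, v] *)
have e : (fun a => W a * resker x y v a) =
    (fun a => cexp (- y) x v * (ind `[0, v] a * cexp (y - 1) (- x) a)).
  apply/funext => a; rewrite /W /resker /hker.
  have [av|av] := boolP (0 <= a <= v).
    have [aH vaH] : H a /\ H (v - a).
      by case/andP: av => a0 av; split; rewrite /= in_itv/= andbT ?subr_ge0.
    rewrite (ind_in aH) (ind_in vaH) ind_in/= ?in_itv// !mul1r cexpD cexpN.
    have e1 : -1 + - - y = y - 1 :> R by ring.
    have e2 : 0 + - x = - x :> R by ring.
    by rewrite [LHS]mulrCA cexpMD e1 e2.
  rewrite [ind `[0, v] a]ind_out/= ?in_itv//; last exact/negP.
  rewrite mul0r mulr0; have [a0|a0] := ltP a 0.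
    by rewrite [ind H a]ind_out ?mul0r//= in_itv/= andbT leNgt a0.
  rewrite [ind H (v - a)]ind_out ?mul0r ?mulr0//= in_itv/= andbT subr_ge0.
  by apply/negP; move: av; rewrite a0.
have i1 : L1 (fun a => ind `[0, v] a * cexp (y - 1) (- x) a).
  pose B := expR (`|y - 1| * v).
  apply: (L1_dom (h := fun a => B * \1_`[0, v] a)).
  - by apply: cmeasM; [exact: cmeas_itv|exact: cmeas_cexp].
  - move=> a; rewrite normcM normc_ind normc_cexp mulrC !indicE.
    have [av|av] := boolP (a \in `[0, v]%classic); last by rewrite !mulr0.
    rewrite !mulr1 ler_expR; move: av; rewrite inE /= in_itv/= => /andP[a0 av].
    by apply: (le_trans (ler_norm _)); rewrite normrM (ger0_norm a0) ler_wpM2l.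
  - exact: (integrableZl _ B (integrable_indic_itv 0 v true false)).
rewrite e cIZ// mulrCA.
have -> : s * cI (fun a => ind `[0, v] a * cexp (y - 1) (- x) a) = cexp (y - 1) (- x) v - 1.
  rewrite -cIZ// -(cexp0 (y - 1) (- x)) -cintegral_cexp// cintegral_ind//.
  by congr cI; apply/funext => a; rewrite mulrCA.
have e1 : - y + (y - 1) = -1 :> R by ring.
have e2 : x + - x = 0 :> R by ring.
by rewrite mulrBr mulr1 cexpMD e1 e2.
Qed.

(** The resolvent of translations is explicit: after exchanging the integrals, the one
    over [a] is elementary. *)
Lemma resolvent_eval x y : 0 <= y ->
  ((y - 1) +i* (- x)) * resolvent x y = lap 0 1 - lap x y.
Proof.
move=> y0; have k1 u v : normc (resker x y u v) <= 1 by exact: hker1.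
rewrite /resolvent (kernel_fubini (resker_cmeas x y) k1 g1 weight_L1).
have L1r : L1 (fun v => g v * cI (fun a => W a * resker x y v a)).
  exact: (kernel_intM (k := fun a v => resker x y v a) (resker_cmeasC x y) (fun a v => k1 v a) weight_L1 g1).
rewrite -cIZ// -cIB; [|by apply: lap_L1|exact: lap_L1].
congr cI; apply/funext => v; have [v0|v0] := ltP v 0.
  by rewrite (g0 v0) mul0r !mulr0 subr0.
by rewrite mulrCA resolvent_kernel// mulrBr [g v * _]mulrC [g v * _]mulrC.
Qed.

(** Two expressions for the resolvent: by the eigenvalue equation it is a constant rho
    times [lap x y], by direct computation it is a difference of values of [lap] divided
    by -1 - iz at z = x + iy. Solving for [lap] gives a simple fraction. *)
Lemma lap_rational : (exists x, lap x 0 != 0) ->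
  exists rho C : R[i], forall x y, 0 <= y ->
    lap x y * (1 + rho * ((y - 1) +i* (- x))) = C.
Proof.
move=> [x0 n0]; exists (resolvent x0 0 / lap x0 0), (lap 0 1) => x y y0.
have e : resolvent x y = lap x y * (resolvent x0 0 / lap x0 0).
  by rewrite mulrA -(resolvent_prop x x0 y0 (lexx 0)) mulrAC mulfV// mul1r.
have := resolvent_eval x y0; rewrite e => h.
rewrite -[RHS](subrK (lap x y)) -h; ring.
Qed.

End laplace.

(** * Simple fractions of given norm *)

Section rational.
Context {R : realType}.
Local Notation mu := (@lebesgue_measure R).
Variables (f : R -> R[i]) (L : R -> R -> R[i]) (k rho C : R[i]).
Hypothesis f2 : L2 f.
Hypothesis fn : nrm f ^+ 2 = 2 * pi.
Hypothesis fL : {ae mu, forall x, f x = k * L x 0}.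
Hypothesis LC : forall x y, 0 <= y -> L x y * (1 + rho * ((y - 1) +i* (- x))) = C.

(** A constant has norm 0 or infinity on the line. *)
Lemma not_ae_cst d : ~ {ae mu, forall x, f x = d}.
Proof.
move=> fd; have mc : cmeasurable (fun=> d : R[i]) by exact: cmeas_cst.
have mT : (mu [set: R] = +oo)%E by rewrite -set_itvNyy lebesgue_measure_itv.
have e : sqI f = ((normc d ^+ 2)%:E * +oo)%E.
  rewrite (sqI_ae f2.1 mc fd) /sqI lebesgue_integral_nonneg.integral_cstr//.
  by congr (_ * _)%E; exact: mT.
have p0 : (0 < (2 * pi : R)%:E)%E by rewrite lte_fin pi2_gt0.
move: e; rewrite sqIE// fn; have [d0|d0] := eqVneq (normc d ^+ 2) 0.
  by rewrite d0 mul0e => e; rewrite e ltxx in p0.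
by rewrite gt0_muley// lte_fin lt_neqAle eq_sym d0 sqr_ge0.
Qed.

(** Otherwise [L x 0] would be constant. *)
Lemma rho_neq0 : rho != 0.
Proof.
apply/eqP => r0; apply: (@not_ae_cst (k * C)); apply: ae_imp fL => x ->.
by rewrite -(LC x (lexx 0)) r0 mul0r addr0 mulr1.
Qed.

Lemma factor_inj x x' : 1 + rho * ((0 - 1) +i* (- x)) = 0 ->
  1 + rho * ((0 - 1) +i* (- x')) = 0 -> x = x'.
Proof.
move=> e e'; have : rho * ((0 - 1) +i* (- x)) = rho * ((0 - 1) +i* (- x')).
  by apply: (addrI 1); rewrite e e'.
by move=> /(mulfI rho_neq0)[/oppr_inj].
Qed.

(** Otherwise [L x 0] would vanish wherever its denominator does not, that is, off at
    most one point. *)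
Lemma C_neq0 : C != 0.
Proof.
apply/eqP => C0; apply: (@not_ae_cst 0).
have key : {ae mu, forall x : R, 1 + rho * ((0 - 1) +i* (- x)) != 0}.
  have [[x1 h1]|h] := pselect (exists x : R, 1 + rho * ((0 - 1) +i* (- x)) = 0).
    apply: ae_imp (ae_neq x1) => x; apply: contra => /eqP h.
    by apply/eqP; exact: (factor_inj h h1).
  by apply: aeW => x; apply/eqP => hx; apply: h; exists x.
apply: ae_imp2 fL key => x -> hx; have := LC x (lexx 0); rewrite C0 => /eqP.
by rewrite mulf_eq0 (negbTE hx) orbF => /eqP ->; rewrite mulr0.
Qed.

(* The pole of the fraction is beta - i alpha, and its numerator is [D]. *)
Let r := rho^-1.
Let alpha : R := Re r - 1.
Let beta : R := Im r.
Let ii : R[i] := 0 +i* 1.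
Let D : R[i] := k * C * r * ii.

(** The denominator vanishes at the point beta - i alpha. If [alpha <= 0], this point is in
    the closed upper half plane, where the relation between [L] and [C] forces
    [C = 0]. *)
Lemma alpha_gt0 : 0 < alpha.
Proof.
(* the height [- alpha] and the abscissa [beta] of the pole; there
   (y - 1) - ix = - 1/rho *)
rewrite ltNge; apply/negP => a0; have y0 : 0 <= - alpha by rewrite oppr_ge0.
have := LC beta y0.
have -> : (- alpha - 1) +i* (- beta) = - r.
  by apply: ceqP; rewrite ReImE /= /alpha /beta//; ring.
rewrite mulrN /r mulfV ?rho_neq0// subrr mulr0 => /esym/eqP.
by rewrite (negbTE C_neq0).
Qed.

Lemma den_neq0 (x : R) : (x - beta) +i* alpha != 0.
Proof. by rewrite eq_complex /= negb_and (gt_eqF alpha_gt0) orbT. Qed.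

Lemma f_rational : {ae mu, forall x, f x = D / ((x - beta) +i* alpha)}.
Proof.
apply: ae_imp fL => x ->; have := LC x (lexx 0).
have -> : 1 + rho * ((0 - 1) +i* (- x)) = rho * (- ii) * ((x - beta) +i* alpha).
  have {1}-> : 1 = rho * r by rewrite /r mulfV ?rho_neq0.
  rewrite -mulrDr -mulrA; congr (_ * _).
  by apply: ceqP; rewrite !ReImE /ii /alpha /beta /=; ring.
move=> e; rewrite /D -e; set d := _ +i* _; have d0 : d != 0 by exact: den_neq0.
have i2 : ii * ii = -1 by apply: ceqP; rewrite !ReImE /ii /=; ring.
transitivity (k * L x 0 * (rho * r) * (- (ii * ii)) * (d / d)); last by ring.
by rewrite i2 opprK mulfV ?rho_neq0// mulfV// !mulr1.
Qed.

(** The square of |1/(x - beta + i alpha)| is a Poisson kernel over alpha, and so has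
    integral pi/alpha. *)
Lemma D_norm : normc D ^+ 2 = 2 * alpha.
Proof.
have a0 := alpha_gt0.
have sE : (sqI f = (normc D ^+ 2 / alpha)%:E * pi%:E)%E.
  rewrite -(poisson_mass (- beta) a0) -ge0_integralZl//; last 3 first.
  - by apply/measurable_EFinP; exact: measurable_poisson.
  - by move=> x _; rewrite lee_fin poisson_ge0.
  - by rewrite lee_fin divr_ge0 ?sqr_ge0// ltW.
  apply: ge0_ae_eq_integral => //.
  - by apply/measurable_EFinP; apply: measurable_sq; exact: f2.1.
  - apply/measurable_EFinP; apply: measurable_funM; first exact: measurable_cst.
    exact: measurable_poisson.
  - by move=> x _; rewrite lee_fin sqr_ge0.
  - by move=> x _; rewrite lee_fin mulr_ge0 ?poisson_ge0// divr_ge0 ?sqr_ge0// ltW.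
  apply: ae_imp f_rational => x -> _; rewrite -EFinM; congr EFin.
  have dE : normc ((x - beta) +i* alpha) ^+ 2 = alpha ^+ 2 + (x - beta) ^+ 2.
    by rewrite normc_sqr /= addrC.
  by rewrite normcM normcV exprMn exprVn dE /poisson mulrA divfK ?(gt_eqF a0).
have := sE; rewrite sqIE// fn -EFinM => -[] e.
have p0 : pi != 0 :> R by rewrite gt_eqF// pi_gt0.
have {}e := mulIf p0 e.
by rewrite e divfK ?(gt_eqF a0).
Qed.

(** The norm fixes the modulus of the numerator, whose phase is theta. *)
Lemma rational_Mop : exists alpha beta theta : R, 0 < alpha /\
  {ae mu, forall x, f x = Mop alpha beta 0 theta ratR x}.
Proof.
have a0 := alpha_gt0; have [theta DE] := polar D.
exists alpha, beta, theta; split; first exact: a0.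
apply: ae_imp f_rational => x ->; rewrite /Mop /ratR mul0r expi0 mulr1.
have nD : normc D = Num.sqrt 2 * Num.sqrt alpha.
  by rewrite -sqrtrM// -D_norm sqrtr_sqr ger0_norm// normc_ge0.
have sa : Num.sqrt alpha != 0 by rewrite gt_eqF// sqrtr_gt0.
have -> : ((x - beta) / alpha) +i* 1 = ((x - beta) +i* alpha) * (alpha^-1)%:C.
  by apply: ceqP; rewrite !ReImE /= ?mulr0 ?subr0 ?add0r ?addr0// divff// gt_eqF.
rewrite {1}DE nD invfM -rmorphV ?unitfE ?invr_eq0 ?gt_eqF//= invrK.
set E := expi theta; set d := ((x - beta) +i* alpha)^-1.
transitivity (E * d * (Num.sqrt 2 * Num.sqrt alpha)%:C); first by ring.
transitivity (E * d * ((Num.sqrt alpha)^-1 * (Num.sqrt 2 * alpha))%:C); last first.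
  by rewrite !rmorphM /=; ring.
congr (_ * _%:C); rewrite mulrCA; congr (_ * _).
by rewrite -{3}(sqr_sqrtr (ltW a0)) expr2 mulrA mulVf// mul1r.
Qed.

End rational.

(** * The extremizer *)

Section eigen_transform.
Context {R : realType}.
Local Notation mu := (@lebesgue_measure R).

(** The function [F] is integrable, so [f], its inverse transform, is the boundary value
    on the real line of the Laplace transform of [F], which is a simple fraction. *)
Lemma shift_eigen_Mop (f F : R -> R[i]) : L2 f -> L2 F -> nrm F = nrm f ->
  nrm f ^+ 2 = 2 * pi ->
  {ae mu, forall x, fourier F x = f (- x)} ->
  {ae mu, forall z, z < 0 -> F z = 0} ->
  (forall a : R, 0 <= a -> exists c, {ae mu, forall z, tshift a F z = c * F z}) ->
  exists alpha beta theta : R, 0 < alpha /\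
    {ae mu, forall x, f x = Mop alpha beta 0 theta ratR x}.
Proof.
move=> f2 F2 Fn fn Finv Fsupp Fshift.
(* a representative of [F] that vanishes everywhere on the negative half line *)
pose g z := ind `[0, +oo[ z * F z.
have mI : measurable (`[0, +oo[%classic : set R) by exact: measurable_itv.
have g2 : L2 g by exact: L2_indM.
have Fg : {ae mu, forall z, F z = g z}.
  apply: ae_imp Fsupp => z h; rewrite /g; have [z0|z0] := ltP z 0.
    by rewrite h// mulr0.
  by rewrite ind_in ?mul1r//= in_itv/= z0.
have gn : nrm g = nrm f by rewrite -Fn; apply/esym; apply: nrm_ae; [exact: F2.1|exact: g2.1|exact: Fg].
have gn0 : 0 < nrm g.
  rewrite lt_neqAle nrm_ge0 andbT eq_sym gn; apply/eqP => n0.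
  by move: fn; rewrite n0 expr0n /= => /esym/eqP; rewrite gt_eqF// pi2_gt0.
have g0 (z : R) : z < 0 -> g z = 0.
  by move=> z0; rewrite /g ind_out ?mul0r//= in_itv/= andbT leNgt z0.
have /choice[c cP] : forall a : R, exists c, 0 <= a -> {ae mu, forall z, tshift a F z = c * F z}.
  move=> a; have [a0|a0] := leP 0 a; last by exists 0.
  by have [c hc] := Fshift _ a0; exists c.
have hc a : 0 <= a -> {ae mu, forall z, tshift a g z = c a * g z}.
  move=> a0; apply: ae_imp2 (cP a a0) Fg => z e1 e2; rewrite -e2 -e1 /tshift.
  have [z0|z0] := ltP z 0; first by rewrite ind_out ?mul0r//= in_itv/= andbT leNgt z0.
  by rewrite /g [ind _ (z + a)]ind_in ?mul1r//= in_itv/= andbT addr_ge0.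
have g1 : L1 g by exact: (eigenfunction_L1 g2 gn0 g0 hc).
have fL : {ae mu, forall x, f x = kap * lap g x 0}.
  have h1 := ae_imp2 (fun x e1 e2 => etrans (esym e1) e2) (fourier_ae F2 g2 Fg) Finv.
  have h2 := ae_imp2 (fun x e1 e2 => etrans (esym e1) e2) h1 (fourier_L1 g1 g2).
  have h3 : {ae mu, forall x, f (- - x) = FT g (- x)}.
    exact: (ae_preserving mu_preserving_opp h2).
  apply: ae_imp h3 => x; rewrite opprK => ->; rewrite /FT /lap; congr (_ * cI _).
  apply/funext => z; rewrite mulrC; congr (_ * _).
  by rewrite /fker /cexp oppr0 mul0r expR0 mulrN opprK mul1r mulrC.
(* otherwise [f] would vanish almost everywhere, against its norm *)
have ex : exists x, lap g x 0 != 0.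
  apply: contrapT => h; have f0 : {ae mu, forall x, f x = 0}.
    apply: ae_imp fL => x ->; have [->|n0] := eqVneq (lap g x 0) 0; first by rewrite mulr0.
    by exfalso; apply: h; exists x.
  have : nrm f = 0.
    rewrite (nrm_ae (g := fun x => 0 * f x) f2.1 (L2Z 0 f2).1).
      by rewrite nrmZ// normc0 mul0r.
    by apply: ae_imp f0 => x ->; rewrite mulr0.
  by apply/eqP; rewrite -gn gt_eqF.
have [rho [C LC]] := lap_rational g1 g0 hc ex.
exact: (rational_Mop f2 fn fL LC).
Qed.

End eigen_transform.

Theorem theorem5p17 (R : realType) (f_ : nat -> R -> R[i]) (f : R -> R[i])
    (hf_ : forall n, hardyL2 (f_ n))
    (hnorm : forall n, (L2norm (f_ n) ^+ 2 = (2 * pi)%:E)%E)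
    (hf : L2 f)
    (hcvg : L2norm (f_ n \- f) @[n --> \oo] --> 0%E)
    (hdelta : forall A : R, 0 <= A -> delta A (f_ n) @[n --> \oo] --> 0%E) :
  exists alpha beta theta : R, 0 < alpha /\
    {ae @lebesgue_measure R, forall x, f x = Mop alpha beta 0 theta ratR x}.
Proof.
apply: (shift_eigen_Mop hf (fourier_L2 hf) (plancherel hf)).
- exact: (limit_norm hf_ hnorm hf hcvg).
- exact: (fourier_inversion hf).
- exact: (limit_hardy hf_ hf hcvg).
- exact: (limit_shift hf_ hnorm hf hcvg hdelta).
Qed.
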